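(* Let $\varepsilon_g,\varepsilon_H>0$. Assume that the retraction is second-order, that $f$ is $(\alpha,\beta,\gamma,\delta)$-strict saddle on $\mathcal{M}$ with $\mathcal{R}_3$ compact, that the pullback cubic bound holds with constant $L_H$ along the iterates, that $\|H_k\|\le\kappa_H$ for all iterates, and that there is $f^*>-\infty$ with $f(x)\ge f^*$ for all $x\in\mathcal{M}$. Then the Riemannian trust-region algorithm with exact subproblem minimization produces an iterate $x$ satisfying $\|\mathrm{grad} f(x)\|\le\varepsilon_g$ and $\lambda_{\min}(\mathrm{Hess} f(x))\ge-\varepsilon_H$ in at most $$\frac{C}{\min\left(\underline{\alpha}^2,\underline{\alpha}^{4/3}\underline{\beta},\underline{\alpha}^{4/3}\underline{\gamma},\underline{\alpha}^{2/3}\underline{\gamma}^2,\underline{\beta}^3,\underline{\beta}^2\underline{\gamma},\underline{\beta}\,\underline{\gamma}^2,\underline{\gamma}^3,\underline{\gamma}^2\underline{\delta}\right)}+1+\log_2\log_2\left(\frac{2\gamma^2}{\kappa_R\hat L_H\varepsilon_g}\right)$$ successful iterations, where the constant $C>0$ depends on $\kappa_H,c_\Delta,\Delta_0,\nu_R,\kappa_R,\hat L_H,\eta_1,c_Q$, and $\underline{\theta}=\min(1,\theta)$ for any $\theta\in\{\alpha,\beta,\gamma,\delta\}$.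
   Context: Setting. $\mathcal{M}$ is an $n$-dimensional Riemannian manifold with Riemannian distance $\mathrm{dist}$; $f:\mathcal{M}\to\mathbb{R}$ is twice continuously differentiable with Riemannian gradient $\mathrm{grad} f$ and Riemannian Hessian $\mathrm{Hess} f$; $\lambda_{\min}$ denotes the smallest eigenvalue. A retraction $R_x:T_x\mathcal{M}\to\mathcal{M}$ is given, possibly defined only on the ball of radius $\varrho(x)>0$ around $0\in T_x\mathcal{M}$. The pullback at $x$ is $\hat f_x=f\circ R_x$, and $\hat f_k=\hat f_{x_k}$; $\nabla,\nabla^2$ denote its Euclidean gradient and Hessian on the tangent space. The retraction is second-order if each curve $t\mapsto R_x(ts)$ has zero intrinsic acceleration at $t=0$ (then $\nabla^2\hat f_x(0)=\mathrm{Hess} f(x)$). Strict saddle. A set $S\subset\mathcal{M}$ is geodesically convex if any two points of $S$ are joined by a geodesic segment contained in $S$; $f$ is geodesically $\gamma$-strongly convex on $S$ if $S$ is geodesically convex and for each geodesic $c:[0,1]\to S$ of length $L(c)>0$, $f\circ c$ is strongly convex with modulus $\gamma L(c)^2$. For $\alpha,\beta,\gamma,\delta>0$ let $\mathcal{R}_1=\{x:\|\mathrm{grad} f(x)\|\ge\alpha\}$, $\mathcal{R}_2=\{x:\lambda_{\min}(\mathrm{Hess} f(x))\le-\beta\}$, and $\mathcal{R}_3$ the set of $x$ for which there is a local minimizer $x^*$ of $f$ with $\mathrm{dist}(x,x^* )\le\delta$ and $f$ geodesically $\gamma$-strongly convex on $\{y:\mathrm{dist}(x^*,y)<2\delta\}$.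 $f$ is $(\alpha,\beta,\gamma,\delta)$-strict saddle if $\mathcal{M}=\mathcal{R}_1\cup\mathcal{R}_2\cup\mathcal{R}_3$. Algorithm (Riemannian trust-region, exact subproblem). Inputs: $x_0\in\mathcal{M}$, $0<\Delta_0<\bar\Delta$, $0<\eta_1<\eta_2<1$, $0<\tau_1<1<\tau_2$. For $k=0,1,2,\dots$: with $g_k=\mathrm{grad} f(x_k)$, $H_k=\nabla^2\hat f_k(0)$ and $m_k(s)=f(x_k)+\langle s,g_k\rangle+\frac12\langle s,H_ks\rangle$, let $s_k$ be a global minimizer of $m_k$ over $\{s\in T_{x_k}\mathcal{M}:\|s\|\le\Delta_k\}$. Let $\rho_k=\frac{f(x_k)-f(R_{x_k}(s_k))}{m_k(0)-m_k(s_k)}$. Set $x_{k+1}=R_{x_k}(s_k)$ if $\rho_k\ge\eta_1$ (the iteration is then called successful), $x_{k+1}=x_k$ otherwise. Set $\Delta_{k+1}=\min(\tau_2\Delta_k,\bar\Delta)$ if $\rho_k>\eta_2$, $\Delta_{k+1}=\Delta_k$ if $\eta_2\ge\rho_k\ge\eta_1$, $\Delta_{k+1}=\tau_1\Delta_k$ otherwise. Pullback cubic bound with constant $L_H>0$: for all iterates $x_k$ and all $s\in T_{x_k}\mathcal{M}$ with $\|s\|\le\varrho(x_k)$, $f(R_{x_k}(s))\le f(x_k)+\langle s,\mathrm{grad} f(x_k)\rangle+\frac12\langle s,\nabla^2\hat f_k(0)[s]\rangle+\frac{L_H}{6}\|s\|^3$; moreover $\Delta_k\le\varrho(x_k)$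 for all $k$. Constants (they exist when $\mathcal{R}_3$ is compact). $\hat L_H>0$ is such that $\|\nabla\hat f_k(s_k)-\nabla\hat f_k(0)-\nabla^2\hat f_k(0)[s_k]\|\le\frac{\hat L_H}{2}\|s_k\|^2$ for all iterates $x_k\in\mathcal{R}_3$. $\kappa_R>1$ and $\nu_R>0$ are such that $\|\mathrm{grad} f(R_x(s))\|\le\kappa_R\|\nabla\hat f_x(s)\|$ for $x\in\mathcal{R}_3$, $\|s\|\le\nu_R$. $\nu_S,\kappa_S>0$ are such that $\mathrm{dist}(x,R_x(s))\le\kappa_S\|s\|$ for $x\in\mathcal{R}_3$, $\|s\|\le\nu_S$. $c_\Delta=\min\left(1,\tau_1\sqrt{\tfrac{3(1-\eta_1)}{L_H}},\tau_1\sqrt[3]{\tfrac{3(1-\eta_1)}{\kappa_HL_H}},3\tau_1\tfrac{1-\eta_1}{L_H}\right)$ and $c_Q=\min\left(\tfrac{3(1-\eta_1)}{L_H},\nu_R,\tfrac1{\kappa_S},\tfrac12,\tfrac1{\kappa_R\hat L_H}\right)$.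
   Formalization: The constant C is allowed to depend also on f(x_0)-f^* (the bound is false otherwise), and the term log_2 log_2(2γ²/(κ_R L̂_H ε_g)) is replaced by its maximum with 0, since it is undefined or arbitrarily negative when its argument is below 2. *)

(* Defs.v *)
From HB Require Import structures.
From mathcomp Require Import all_boot all_order all_algebra.
From mathcomp Require Import all_classical all_reals all_analysis.
Import Order.TTheory GRing.Theory Num.Theory.
Import numFieldNormedType.Exports.

Set Implicit Arguments.
Unset Strict Implicit.
Unset Printing Implicit Defensive.

Local Open Scope classical_set_scope.
Local Open Scope ring_scope.

Section EuclideanSpace.
Context {R : realType}.

Definition basis_vec {n : nat} (i : 'I_n) : 'rV[R]_n := delta_mx 0 i.

(* [Ck k U g]: all iterated partial derivatives of [g] of order at most [k]
   exist and are continuous on [U]. Only used for open [U]. *)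
Fixpoint Ck {n : nat} (k : nat) (U : set 'rV[R]_n) (g : 'rV[R]_n -> R) : Prop :=
  (forall u, U u -> {for u, continuous g}) /\
  if k is k'.+1 then
    forall i : 'I_n, (forall u, U u -> derivable g u (basis_vec i)) /\
      Ck k' U (fun u => 'D_(basis_vec i) g u)
  else True.

Definition smooth {n : nat} (U : set 'rV[R]_n) (g : 'rV[R]_n -> R) : Prop :=
  forall k, Ck k U g.

Definition partials {n : nat} (g : 'rV[R]_n -> R) (u : 'rV[R]_n) : 'rV[R]_n :=
  \row_i 'D_(basis_vec i) g u.

(* A matrix [A] stands for the operator [v |-> v *m A], as in [eigenvalue].
   It is only applied to operators that are self-adjoint for some inner product;
   for them the set below is finite, and nonempty as soon as [0 < n]. *)
Definition lambda_min {n : nat} (A : 'M[R]_n) : R :=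
  inf [set a : R | eigenvalue A a].

Definition strongly_convex01 (mu : R) (h : R -> R) : Prop :=
  forall a b t : R, 0 <= a <= 1 -> 0 <= b <= 1 -> 0 <= t <= 1 ->
    h ((1 - t) * a + t * b) <=
      (1 - t) * h a + t * h b - mu / 2 * t * (1 - t) * (b - a) ^+ 2.

Definition log2 (a : R) : R := ln a / ln 2.

End EuclideanSpace.

(* A smooth manifold with an atlas indexed by its points: [chart p], defined on
   the open set [chart_dom p] containing [p], is the preferred chart around [p]
   (any atlas can be so indexed, with repetitions). *)
Record manifold (R : realType) (n : nat) : Type := Manifold {
  carrier :> topologicalType;
  carrier_hausdorff : hausdorff_space carrier;
  carrier_second_countable : @second_countable carrier;
  chart_dom : carrier -> set carrier;
  chart_cod : carrier -> set 'rV[R]_n;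
  chart : carrier -> carrier -> 'rV[R]_n;
  chart_inv : carrier -> 'rV[R]_n -> carrier;
  mem_chart_dom : forall p, chart_dom p p;
  open_chart_dom : forall p, open (chart_dom p);
  open_chart_cod : forall p, open (chart_cod p);
  chart_fun : forall p x, chart_dom p x -> chart_cod p (chart p x);
  chart_inv_fun : forall p u, chart_cod p u -> chart_dom p (chart_inv p u);
  chartK : forall p x, chart_dom p x -> chart_inv p (chart p x) = x;
  chart_invK : forall p u, chart_cod p u -> chart p (chart_inv p u) = u;
  continuous_chart : forall p x, chart_dom p x -> {for x, continuous (chart p)};
  continuous_chart_inv : forall p u, chart_cod p u ->
    {for u, continuous (chart_inv p)};
  chart_compatible : forall p q j,
    smooth [set u | chart_cod p u /\ chart_dom q (chart_inv p u)]
      (fun u => chart q (chart_inv p u) 0 j)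
}.

(* The matrix sending components in the chart at [p] of a vector tangent at
   [chart_inv p u] to its components in the chart at [q]. *)
Definition transition (R : realType) (n : nat) (M : manifold R n)
    (p q : M) (u : 'rV[R]_n) : 'M[R]_n :=
  'J (fun w => chart q (chart_inv p w)) u.

(* [gram p u] is the matrix of the metric at [chart_inv p u] in the chart at
   [p]. *)
Record riemannian_manifold (R : realType) (n : nat) : Type :=
  RiemannianManifold {
  smooth_base :> manifold R n;
  gram : smooth_base -> 'rV[R]_n -> 'M[R]_n;
  gram_smooth : forall p i j, smooth (chart_cod p) (fun u => gram p u i j);
  gram_sym : forall p u, chart_cod p u -> (gram p u)^T = gram p u;
  gram_pos : forall p u (v : 'rV[R]_n), chart_cod p u -> v != 0 ->
    0 < (v *m gram p u *m v^T) 0 0;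
  gram_compatible : forall p q u,
    chart_cod p u -> chart_dom q (chart_inv p u) ->
    gram p u = transition p q u *m gram q (chart q (chart_inv p u))
                 *m (transition p q u)^T
}.

(* The tangent space at [x] is ['rV[R]_n]: a tangent vector at [x] is given by
   its components in the preferred chart at [x]. *)
Section RiemannianGeometry.
Context {R : realType} {n : nat} {M : riemannian_manifold R n}.

Definition gram_at (x : M) : 'M[R]_n := gram x (chart x x).

Definition inner (x : M) (v w : 'rV[R]_n) : R := (v *m gram_at x *m w^T) 0 0.

Definition tnorm (x : M) (v : 'rV[R]_n) : R := Num.sqrt (inner x v v).

Definition opnorm (x : M) (A : 'M[R]_n) : R :=
  sup [set tnorm x (v *m A) | v in [set v | tnorm x v <= 1]].

Definition christoffel (p : M) (u : 'rV[R]_n) (i j k : 'I_n) : R :=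
  2^-1 * \sum_l invmx (gram p u) k l *
    ('D_(basis_vec i) (fun w => gram p w j l) u +
     'D_(basis_vec j) (fun w => gram p w i l) u -
     'D_(basis_vec l) (fun w => gram p w i j) u).

Definition christoffel_form (p : M) (u v w : 'rV[R]_n) : 'rV[R]_n :=
  \row_k \sum_i \sum_j v 0 i * w 0 j * christoffel p u i j k.

Definition covariant_derivative (p : M) (X : 'rV[R]_n -> 'rV[R]_n)
    (u v : 'rV[R]_n) : 'rV[R]_n :=
  'D_v X u + christoffel_form p u v (X u).

Definition coord_curve (p : M) (c : R -> M) (t : R) : 'rV[R]_n := chart p (c t).

Definition velocity (c : R -> M) (t : R) : 'rV[R]_n :=
  derive1 (coord_curve (c t) c) t.

Definition acceleration (c : R -> M) (t : R) : 'rV[R]_n :=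
  derive1n 2 (coord_curve (c t) c) t +
  christoffel_form (c t) (chart (c t) (c t)) (velocity c t) (velocity c t).

(* Curves are total functions on [R] of which only the restriction to [[0, 1]]
   matters. At the endpoints the derivatives are two-sided, i.e. the curve comes
   with an extension beyond [[0, 1]]; this is no restriction, as a C^1 curve (or
   a geodesic) on [[0, 1]] always has such an extension. *)
Definition C1_curve (c : R -> M) : Prop :=
  forall t, 0 <= t <= 1 ->
    {for t, continuous c} /\
    forall p, chart_dom p (c t) ->
      (\forall s \near t, derivable (coord_curve p c) s 1) /\
      {for t, continuous (derive1 (coord_curve p c))}.

Definition geodesic (c : R -> M) : Prop :=
  C1_curve c /\
  forall t, 0 <= t <= 1 ->
    derivable (derive1 (coord_curve (c t) c)) t 1 /\ acceleration c t = 0.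

Definition curve_length (c : R -> M) : R :=
  \int[lebesgue_measure]_(t in `[0, 1]) tnorm (c t) (velocity c t).

(* A piecewise C^1 curve is the list of its C^1 pieces, each parametrized by
   [[0, 1]]. *)
Fixpoint piecewise_C1_joins (x : M) (cs : seq (R -> M)) (y : M) : Prop :=
  if cs is c :: cs' then
    [/\ C1_curve c, c 0 = x & piecewise_C1_joins (c 1) cs' y]
  else x = y.

(* [M] is not assumed connected: the distance between points of distinct
   components is [+oo]. *)
Definition dist (x y : M) : \bar R :=
  ereal_inf [set (\sum_(c <- cs) curve_length c)%:E
            | cs in [set cs | piecewise_C1_joins x cs y]].

Definition C2_on_manifold (f : M -> R) : Prop :=
  forall p, Ck 2 (chart_cod p) (fun u => f (chart_inv p u)).

Definition grad_chart (f : M -> R) (p : M) (u : 'rV[R]_n) : 'rV[R]_n :=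
  partials (fun w => f (chart_inv p w)) u *m invmx (gram p u).

Definition grad (f : M -> R) (x : M) : 'rV[R]_n := grad_chart f x (chart x x).

(* [v *m hess f x] is the covariant derivative of the gradient along [v]. *)
Definition hess (f : M -> R) (x : M) : 'M[R]_n :=
  \matrix_i covariant_derivative x (grad_chart f x) (chart x x) (basis_vec i).

Definition local_minimizer (f : M -> R) (x : M) : Prop :=
  \forall y \near x, f x <= f y.

Definition curve_in (c : R -> M) (S : set M) : Prop :=
  forall t, 0 <= t <= 1 -> S (c t).

Definition geodesically_convex (S : set M) : Prop :=
  forall x y, S x -> S y ->
    exists c, [/\ geodesic c, c 0 = x, c 1 = y & curve_in c S].

Definition geodesically_strongly_convex (f : M -> R) (gamma : R) (S : set M) :
    Prop :=
  geodesically_convex S /\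
  forall c, geodesic c -> curve_in c S -> 0 < curve_length c ->
    strongly_convex01 (gamma * curve_length c ^+ 2) (fun t => f (c t)).

Definition region1 (f : M -> R) (alpha : R) : set M :=
  [set x | alpha <= tnorm x (grad f x)].

Definition region2 (f : M -> R) (beta : R) : set M :=
  [set x | lambda_min (hess f x) <= - beta].

Definition region3 (f : M -> R) (gamma delta : R) : set M :=
  [set x | exists xs, [/\ local_minimizer f xs, (dist x xs <= delta%:E)%E &
    geodesically_strongly_convex f gamma
      [set y | (dist xs y < (2 * delta)%:E)%E]]].

Definition strict_saddle (f : M -> R) (alpha beta gamma delta : R) : Prop :=
  region1 f alpha `|` region2 f beta `|` region3 f gamma delta = setT.

(* A map on the tangent bundle in the charts: the first half of [w] is a point
   in the chart at [p], the second half the components in that chart of a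
   vector tangent at this point. *)
Definition bundle_map (retr : M -> 'rV[R]_n -> M) (p : M) (w : 'rV[R]_(n + n)) :
    M :=
  let x := chart_inv p (lsubmx w) in
  retr x (rsubmx w *m transition p x (lsubmx w)).

Definition bundle_map_smooth_at (retr : M -> 'rV[R]_n -> M) (x : M)
    (s : 'rV[R]_n) : Prop :=
  forall q, chart_dom q (retr x s) ->
  exists U : set 'rV[R]_(n + n),
    [/\ open U, U (row_mx (chart x x) s),
        forall w, U w ->
          chart_cod x (lsubmx w) /\ chart_dom q (bundle_map retr x w) &
        forall j, smooth U (fun w => chart q (bundle_map retr x w) 0 j)].

(* [retr x] only matters on the closed ball of radius [rad x] (possibly [+oo]);
   smoothness at the boundary means smoothness of an extension. *)
Record is_retraction (retr : M -> 'rV[R]_n -> M) (rad : M -> \bar R) : Prop :=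
  IsRetraction {
  retr_radius : forall x, (0 < rad x)%E;
  retr_smooth : forall x s, ((tnorm x s)%:E <= rad x)%E ->
    bundle_map_smooth_at retr x s;
  retr_center : forall x, retr x 0 = x;
  retr_rigid : forall x v, is_derive 0 v (fun s => chart x (retr x s)) v
}.

Definition second_order_retraction (retr : M -> 'rV[R]_n -> M) : Prop :=
  forall x (s : 'rV[R]_n), acceleration (fun t => retr x (t *: s)) 0 = 0.

Definition pullback (f : M -> R) (retr : M -> 'rV[R]_n -> M) (x : M)
    (s : 'rV[R]_n) : R :=
  f (retr x s).

Definition pullback_grad (f : M -> R) (retr : M -> 'rV[R]_n -> M) (x : M)
    (s : 'rV[R]_n) : 'rV[R]_n :=
  partials (pullback f retr x) s *m invmx (gram_at x).

Definition pullback_hess (f : M -> R) (retr : M -> 'rV[R]_n -> M) (x : M)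
    (s : 'rV[R]_n) : 'M[R]_n :=
  \matrix_i 'D_(basis_vec i) (pullback_grad f retr x) s.

Definition model (f : M -> R) (retr : M -> 'rV[R]_n -> M) (x : M)
    (s : 'rV[R]_n) : R :=
  f x + inner x s (grad f x) +
  2^-1 * inner x s (s *m pullback_hess f retr x 0).

Definition decrease_ratio (f : M -> R) (retr : M -> 'rV[R]_n -> M) (x : M)
    (s : 'rV[R]_n) : R :=
  (f x - f (retr x s)) / (model f retr x 0 - model f retr x s).

Record rtr_run (f : M -> R) (retr : M -> 'rV[R]_n -> M) (x0 : M)
    (Delta0 Deltabar eta1 eta2 tau1 tau2 : R)
    (x : nat -> M) (Delta : nat -> R) (s : nat -> 'rV[R]_n) : Prop := RtrRun {
  run_x0 : x 0%N = x0;
  run_Delta0 : Delta 0%N = Delta0;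
  run_step_feasible : forall k, tnorm (x k) (s k) <= Delta k;
  run_step_minimizer : forall k v, tnorm (x k) v <= Delta k ->
    model f retr (x k) (s k) <= model f retr (x k) v;
  run_next_x : forall k, x k.+1 =
    if eta1 <= decrease_ratio f retr (x k) (s k) then retr (x k) (s k) else x k;
  run_next_Delta : forall k, Delta k.+1 =
    if eta2 < decrease_ratio f retr (x k) (s k)
    then Num.min (tau2 * Delta k) Deltabar
    else if eta1 <= decrease_ratio f retr (x k) (s k) then Delta k
    else tau1 * Delta k
}.

(* Number of successful iterations among the iterations [0, .., k - 1]. *)
Definition successful_before (f : M -> R) (retr : M -> 'rV[R]_n -> M) (eta1 : R)
    (x : nat -> M) (s : nat -> 'rV[R]_n) (k : nat) : nat :=
  (\sum_(j < k) (eta1 <= decrease_ratio f retr (x j) (s j))%R)%N.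

Definition pullback_cubic_bound (f : M -> R) (retr : M -> 'rV[R]_n -> M)
    (rad : M -> \bar R) (L_H : R) (x : nat -> M) : Prop :=
  forall k s, ((tnorm (x k) s)%:E <= rad (x k))%E ->
    f (retr (x k) s) <=
      f (x k) + inner (x k) s (grad f (x k)) +
      2^-1 * inner (x k) s (s *m pullback_hess f retr (x k) 0) +
      L_H / 6 * tnorm (x k) s ^+ 3.

End RiemannianGeometry.

Section Constants.
Context {R : realType}.

Definition minimum (a : R) (s : seq R) : R := foldl Num.min a s.

Definition c_Delta (eta1 tau1 L_H kappa_H : R) : R :=
  minimum 1 [:: tau1 * Num.sqrt (3 * (1 - eta1) / L_H);
                tau1 * (3 * (1 - eta1) / (kappa_H * L_H)) `^ 3^-1;
                3 * tau1 * ((1 - eta1) / L_H)].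

Definition c_Q (eta1 L_H nu_R kappa_S kappa_R Lhat_H : R) : R :=
  minimum (3 * (1 - eta1) / L_H)
    [:: nu_R; kappa_S^-1; 2^-1; (kappa_R * Lhat_H)^-1].

Definition saddle_min (alpha beta gamma delta : R) : R :=
  let a := Num.min 1 alpha in let b := Num.min 1 beta in
  let g := Num.min 1 gamma in let d := Num.min 1 delta in
  minimum (a ^+ 2)
    [:: a `^ (4 / 3) * b; a `^ (4 / 3) * g; a `^ (2 / 3) * g ^+ 2;
        b ^+ 3; b ^+ 2 * g; b * g ^+ 2; g ^+ 3; g ^+ 2 * d].

(* The number of quadratically convergent steps. The iterated logarithm is
   negative for [1 < a < 2] (tending to [-oo] at [1]) and undefined for
   [a <= 1]; in both cases no such step is needed. *)
Definition loglog2 (a : R) : R := Num.max 0 (log2 (log2 a)).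

End Constants.

(* Main.v *)
Require Import Defs.
From HB Require Import structures.
From mathcomp Require Import all_boot all_order all_algebra.
From mathcomp Require Import all_classical all_reals all_analysis.
From mathcomp Require Import ring lra.
Import Order.TTheory GRing.Theory Num.Theory.
Import numFieldNormedType.Exports.

Set Implicit Arguments.
Unset Strict Implicit.
Unset Printing Implicit Defensive.

Local Open Scope classical_set_scope.
Local Open Scope ring_scope.

(** Why the bound holds. Before the target is reached, the trust-region radius
    stays above a multiple of the minimum of [alpha ^ (2/3)], [beta] and [gamma]
    (all thresholds being capped at 1), because a rejection forces the cubic error
    to exceed a fraction of the model decrease [radius_rejection]. An iterate with a
    large gradient, or with a direction of negative curvature, or close to a
    minimizer but with a step that is not short, then has a large model decrease,
    and each success there lowers [f] by a fixed multiple of [saddle_min]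
    [long_step_success]. Since [f] is bounded below, this happens a bounded number
    of times.

    There remain the short steps near a minimizer. They are Newton steps, always
    accepted, after which the gradient norm is quadratic in the step length
    [short_step]. The next iterate does not have a large gradient. If it has
    negative curvature, its next success lowers [f] and pays for the short step as
    well. Otherwise it is again close to a minimizer, with a gradient norm less than
    [gamma * delta], and from then on the iterates are trapped: by strong convexity
    the value of [f] at the iterate is too small for a path on which [f] does not
    exceed it to leave the ball of radius [delta], and [t |-> R_x (t s)] is such a
    path [strong_convexity_trap], [descent_path]. So all later iterates stay
    in this phase, where the normalized gradient norm is at least squared at each
    iteration, starting from at most 1/2; this gives the iterated logarithm
    [newton_phaseS]. The count is kept by [rtr_invariant]. If the target were never
    reached, all iterations would eventually be rejected and the radius would tend
    to 0, contradicting its lower bound [rtr_iteration_bound].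

    Strong convexity is a hypothesis on geodesics, whereas the algorithm sees the
    Hessian of the pullback. The bridge has two parts. Since the retraction is of
    second order, the Hessians of [f] and of the pullback define the same quadratic
    form [pullback_hess_quadratic]. And this form is bounded below by [gamma]
    because it is the second derivative of [f] along geodesics
    [strong_convexity_hess]; that requires a geodesic in every direction, obtained
    from the Picard-Lindelof theorem in a chart [geodesic_exists], and the
    invariance of the geodesic equation under changes of charts
    [geodesic_transport]. *)

(** * Calculus in R^n *)

Section RowNorm.
Context {R : realType}.

Lemma row_coord_le {n : nat} (v : 'rV[R]_n) i : `|v 0 i| <= `|v|.
Proof.
rewrite [leRHS]/Num.Def.normr/= mx_normrE.
exact: (le_bigmax _ (fun ij : 'I_1 * 'I_n => `|v ij.1 ij.2|) (0, i)).
Qed.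

Lemma row_norm_le {n : nat} (v : 'rV[R]_n) c :
  0 <= c -> (forall i, `|v 0 i| <= c) -> `|v| <= c.
Proof.
move=> c0 vc; rewrite [leLHS]/Num.Def.normr/= mx_normrE.
by apply: bigmax_le => // -[i j] _ /=; rewrite ord1.
Qed.

Lemma sum_basis {n : nat} i (h : 'I_n -> R) :
  \sum_k (basis_vec i : 'rV[R]_n) 0 k * h k = h i.
Proof.
rewrite (bigD1 i)//= big1 ?addr0; first by rewrite mxE !eqxx mul1r.
by move=> k ki; rewrite mxE (negbTE ki) andbF mul0r.
Qed.

Lemma row_continuous {T : topologicalType} {n : nat} (F : T -> 'rV[R]_n) (x : T) :
  (forall i, {for x, continuous (fun y => F y 0 i)}) -> {for x, continuous F}.
Proof.
move=> Fi; apply/cvgrPdist_le => /= e e0; near=> y.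
apply: row_norm_le; first exact: ltW.
move=> i; rewrite !mxE; move: i; near: y; apply: filter_forall => i.
by have /cvgrPdist_le/(_ _ e0) := Fi i.
Unshelve. all: by end_near. Qed.

Lemma cvg_fsum {T : Type} (F : set_system T) {FF : Filter F} {I : Type}
    (r : seq I) (g : I -> T -> R) (l : I -> R) :
  (forall i, g i y @[y --> F] --> l i) ->
  \sum_(i <- r) g i y @[y --> F] --> \sum_(i <- r) l i.
Proof. by move=> gl; apply: cvg_big => //; exact: add_continuous. Qed.

Lemma continuous_fsum {T : topologicalType} {I : Type} (r : seq I)
    (g : I -> T -> R) (x : T) : (forall i, {for x, continuous (g i)}) ->
  {for x, continuous (fun y => \sum_(i <- r) g i y)}.
Proof. by move=> gc; apply: (@cvg_fsum T (nbhs x)) => i; exact: gc. Qed.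

Lemma continuous_coord {T : topologicalType} {n : nat} (F : T -> 'rV[R]_n) (x : T) i :
  {for x, continuous F} -> {for x, continuous (fun y => F y 0 i)}.
Proof.
move=> Fx; apply: (@continuous_comp _ _ _ F (fun M : 'rV[R]_n => M 0 i)) => //.
exact: coord_continuous.
Qed.

End RowNorm.

(** Differentiability, with a differential that was guessed beforehand: here in
    coordinates, from the partial derivatives. *)
Lemma diff_intro {R : realType} {V W : normedModType R} (f : V -> W)
    (df : {linear V -> W}) (x : V) : continuous df ->
  (forall e, 0 < e -> \forall h \near (0 : V),
     `|f (x + h) - f x - df h| <= e * `|h|) ->
  differentiable f x /\ 'd f x = df :> (V -> W).
Proof.
move=> dfc H.
have E : f \o shift x = cst (f x) + (df : _ -> _) +o_ 0 id.
  apply/eqaddoP => e e0; have := H e e0; apply: filterS => h.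
  by rewrite /= !fctE/= [h + x]addrC opprD addrA.
have D := diff_unique dfc E.
by split=> //; apply/diff_locallyP; rewrite D.
Qed.

Lemma near_continuous {T U : topologicalType} (f g : T -> U) x :
  (\forall y \near x, f y = g y) -> {for x, continuous f} ->
  {for x, continuous g}.
Proof.
move=> fg fx; rewrite /prop_for/continuous_at -(nbhs_singleton fg).
by apply: cvg_trans fx; apply: near_eq_cvg; apply: filterS fg => y ->.
Qed.

Lemma continuous_near_le {R : realType} {T : topologicalType} (F : T -> R) x e :
  {for x, continuous F} -> 0 < e -> \forall y \near x, `|F y - F x| <= e.
Proof.
move=> Fx e0; have /cvgrPdist_le/(_ _ e0) := Fx.
by apply: filterS => y; rewrite distrC.
Qed.

Lemma mean_value {R : realType} (h dh : R -> R) (a b : R) : a <= b ->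
  (forall t, t \in `[a, b] -> is_derive t 1 h (dh t)) ->
  exists2 t, t \in `[a, b] & h b - h a = dh t * (b - a).
Proof.
move=> ab D.
have C : {within `[a, b], continuous h}.
  by apply: (@derivable_within_continuous _ _ h `[a, b]) => t /D[].
exact: (@MVT_segment R h dh a b ab (fun t tc => D t (subset_itv_oo_cc tc)) C).
Qed.

Lemma is_derive_derive1 {R : realType} {W : normedModType R} (c : R -> W) (t : R) :
  derivable c t 1 -> is_derive t 1 c (derive1 c t).
Proof. by rewrite derive1E; exact: derivableP. Qed.

Lemma is_derive_reparam {R : realType} {W : normedModType R} (h : R -> W) (g : R -> R)
    (k t : R) dh :
  is_derive t 1 g k -> is_derive (g t) 1 h dh -> is_derive t 1 (fun s => h (g s)) (k *: dh).
Proof.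
move=> [dg gE] [dh1 dhE].
have Dg : differentiable g t by exact/derivable1_diffP.
have Dh : differentiable h (g t) by exact/derivable1_diffP.
have D : differentiable (h \o g) t by exact: differentiable_comp.
apply: DeriveDef; first exact/derivable1_diffP.
rewrite (deriveE _ D) diff_comp//= -(deriveE _ Dg) gE -{1}[k]mulr1.
by rewrite -[k * 1]/(k *: 1) linearZ/= -deriveE// dhE.
Qed.

Section Lines.
Context {R : realType} {V : normedModType R}.

Lemma is_derive_line (W : normedModType R) (g : V -> W) (a v : V) (t : R) :
  derivable g (a + t *: v) v ->
  is_derive t 1 (fun t => g (a + t *: v)) ('D_v g (a + t *: v)).
Proof.
have E : (fun h : R => h^-1 *: (g (a + (h *: 1 + t) *: v) - g (a + t *: v))) =
         (fun h : R => h^-1 *: (g (h *: v + (a + t *: v)) - g (a + t *: v))).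
  by apply/funext => h; rewrite [h *: 1]mulr1 scalerDl addrCA.
move=> dg; apply: DeriveDef; first by rewrite /derivable E.
by rewrite /derive E.
Qed.

Lemma is_derive_affine (u v : V) (t : R) : is_derive t 1 (fun s : R => u + s *: v) v.
Proof.
have D : is_derive t (1 : R) (fun s : R => s *: v) (1 *: v).
  apply: DeriveDef; first exact/derivable1_diffP.
  by rewrite deriveE// diff_val.
have := is_deriveD (is_derive_cst u t (1 : R)) D.
by rewrite add0r scale1r.
Qed.

Lemma MVT_line (g : V -> R) (a v : V) (c : R) :
  (forall t, `|t| <= `|c| -> derivable g (a + t *: v) v) ->
  exists2 t, `|t| <= `|c| & g (a + c *: v) - g a = c * 'D_v g (a + t *: v).
Proof.
move=> dg; have D t tc := is_derive_line (dg t tc).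
have [c0|c0] := leP 0 c.
  have H t : t \in `[0, c] -> `|t| <= `|c|.
    by rewrite in_itv/= => /andP[t0 tc]; rewrite !ger0_norm.
  have [t tc E] := mean_value c0 (fun t tc => D t (H t tc)).
  exists t; first exact: H.
  by move: E; rewrite scale0r addr0 subr0 mulrC.
have H t : t \in `[c, 0] -> `|t| <= `|c|.
  rewrite in_itv/= => /andP[t0 tc].
  by rewrite (ler0_norm tc) (ler0_norm (ltW c0)) lerN2.
have [t tc E] := mean_value (ltW c0) (fun t tc => D t (H t tc)).
exists t; first exact: H.
move/eqP: E; rewrite scale0r addr0 sub0r eq_sym => /eqP E.
by rewrite -opprB -E mulrN opprK mulrC.
Qed.

End Lines.

Section C1.
Context {R : realType} {n : nat}.
Implicit Types (U : set 'rV[R]_n) (g : 'rV[R]_n -> R).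

Definition D1form g (u v : 'rV[R]_n) : R := \sum_i v 0 i * 'D_(basis_vec i) g u.

Definition D2form g (u v w : 'rV[R]_n) : R :=
  \sum_i \sum_j v 0 i * w 0 j * 'D_(basis_vec i) ('D_(basis_vec j) g) u.

Lemma D1form_basis g u i : D1form g u (basis_vec i) = 'D_(basis_vec i) g u.
Proof. exact: sum_basis. Qed.

Lemma Ck_cont k U g u : Ck k U g -> U u -> {for u, continuous g}.
Proof. by case: k => [|k] [H _]; exact: H. Qed.

Lemma Ck_derivable k U g i u : Ck k.+1 U g -> U u -> derivable g u (basis_vec i).
Proof. by move=> [_ /(_ i)[H _]]; exact: H. Qed.

Lemma Ck_partial k U g i : Ck k.+1 U g -> Ck k U ('D_(basis_vec i) g).
Proof. by move=> [_ /(_ i)[_ H]]. Qed.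

Lemma CkW k U g : Ck k.+1 U g -> Ck k U g.
Proof.
elim: k g => [|k IH] g [H1 H2]; first by split.
split=> // i; split; first by have [] := H2 i.
by apply: IH; have [] := H2 i.
Qed.

Lemma Ck1S k U g : Ck k.+1 U g -> Ck 1 U g.
Proof. by elim: k => // k IH /CkW. Qed.

Let trunc (k : nat) (h : 'rV[R]_n) : 'rV[R]_n :=
  \row_i (if (i < k)%N then h 0 i else 0).

Let truncS (i : 'I_n) h : trunc i.+1 h = trunc i h + h 0 i *: basis_vec i.
Proof.
apply/rowP => j; rewrite !mxE eqxx/= ltnS.
have [->|ji] := eqVneq j i; first by rewrite leqnn ltnn mulr1 add0r.
by rewrite mulr0 addr0 leq_eqVlt (negbTE (_ : j != i :> nat)).
Qed.

Lemma C1_near_partials U g u e : open U -> Ck 1 U g -> U u -> 0 < e ->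
  \forall w \near u, U w /\
    forall i, `|'D_(basis_vec i) g w - 'D_(basis_vec i) g u| <= e.
Proof.
move=> oU cg Uu e0; apply: filterI; first exact: open_nbhs_nbhs.
apply: (@filter_forall _ 'I_n
  (fun i w => `|'D_(basis_vec i) g w - 'D_(basis_vec i) g u| <= e) (nbhs u) _) => i.
exact: continuous_near_le (Ck_cont (Ck_partial i cg) Uu) e0.
Qed.

(** Moving from [u] to [u + h] one coordinate at a time, the mean value theorem
    yields partial derivatives at points close to [u], and these are close to the
    partial derivatives at [u]. *)
Lemma C1_increment U g u : open U -> Ck 1 U g -> U u ->
  forall e, 0 < e -> \forall h \near (0 : 'rV[R]_n),
    `|g (u + h) - g u - D1form g u h| <= e * `|h|.
Proof.
move=> oU cg Uu e e0.
pose e' := e / n.+1%:R.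
have e'0 : 0 < e' by rewrite divr_gt0// ltr0n.
have /nbhs_normP[r /= r0 Hr] := C1_near_partials oU cg Uu e'0.
near=> h.
have hr : `|h| < r.
  near: h; exact: (@nbhs0_lt R 'rV[R]_n r r0).
have step (i : 'I_n) : `|g (u + trunc i.+1 h) - g (u + trunc i h)
    - h 0 i * 'D_(basis_vec i) g u| <= e' * `|h|.
  have Ht t : `|t| <= `|h 0 i| ->
      U (u + trunc i h + t *: basis_vec i) /\
      forall j, `|'D_(basis_vec j) g (u + trunc i h + t *: basis_vec i)
                 - 'D_(basis_vec j) g u| <= e'.
    move=> th; apply: Hr => /=.
    rewrite -addrA opprD addNKr normrN.
    apply: le_lt_trans hr; apply: row_norm_le => // j; rewrite !mxE eqxx/=.
    case: (eqVneq j i) => [->|ji].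
      by rewrite ltnn add0r mulr1 (le_trans th)// row_coord_le.
    by rewrite mulr0 addr0; case: ifP => _; rewrite ?normr0// row_coord_le.
  rewrite truncS addrA.
  have [t th ->] := @MVT_line _ _ g (u + trunc i h) (basis_vec i) (h 0 i)
    (fun t th => Ck_derivable cg (Ht t th).1).
  rewrite -mulrBr normrM mulrC.
  by apply: ler_pM => //; [exact: (Ht t th).2|exact: row_coord_le].
have tele : g (u + h) - g u = \sum_(i < n) (g (u + trunc i.+1 h) - g (u + trunc i h)).
  rewrite -(big_mkord xpredT (fun i => g (u + trunc i.+1 h) - g (u + trunc i h))).
  rewrite telescope_sumr//; congr (g (u + _) - g _).
    by apply/rowP => j; rewrite mxE ltn_ord.
  by rewrite -[LHS]addr0; congr (u + _); apply/rowP => j; rewrite !mxE.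
rewrite tele -sumrB; apply: le_trans (ler_norm_sum _ _ _) _.
apply: (@le_trans _ _ (\sum_(i < n) e' * `|h|)).
  by apply: ler_sum => i _; exact: step.
rewrite sumr_const card_ord -mulr_natl mulrA ler_wpM2r//.
by rewrite /e' mulrCA ler_piMr ?(ltW e0)// ler_pdivrMr ?ltr0n// mul1r ler_nat.
Unshelve. all: by end_near. Qed.

Lemma C1_diff U g u : open U -> Ck 1 U g -> U u ->
  differentiable g u /\
  forall h, 'd g u h = D1form g u h.
Proof.
move=> oU cg Uu; pose df := D1form g u.
have df_lin : linear df.
  move=> a x y; rewrite /df /D1form scaler_sumr -big_split/=; apply: eq_bigr => i _.
  by rewrite !mxE mulrDl -mulrA.
pose dfM := GRing.isLinear.Build _ _ _ _ _ df_lin.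
pose dfL : {linear 'rV[R]_n -> R} := HB.pack df dfM.
have dfc : continuous dfL.
  move=> x; apply: continuous_fsum => i; apply: continuousM; last exact: cst_continuous.
  exact: coord_continuous.
have [dg D] : differentiable g u /\ 'd g u = dfL :> (_ -> _).
  by apply: diff_intro => // e e0; exact: C1_increment oU cg Uu e e0.
by split=> // h; rewrite D.
Qed.

Lemma C1_differentiable U g u : open U -> Ck 1 U g -> U u -> differentiable g u.
Proof. by move=> oU cg Uu; have [] := C1_diff oU cg Uu. Qed.

Lemma C1_deriveE U g u v : open U -> Ck 1 U g -> U u ->
  'D_v g u = D1form g u v.
Proof. by move=> oU cg Uu; have [dg E] := C1_diff oU cg Uu; rewrite deriveE. Qed.

End C1.

Section CkAlgebra.
Context {R : realType} {n : nat}.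
Implicit Types (U : set 'rV[R]_n) (g h : 'rV[R]_n -> R).

Lemma eq_Ck k U g h : open U -> (forall u, U u -> g u = h u) ->
  Ck k U g -> Ck k U h.
Proof.
move=> oU; elim: k g h => [|k IH] g h gh [gc gd].
  split=> // u Uu; apply: near_continuous (gc u Uu).
  exact: filterS gh (open_nbhs_nbhs (conj oU Uu)).
have near_gh u : U u -> \forall w \near u, g w = h w.
  by move=> Uu; exact: filterS gh (open_nbhs_nbhs (conj oU Uu)).
split=> [u Uu|i]; first by apply: near_continuous (gc u Uu); exact: near_gh.
have [dg Cg] := gd i; split.
  by move=> u Uu; apply: near_eq_derivable (dg u Uu); exact: near_gh.
by apply: IH Cg => u Uu; apply: near_eq_derive; exact: near_gh.
Qed.

Lemma Ck_cst k U (c : R) : Ck k U (fun=> c).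
Proof.
elim: k c => [|k IH] c; first by split=> // u _; exact: cst_continuous.
split=> // [u _|i]; first exact: cst_continuous.
split; first by move=> u _; exact: derivable_cst.
have -> : 'D_(basis_vec i) (fun=> c) = (fun=> 0 : R) :> ('rV[R]_n -> R).
  by apply/funext => u; exact: derive_cst.
exact: IH.
Qed.

Lemma CkD k U g h : open U -> Ck k U g -> Ck k U h ->
  Ck k U (fun u => g u + h u).
Proof.
move=> oU; elim: k g h => [|k IH] g h [gc gd] [hc hd].
  by split=> // u Uu; apply: continuousD; [exact: gc|exact: hc].
split=> // [u Uu|i]; first by apply: continuousD; [exact: gc|exact: hc].
have [dg Cg] := gd i; have [dh Ch] := hd i; split=> [u Uu|].
    by apply: derivableD; [exact: dg|exact: dh].
  apply: eq_Ck (IH _ _ Cg Ch) => // u Uu /=.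
  by rewrite -deriveD//; [exact: dg|exact: dh].
Qed.

Lemma CkM k U g h : open U -> Ck k U g -> Ck k U h ->
  Ck k U (fun u => g u * h u).
Proof.
move=> oU; elim: k g h => [|k IH] g h Cg Ch.
  split=> // u Uu.
  by apply: continuousM; [exact: Ck_cont Cg Uu|exact: Ck_cont Ch Uu].
split=> [u Uu|i].
  by apply: continuousM; [exact: Ck_cont Cg Uu|exact: Ck_cont Ch Uu].
split=> [u Uu|].
  by apply: derivableM; [exact: Ck_derivable Cg Uu|exact: Ck_derivable Ch Uu].
apply: (@eq_Ck _ _ (fun u => g u * 'D_(basis_vec i) h u + h u * 'D_(basis_vec i) g u)) => //.
  move=> u Uu /=.
  by rewrite deriveM//; [exact: Ck_derivable Cg Uu|exact: Ck_derivable Ch Uu].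
by apply: CkD => //; apply: IH; do ?[exact: CkW|exact: Ck_partial].
Qed.

Lemma Ck_sum k U (I : Type) (r : seq I) (g : I -> 'rV[R]_n -> R) : open U ->
  (forall i, Ck k U (g i)) -> Ck k U (fun u => \sum_(i <- r) g i u).
Proof.
move=> oU Cg; elim: r => [|i r IH].
  by apply: eq_Ck (Ck_cst k U 0) => // u _; rewrite big_nil.
by apply: eq_Ck (CkD oU (Cg i) IH) => // u _; rewrite big_cons.
Qed.

Lemma Ck_prod k U (I : Type) (r : seq I) (g : I -> 'rV[R]_n -> R) : open U ->
  (forall i, Ck k U (g i)) -> Ck k U (fun u => \prod_(i <- r) g i u).
Proof.
move=> oU Cg; elim: r => [|i r IH].
  by apply: eq_Ck (Ck_cst k U 1) => // u _; rewrite big_nil.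
by apply: eq_Ck (CkM oU (Cg i) IH) => // u _; rewrite big_cons.
Qed.

Lemma CkN k U g : open U -> Ck k U g -> Ck k U (fun u => - g u).
Proof.
move=> oU Cg; apply: eq_Ck (CkM oU (Ck_cst k U (-1)) Cg) => // u _ /=.
by rewrite mulN1r.
Qed.

Lemma CkB k U g h : open U -> Ck k U g -> Ck k U h ->
  Ck k U (fun u => g u - h u).
Proof. by move=> oU Cg Ch; apply: CkD => //; exact: CkN. Qed.

(** The partial derivatives of [1 / g] are products of [1 / g], of itself again,
    and of a partial derivative of [g], so that regularity improves by induction. *)
Lemma CkV k U g : open U -> (forall u, U u -> g u != 0) -> Ck k U g ->
  Ck k U (fun u => (g u)^-1).
Proof.
move=> oU g0; elim: k => [|k IH] Cg.
  by split=> // u Uu; apply: continuousV; [exact: g0|exact: Ck_cont Cg Uu].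
split=> [u Uu|i].
  by apply: continuousV; [exact: g0|exact: Ck_cont Cg Uu].
split=> [u Uu|].
  by apply: derivableV; [exact: g0|exact: Ck_derivable Cg Uu].
have CV := IH (CkW Cg).
apply: (@eq_Ck _ _ (fun u => - ((g u)^-1 * (g u)^-1) * 'D_(basis_vec i) g u)) => //.
  move=> u Uu /=.
  rewrite (@deriveV _ _ g)//; [|exact: g0|exact: Ck_derivable Cg Uu].
  by rewrite -exprVn expr2.
by apply: CkM => //; [apply/CkN/CkM|exact: Ck_partial].
Qed.

Lemma Ck_linear k U (g : {linear 'rV[R]_n -> R}) : continuous g -> Ck k U g.
Proof.
move=> gc; case: k => [|k]; first by split=> // u _; exact: (gc u).
split=> // [u _|i]; first exact: (gc u).
have dg u : differentiable g u by exact: linear_differentiable.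
split; first by move=> u _; exact/diff_derivable.
have -> : 'D_(basis_vec i) g = (fun=> g (basis_vec i)) :> ('rV[R]_n -> R).
  by apply/funext => u; rewrite deriveE// diff_lin.
exact: Ck_cst.
Qed.

Lemma Ck_coord k U i : Ck k U (fun u => u 0 i).
Proof.
have @f : {linear 'rV[R]_n -> R}.
  by exists (fun N : 'rV[R]_n => N 0 i); do 2![eexists]; do ?[constructor];
     rewrite ?mxE// => ? *; rewrite ?mxE//; move=> ?; rewrite !mxE.
have : Ck k U f by apply: Ck_linear; exact: coord_continuous.
exact.
Qed.

End CkAlgebra.

Section CkComp.
Context {R : realType} {n m : nat}.
Implicit Types (U : set 'rV[R]_n) (V : set 'rV[R]_m).

Lemma C1_row_diff U (phi : 'rV[R]_n -> 'rV[R]_m) u : open U ->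
  (forall j, Ck 1 U (fun w => phi w 0 j)) -> U u ->
  differentiable phi u /\
  forall h, 'd phi u h = \row_j D1form (fun w => phi w 0 j) u h.
Proof.
move=> oU Cphi Uu.
pose L j : {linear 'rV[R]_n -> R} := 'd (fun w => phi w 0 j) u.
pose df (h : 'rV[R]_n) : 'rV[R]_m := \row_j L j h.
have df_lin : linear df.
  by move=> a x y; apply/rowP => j; rewrite !mxE linearP.
pose dfM := GRing.isLinear.Build _ _ _ _ _ df_lin.
pose dfL : {linear 'rV[R]_n -> 'rV[R]_m} := HB.pack df dfM.
have Ldiff j : differentiable (fun w => phi w 0 j) u by exact: C1_differentiable (Cphi j) Uu.
have dfc : continuous dfL.
  move=> x; apply: row_continuous => j.
  have -> : (fun y => dfL y 0 j) = L j by apply/funext => y; rewrite mxE.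
  exact: diff_continuous.
have [dphi D] : differentiable phi u /\ 'd phi u = dfL :> (_ -> _).
  apply: diff_intro => // e e0.
  have : forall j, \forall h \near (0 : 'rV[R]_n),
     `|phi (u + h) 0 j - phi u 0 j - L j h| <= e * `|h|.
    move=> j; have := C1_increment oU (Cphi j) Uu e0; apply: filterS => h.
    by rewrite /L; have [_ ->] := C1_diff oU (Cphi j) Uu.
  move=> /(@filter_forall _ 'I_m (fun j (h : 'rV[R]_n) =>
    `|phi (u + h) 0 j - phi u 0 j - L j h| <= e * `|h|) (nbhs (0 : 'rV[R]_n)) _).
  apply: filterS => h H.
  apply: row_norm_le; first by rewrite mulr_ge0// ltW.
  by move=> j; rewrite !mxE.
split=> // h; rewrite D; apply/rowP => j; rewrite !mxE /L.
by have [_ ->] := C1_diff oU (Cphi j) Uu.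
Qed.

(** By the chain rule the partial derivatives of the composite are sums of
    products, to which the induction hypothesis applies. *)
Lemma Ck_comp k U V (phi : 'rV[R]_n -> 'rV[R]_m) (g : 'rV[R]_m -> R) :
  open U -> open V -> (forall u, U u -> V (phi u)) ->
  (forall j, Ck k U (fun u => phi u 0 j)) -> Ck k V g ->
  Ck k U (fun u => g (phi u)).
Proof.
move=> oU oV UV; elim: k g => [|k IH] g Cphi Cg.
  split=> // u Uu; apply: continuous_comp; last exact: Ck_cont Cg (UV _ Uu).
  by apply: row_continuous => j; exact: Ck_cont (Cphi j) Uu.
have Cphi1 j : Ck 1 U (fun u => phi u 0 j) by exact: Ck1S (Cphi j).
have Cg1 := Ck1S Cg.
split=> [u Uu|i].
  apply: continuous_comp; last exact: Ck_cont Cg (UV _ Uu).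
  by apply: row_continuous => j; exact: Ck_cont (Cphi j) Uu.
have dc u : U u -> differentiable (g \o phi) u.
  move=> Uu; apply: differentiable_comp; first by have [] := C1_row_diff oU Cphi1 Uu.
  exact: C1_differentiable oV Cg1 (UV _ Uu).
split=> [u Uu|]; first exact: diff_derivable (dc u Uu).
apply: (@eq_Ck _ _ _ _ (fun u => \sum_j 'D_(basis_vec i) (fun w => phi w 0 j) u * 'D_(basis_vec j) g (phi u))) => //.
  move=> u Uu /=; rewrite (deriveE _ (dc u Uu)).
  have [dphi Ephi] := C1_row_diff oU Cphi1 Uu.
  have [dg Eg] := C1_diff oV Cg1 (UV _ Uu).
  rewrite diff_comp//= Eg; apply: eq_bigr => j _.
  by rewrite Ephi mxE; congr (_ * _); rewrite D1form_basis.
apply: Ck_sum => // j; apply: CkM => //; first exact: Ck_partial.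
by apply: (IH ('D_(basis_vec j) g)); [move=> l; exact: CkW|exact: Ck_partial].
Qed.

End CkComp.

(** * Curves and second derivatives *)

Section DeriveRules.
Context {R : realType} {V : normedModType R}.

Lemma is_derive_fsum {I : Type} (r : seq I) (h : I -> V -> R) (x v : V) (dh : I -> R) :
  (forall i, is_derive x v (h i) (dh i)) ->
  is_derive x v (fun y => \sum_(i <- r) h i y) (\sum_(i <- r) dh i).
Proof.
move=> H; elim: r => [|i r IH].
  rewrite big_nil; have -> : (fun y => \sum_(i <- [::]) h i y) = cst (0 : R).
    by apply/funext => y; rewrite big_nil.
  exact: is_derive_cst.
rewrite big_cons.
have -> : (fun y => \sum_(j <- i :: r) h j y) = h i + (fun y => \sum_(j <- r) h j y).
  by apply/funext => y; rewrite big_cons.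
exact: is_deriveD.
Qed.

Lemma is_derive_mul (f g : V -> R) (x v : V) (df dg : R) :
  is_derive x v f df -> is_derive x v g dg ->
  is_derive x v (fun y => f y * g y) (df * g x + f x * dg).
Proof.
move=> Hf Hg; apply: (@is_derive_eq _ _ _ _ _ _ _ _ (is_deriveM Hf Hg)).
by rewrite /GRing.scale/= addrC; congr (_ + _); rewrite mulrC.
Qed.

Lemma is_derive_congr (f g : V -> R) (x v : V) (df dg : R) :
  is_derive x v f df -> f = g -> df = dg -> is_derive x v g dg.
Proof. by move=> H <- <-. Qed.

End DeriveRules.

Section Curves.
Context {R : realType} {n : nat}.
Implicit Types (U : set 'rV[R]_n) (g : 'rV[R]_n -> R) (c : R -> 'rV[R]_n).

Lemma is_derive_coord {V : normedModType R} (F : V -> 'rV[R]_n) (x v : V) (dF : 'rV[R]_n) j :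
  is_derive x v F dF -> is_derive x v (fun y => F y 0 j) (dF 0 j).
Proof.
move=> [dc <-]; apply: DeriveDef; first by move/derivable_mxP : dc; exact.
by rewrite derive_mx// mxE.
Qed.

Lemma is_derive_row {V : normedModType R} (F : V -> 'rV[R]_n) (x v : V) (dF : 'rV[R]_n) :
  (forall j, is_derive x v (fun y => F y 0 j) (dF 0 j)) -> is_derive x v F dF.
Proof.
move=> H; have dF' : derivable F x v.
  by apply/derivable_mxP => i j; rewrite ord1; have [] := H j.
apply: DeriveDef => //; rewrite derive_mx//; apply/rowP => j; rewrite mxE.
by have [_] := H j.
Qed.

Lemma is_derive1_continuous {W : normedModType R} (F : R -> W) (t : R) (dF : W) :
  is_derive t 1 F dF -> {for t, continuous F}.
Proof. by move=> [dF' _]; apply: differentiable_continuous; exact/derivable1_diffP. Qed.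

Lemma C1_chain U g c (t : R) (dc : 'rV[R]_n) : open U -> Ck 1 U g -> U (c t) ->
  is_derive t 1 c dc ->
  is_derive t 1 (fun s => g (c s)) (D1form g (c t) dc).
Proof.
move=> oU Cg Uc [derc derE].
have [dg Eg] := C1_diff oU Cg Uc.
have diffc : differentiable c t by exact/derivable1_diffP.
have D : differentiable (g \o c) t by exact: differentiable_comp.
apply: DeriveDef; first exact/derivable1_diffP.
by rewrite (deriveE _ D) diff_comp//= Eg -deriveE// derE.
Qed.

(** The second difference is a first difference in the direction [a] of a first
    difference in the direction [b]; two applications of the mean value theorem
    turn it into a mixed second derivative at a point close to [u]. *)
Let second_difference U g u a b : open U -> Ck 2 U g -> U u -> a != b ->
  forall e, 0 < e -> \forall h \near 0^'+,
    `|(g (u + h *: basis_vec b + h *: basis_vec a) - g (u + h *: basis_vec a)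
      - (g (u + h *: basis_vec b) - g u)) / h ^+ 2
     - 'D_(basis_vec b) ('D_(basis_vec a) g) u| <= e.
Proof.
move=> oU Cg Uu ab e e0.
have Ca := Ck_partial a Cg.
have near_u : \forall w \near u, U w /\
    `|'D_(basis_vec b) ('D_(basis_vec a) g) w - 'D_(basis_vec b) ('D_(basis_vec a) g) u| <= e.
  apply: filterI; first exact: open_nbhs_nbhs (conj oU Uu).
  exact: continuous_near_le (Ck_cont (Ck_partial b Ca) Uu) e0.
have /nbhs_normP[r /= r0 Hr] := near_u.
near=> h.
have h0 : 0 < h by near: h; exact: nbhs_right_gt.
have hr : h < r by near: h; exact: nbhs_right_lt.
have inball s t : `|s| <= `|h| -> `|t| <= `|h| ->
    ball_ Num.Def.normr u r (u + s *: basis_vec a + t *: basis_vec b).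
  move=> sh th /=.
  rewrite -addrA opprD addNKr normrN (le_lt_trans _ hr)//.
  apply: row_norm_le; first exact: ltW.
  move=> l; rewrite !mxE eqxx/= -(gtr0_norm h0).
  have [->|la] := eqVneq l a; first by rewrite (negbTE ab) mulr1 mulr0 addr0.
  rewrite mulr0 add0r; case: (l == b); rewrite ?mulr1//. by rewrite mulr0 normr0.
have nn0 : `|0 : R| <= `|h| by rewrite normr0.
have inU s t (sh : `|s| <= `|h|) (th : `|t| <= `|h|) := (Hr _ (inball s t sh th)).1.
have D1 (s : R) : `|s| <= `|h| -> is_derive s 1
    (fun s => g (u + h *: basis_vec b + s *: basis_vec a) - g (u + s *: basis_vec a))
    ('D_(basis_vec a) g (u + h *: basis_vec b + s *: basis_vec a)
     - 'D_(basis_vec a) g (u + s *: basis_vec a)).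
  move=> sh; apply: is_deriveB; apply: is_derive_line; apply: Ck_derivable Cg _.
    by rewrite addrAC; exact: inU.
  by have := inU s 0 sh nn0; rewrite scale0r addr0.
have Hn (s : R) : s \in `[0, h] -> `|s| <= `|h|.
  by rewrite in_itv/= => /andP[s0 sh]; rewrite !ger0_norm// ltW.
have [s sh E] := mean_value (ltW h0) (fun s sh => D1 s (Hn s sh)).
have {}sh := Hn _ sh.
have [t th E2] := @MVT_line _ _ ('D_(basis_vec a) g) (u + s *: basis_vec a) (basis_vec b) h
  (fun t th => Ck_derivable Ca (inU s t sh th)).
rewrite scale0r !addr0 subr0 in E.
rewrite E addrAC E2.
have -> x : h * x * h / h ^+ 2 = x by field; rewrite gt_eqF.
exact: (Hr _ (inball _ _ sh th)).2.
Unshelve. all: by end_near. Qed.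

(** The second difference is symmetric in the two directions. *)
Lemma C2_schwarz U g u i j : open U -> Ck 2 U g -> U u ->
  'D_(basis_vec i) ('D_(basis_vec j) g) u = 'D_(basis_vec j) ('D_(basis_vec i) g) u.
Proof.
move=> oU Cg Uu; have [->//|ij] := eqVneq i j.
apply/eqP; rewrite -subr_eq0 -normr_le0; apply/ler_addgt0Pl => e e0; rewrite addr0.
have e20 : 0 < e / 2 by rewrite divr_gt0.
have ji : j != i by rewrite eq_sym.
have S1 := second_difference oU Cg Uu ji e20.
have S2 := second_difference oU Cg Uu ij e20.
have [h [H1 H2]] := filter_ex (filterI S1 S2).
have Q (p q r t : R) : p - q - (r - t) = p - r - (q - t) by ring.
rewrite Q [X in g X]addrAC in H2.
have T (q x y : R) : `|q - x| <= e / 2 -> `|q - y| <= e / 2 -> `|x - y| <= e.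
  move=> qx qy; rewrite (splitr e) -(subrKA q) addrC.
  by apply: le_trans (ler_normD _ _) _; rewrite addrC lerD// distrC.
exact: T H1 H2.
Qed.

Lemma D2formC U g u v w : open U -> Ck 2 U g -> U u -> D2form g u v w = D2form g u w v.
Proof.
move=> oU Cg Uu; rewrite /D2form exchange_big/=; apply: eq_bigr => i _.
by apply: eq_bigr => j _; rewrite (C2_schwarz j i oU Cg Uu) [v 0 j * _]mulrC.
Qed.

Lemma is_derive_D1form U g c (t : R) (dc e : 'rV[R]_n) : open U -> Ck 2 U g -> U (c t) ->
  is_derive t 1 c dc -> is_derive t 1 (fun s => D1form g (c s) e) (D2form g (c t) dc e).
Proof.
move=> oU Cg Uc Dc; rewrite /D2form exchange_big/=.
apply: is_derive_fsum => j; have D := C1_chain oU (Ck_partial j Cg) Uc Dc.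
apply: is_derive_congr (is_derive_mul (is_derive_cst (e 0 j) _ _) D) (erefl _) _.
rewrite mul0r add0r mulr_sumr; apply: eq_bigr => i _.
by rewrite mulrA [e 0 j * _]mulrC.
Qed.

End Curves.

Section SecondOrder.
Context {R : realType} {n : nat}.
Implicit Types (U : set 'rV[R]_n) (g : 'rV[R]_n -> R) (c : R -> 'rV[R]_n).

Lemma C2_chain2 U g c (t : R) (ddc : 'rV[R]_n) : open U -> Ck 2 U g -> U (c t) ->
  (\forall s \near t, derivable c s 1) -> is_derive t 1 (derive1 c) ddc ->
  (\forall s \near t, derivable (fun s => g (c s)) s 1) /\
  is_derive t 1 (derive1 (fun s => g (c s)))
    (D2form g (c t) (derive1 c t) (derive1 c t) + D1form g (c t) ddc).
Proof.
move=> oU Cg Uc dc ddcE.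
have Cg1 : Ck 1 U g := CkW Cg.
have ct : {for t, continuous c}.
  exact/differentiable_continuous/derivable1_diffP/(nbhs_singleton dc).
have Unear : \forall s \near t, U (c s) by apply: ct; exact: open_nbhs_nbhs.
have first : \forall s \near t, is_derive (s : R) (1 : R) (fun s : R => g (c s))
     (D1form g (c s) (derive1 c s)).
  apply: filterS2 Unear dc => s Us ds.
  by apply: (C1_chain oU Cg1 Us); exact: is_derive_derive1.
split; first by apply: filterS first => s [].
apply: (@near_eq_is_derive _ _ _
  (fun s => D1form g (c s) (derive1 c s))).
  by apply: filterS first => s [_ E]; rewrite [RHS]derive1E E.
have dct := is_derive_derive1 (nbhs_singleton dc).
have S i : is_derive t 1 (fun s => derive1 c s 0 i * 'D_(basis_vec i) g (c s))
   (ddc 0 i * 'D_(basis_vec i) g (c t) +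
    derive1 c t 0 i * D1form ('D_(basis_vec i) g) (c t) (derive1 c t)).
  apply: is_derive_mul; first exact: is_derive_coord.
  exact: (C1_chain oU (Ck_partial i Cg)).
apply: is_derive_congr (is_derive_fsum _ S) _ _ => //.
rewrite big_split/= addrC; congr (_ + _).
rewrite /D2form exchange_big/=; apply: eq_bigr => i _; rewrite mulr_sumr.
by apply: eq_bigr => j _; rewrite mulrCA mulrA.
Qed.

(** Balls are convex, so that two of their points are joined by a segment on which
    the partial derivatives are bounded. *)
Lemma C1_lipschitz U g u : open U -> Ck 1 U g -> U u ->
  exists L r : R, [/\ 0 < L, 0 < r, ball u r `<=` U &
    forall w w', ball u r w -> ball u r w' -> `|g w' - g w| <= L * `|w' - w|].
Proof.
move=> oU Cg Uu.
have /nbhs_ballP[r /= r0 Hr] := C1_near_partials oU Cg Uu ltr01.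
pose L := 1 + \sum_i (1 + `|'D_(basis_vec i) g u|).
have L0 : 0 < L by rewrite /L ltr_wpDr// sumr_ge0// => i _; rewrite addr_ge0.
exists L, r; split=> // [w /Hr[]//|w w' bw bw'].
have seg (t : R) : 0 <= t <= 1 -> ball u r (w + t *: (w' - w)).
  move=> /andP[t0 t1]; rewrite -ball_normE/=.
  have -> : u - (w + t *: (w' - w)) = (1 - t) *: (u - w) + t *: (u - w').
    by apply/rowP => j; rewrite !mxE; ring.
  rewrite -ball_normE/= in bw; rewrite -ball_normE/= in bw'.
  apply: le_lt_trans (ler_normD _ _) _; rewrite !normrZ.
  rewrite (ger0_norm t0) ger0_norm ?subr_ge0//.
  have [->|t0'] := eqVneq t 0; first by rewrite subr0 mul1r mul0r addr0.
  have tp : 0 < t by rewrite lt_neqAle eq_sym t0' t0.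
  have : (1 - t) * `|u - w| <= (1 - t) * r by rewrite ler_wpM2l ?subr_ge0// ltW.
  have : t * `|u - w'| < t * r by rewrite ltr_pM2l.
  move: `|u - w| `|u - w'| => x y; lra.
have D (t : R) : t \in `[0, 1] -> is_derive t 1 (fun t => g (w + t *: (w' - w)))
    (D1form g (w + t *: (w' - w)) (w' - w)).
  rewrite in_itv/= => /seg /Hr[Ut _].
  by rewrite -(C1_deriveE _ oU Cg Ut); apply: is_derive_line; apply: diff_derivable; exact: C1_differentiable oU Cg Ut.
have [t t01] := mean_value ler01 D.
rewrite scale1r scale0r addr0 subr0 mulr1 [w + _]addrC subrK => ->.
apply: le_trans (ler_norm_sum _ _ _) _.
rewrite /L mulrDl mul1r mulr_suml ler_wpDl//; apply: ler_sum => i _.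
rewrite normrM mulrC; apply: ler_pM => //; last exact: row_coord_le.
have [_ /(_ i)] := Hr _ (seg t t01).
rewrite -lerBlDr; apply: le_trans; exact: lerB_dist.
Qed.

End SecondOrder.

Section StronglyConvexFunctions.
Context {R : realType}.

Lemma is_derive1_near {W : normedModType R} (h : R -> W) (a : R) (dh : W) (e : R) :
  is_derive a 1 h dh -> 0 < e ->
  \forall k \near (0 : R), `|h (a + k) - h a - k *: dh| <= e * `|k|.
Proof.
move=> [derh dhE] e0.
have E : 'd h a = ( *:%R^~ dh) :> (R -> W) by rewrite deriv1E// derive1E dhE.
have dl : differentiable h a by exact/derivable1_diffP.
move/diff_locally/eqaddoP : dl => /(_ _ e0); apply: filterS => k.
by rewrite E /= !fctE/= [k + a]addrC opprD addrA.
Qed.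

(** The convexity inequality at [(1 - t) a + t b], divided by [t], tends to this one
    as [t] tends to 0 from the right. *)
Lemma strongly_convex_tangent (mu : R) (h : R -> R) (a b dh : R) :
  strongly_convex01 mu h -> 0 <= a <= 1 -> 0 <= b <= 1 ->
  is_derive a 1 h dh -> h a + dh * (b - a) + mu / 2 * (b - a) ^+ 2 <= h b.
Proof.
move=> cvx a01 b01 dha; apply/ler_addgt0Pr => eps eps0.
pose e := eps / 2 / (`|b - a| + 1).
have ba1 : 0 < `|b - a| + 1 by rewrite ltr_wpDl.
have e0 : 0 < e by rewrite !divr_gt0.
have eb : e * `|b - a| <= eps / 2.
  rewrite -[leRHS](divfK (lt0r_neq0 ba1)) ler_wpM2l ?(ltW e0)//.
  by rewrite lerDl.
pose m := mu / 2 * (b - a) ^+ 2.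
have m1 : 0 < `|m| + 1 by rewrite ltr_wpDl.
have lim : (fun t : R => t * (b - a)) t @[t --> (0 : R)^'+] --> (0 : R).
  rewrite -[X in _ --> X](mul0r (b - a)); apply: cvg_at_right_filter.
  exact: mulrr_continuous.
near (0 : R)^'+ => t.
have t0 : 0 < t by near: t; exact: nbhs_right_gt.
have t1 : t <= 1 by near: t; exact: nbhs_right_le.
have tm : t <= eps / 2 / (`|m| + 1) by near: t; apply: nbhs_right_le; rewrite !divr_gt0.
have K : `|h (a + t * (b - a)) - h a - (t * (b - a)) *: dh| <= e * `|t * (b - a)|.
  by near: t; exact: (lim _ (is_derive1_near dha e0)).
have := cvx a b t a01 b01; rewrite t1 (ltW t0) => /(_ isT).
have -> : (1 - t) * a + t * b = a + t * (b - a) by ring.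
have tm2 : t * `|m| <= eps / 2.
  move: tm; rewrite ler_pdivlMr// mulrDr => tm; apply: le_trans tm.
  by rewrite mulr1 lerDl ltW.
move: K; rewrite ler_norml normrM (gtr0_norm t0) => /andP[K _].
rewrite /GRing.scale/= in K.
set y := h _ in K * => C.
have mm : - `|m| <= m by rewrite -lerNl -normrN ler_norm.
have E : mu / 2 * t * (1 - t) * (b - a) ^+ 2 = t * ((1 - t) * m) by rewrite /m; ring.
rewrite -(ler_pM2l t0).
have : t * (t * m) <= t * (eps / 2).
  rewrite ler_pM2l//; apply: le_trans tm2; rewrite ler_pM2l//; exact: ler_norm.
have : t * (e * `|b - a|) <= t * (eps / 2) by rewrite ler_pM2l.
rewrite -/m E in C *.
move: K C; rewrite -/m; move: (h a) (h b) (e * `|b - a|) => ha hb eb' .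
move=> K C H1 H2; nra.
Unshelve. all: by end_near. Qed.

End StronglyConvexFunctions.

(** * Local existence for ordinary differential equations *)

Section ODE.
Context {R : realType}.

Lemma le0_geometric (x C : R) : (forall k : nat, x <= C / 2 ^+ k) -> x <= 0.
Proof.
move=> H; rewrite leNgt; apply/negP => x0.
have C0 : 0 < C by have := H 0%N; rewrite expr0 divr1; exact: lt_le_trans.
pose k := (Num.truncn (C / x)).+1.
have Ck : C / x < 2 ^+ k.
  apply: lt_trans (truncnS_gt _) _.
  by rewrite -natrX ltr_nat ltn_expl.
have := H k; rewrite leNgt => /negP; apply.
by rewrite ltr_pdivrMr ?exprn_gt0// mulrC -ltr_pdivrMr.
Qed.

(** The sequences [u k - 2 C / 2^k] and [u k + 2 C / 2^k] are monotone and enclose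
    the limit, which is the supremum of the former. *)
Lemma geometric_cauchy (u : nat -> R) (C : R) :
  (forall k, `|u k.+1 - u k| <= C / 2 ^+ k) ->
  exists l, forall k, `|l - u k| <= 2 * C / 2 ^+ k.
Proof.
move=> H.
pose c k := 2 * C / 2 ^+ k.
have cS k : c k.+1 = c k - C / 2 ^+ k.
  by rewrite /c exprS; field; rewrite expf_neq0.
have c0 k : 0 <= c k.
  by rewrite /c -mulrA mulr_ge0// (le_trans _ (H k)).
have mono k m : u k - c k <= u (k + m)%N - c (k + m)%N /\
                u (k + m)%N + c (k + m)%N <= u k + c k.
  elim: m => [|m [IH1 IH2]]; first by rewrite addn0.
  rewrite addnS cS; have := H (k + m)%N; rewrite ler_norml => /andP[H1 H2].
  by split; lra.
have ub k m : u k - c k <= u m + c m.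
  have [km|/ltnW mk] := leqP k m.
    have [+ _] := mono k (m - k)%N; rewrite subnKC// => h.
    by apply: le_trans h _; have := c0 m; lra.
  have [_] := mono m (k - m)%N; rewrite subnKC// => h.
  by apply: le_trans h; have := c0 k; lra.
exists (sup (range (fun k => u k - c k))) => k.
rewrite ler_norml -/(c k); apply/andP; split.
  rewrite lerBrDr addrC; apply: ub_le_sup; last by exists k.
  by exists (u 0%N + c 0%N) => _ [m _ <-].
rewrite lerBlDr addrC; apply: ge_sup; first by exists (u 0%N - c 0%N); exists 0%N.
by move=> _ [m _ <-].
Qed.

Lemma nbhs_dist_le {V : normedModType R} (x : V) (e : R) : 0 < e ->
  \forall y \near x, `|x - y| <= e.
Proof.
by move=> e0; apply/nbhs_ballP; exists e => // y; rewrite -ball_normE/= => /ltW.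
Qed.

Lemma lipschitz_at_continuous {V W : normedModType R} (f : V -> W) (x : V) (C : R) :
  0 < C -> (forall y, `|f x - f y| <= C * `|x - y|) -> {for x, continuous f}.
Proof.
move=> C0 fC; apply/cvgrPdist_le => e e0.
apply: filterS (nbhs_dist_le x (divr_gt0 e0 C0)) => y h.
by apply: le_trans (fC y) _; rewrite mulrC -ler_pdivlMr.
Qed.

Lemma near_norm_lt (a t : R) : `|t| < a -> \forall s \near t, `|s| < a.
Proof.
move=> ta; apply/nbhs_ballP; exists (a - `|t|) => /=; first by rewrite subr_gt0.
move=> s; rewrite -ball_normE/= => ts.
have := ler_normD t (s - t); rewrite subrKC distrC => h.
by apply: le_lt_trans h _; rewrite -ltrBrDl.
Qed.

(** The integrals start at [-1], so that the primitive is differentiable on both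
    sides of 0, and are shifted to vanish at 0. *)
Definition primitive (g : R -> R) (t : R) : R :=
  \int[lebesgue_measure]_(s in [set` `[-1, t]]) g s
  - \int[lebesgue_measure]_(s in [set` `[-1, 0]]) g s.

Lemma primitive0 g : primitive g 0 = 0.
Proof. exact: subrr. Qed.

Lemma is_derive_primitive (g : R -> R) (t : R) : continuous g -> `|t| < 1 ->
  is_derive t 1 (primitive g) (g t).
Proof.
move=> gc; rewrite ltr_norml => /andP[t1 t2].
have ig : lebesgue_measure.-integrable `[-1, 1] (EFin \o g).
  apply: continuous_compact_integrable; first exact: segment_compact.
  exact: continuous_subspaceT.
have [d E] := @continuous_FTC1_closed R g (-1) t 1 t2 ig t1 (gc t).
rewrite derive1E in E.
have D : is_derive t 1 (fun x => \int[lebesgue_measure]_(s in [set` `[-1, x]]) g s) (g t).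
  exact: DeriveDef.
have := is_deriveB D (is_derive_cst (\int[lebesgue_measure]_(s in [set` `[-1, 0]]) g s : R) t 1).
by rewrite subr0.
Qed.

Lemma mean_value_bound (h : R -> R) (a M t : R) : `|t| <= a ->
  (forall s, `|s| <= a -> derivable h s 1 /\ `|'D_1 h s| <= M) ->
  `|h t - h 0| <= `|t| * M.
Proof.
move=> ta H.
have [s st|s st] := @MVT_line R R h 0 1 t.
  by rewrite add0r [s *: 1]mulr1; apply: (H _ _).1; exact: le_trans st ta.
rewrite !add0r ![_ *: 1]mulr1 => ->.
rewrite normrM ler_wpM2l//; apply: (H _ _).2; exact: le_trans st ta.
Qed.

Definition clamp (a b t : R) : R := Num.max a (Num.min b t).

Lemma clamp_itv a b t : a <= b -> a <= clamp a b t <= b.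
Proof.
move=> ab; rewrite /clamp le_max lexx/= ge_max ab/=.
by rewrite ge_min lexx.
Qed.

Lemma clamp_id a b t : a <= t <= b -> clamp a b t = t.
Proof. by move=> /andP[at_ tb]; rewrite /clamp min_r// max_r. Qed.

Lemma clamp_lip a b s t : `|clamp a b s - clamp a b t| <= `|s - t|.
Proof.
have maxl (x y c : R) : `|Num.max c x - Num.max c y| <= `|x - y|.
  have := ler_norm (x - y); have := ler_norm (y - x); rewrite (distrC y).
  by case: (leP c x) => cx; case: (leP c y) => cy h1 h2; rewrite ler_norml; lra.
have minl (x y c : R) : `|Num.min c x - Num.min c y| <= `|x - y|.
  have := ler_norm (x - y); have := ler_norm (y - x); rewrite (distrC y).
  by case: (leP c x) => cx; case: (leP c y) => cy h1 h2; rewrite ler_norml; lra.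
exact: le_trans (maxl _ _ _) (minl _ _ _).
Qed.

End ODE.

Section Picard.
Context {R : realType} {N : nat}.
Variables (F : 'rV[R]_N -> 'rV[R]_N) (y0 : 'rV[R]_N) (L r : R).
Hypotheses (L0 : 0 < L) (r0 : 0 < r).
Hypothesis F_lip : forall w w', ball y0 r w -> ball y0 r w' ->
  `|F w' - F w| <= L * `|w' - w|.

Let rho := r / 2.
Let rho0 : 0 < rho. Proof. by rewrite divr_gt0. Qed.

(** The retraction onto the closed ball of radius [rho]; composed with it, the
    field [F] becomes bounded and Lipschitz on the whole space. *)
Let K (w : 'rV[R]_N) : 'rV[R]_N := \row_i clamp (y0 0 i - rho) (y0 0 i + rho) (w 0 i).

Let K_near w : `|K w - y0| <= rho.
Proof.
apply: row_norm_le; first exact: ltW.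
move=> i; rewrite !mxE ler_norml.
have /(clamp_itv (w 0 i)) : y0 0 i - rho <= y0 0 i + rho by have := rho0; lra.
by move=> /andP[]; lra.
Qed.

Let K_ball w : ball y0 r (K w).
Proof.
rewrite -ball_normE/= distrC; apply: le_lt_trans (K_near w) _.
by rewrite /rho; have := r0; lra.
Qed.

Let K_lip w w' : `|K w' - K w| <= `|w' - w|.
Proof.
apply: row_norm_le => // i; rewrite !mxE; apply: le_trans (clamp_lip _ _ _ _) _.
by have := row_coord_le (w' - w) i; rewrite !mxE.
Qed.

Let K_id w : `|w - y0| <= rho -> K w = w.
Proof.
move=> wy; apply/rowP => i; rewrite mxE; apply: clamp_id.
have := le_trans (row_coord_le (w - y0) i) wy; rewrite !mxE ler_norml => /andP[].
by lra.
Qed.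

Let G w := F (K w).
Let G_lip w w' : `|G w' - G w| <= L * `|w' - w|.
Proof.
apply: le_trans (F_lip (K_ball _) (K_ball _)) _.
by rewrite ler_wpM2l ?(ltW L0).
Qed.

Let B := `|F y0| + L * rho.
Let B0 : 0 <= B. Proof. by rewrite addr_ge0// mulr_ge0 ?ltW. Qed.
Let G_bound w : `|G w| <= B.
Proof.
have := F_lip (ballxx y0 r0) (K_ball w).
rewrite /B -(subrK (F y0) (G w)) => h; apply: le_trans (ler_normD _ _) _.
rewrite addrC lerD2l; apply: le_trans h _.
by rewrite ler_wpM2l ?(ltW L0).
Qed.

Let G_cont : continuous G.
Proof.
by move=> w; apply: (lipschitz_at_continuous L0) => w'; exact: G_lip.
Qed.

(** Half the length of the interval: the three bounds keep the base point of
    [primitive] inside, make the Picard operator contract by [1 / 2], and keep the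
    solution in the ball. *)
Let a := Num.min 2^-1 (Num.min (2 * L)^-1 (rho / (B + 1))).
Let a0 : 0 < a.
Proof.
rewrite !lt_min invr_gt0 ltr0n/= invr_gt0 mulr_gt0//= divr_gt0//.
by rewrite ltr_wpDl.
Qed.
Let a1 : a < 1.
Proof. by rewrite !gt_min invf_lt1// ltr1n. Qed.
Let aL : a * L <= 2^-1.
Proof.
have : a <= (2 * L)^-1 by rewrite !ge_min lexx !orbT.
by rewrite invfM -ler_pdivlMr.
Qed.
Let aB : a * B <= rho.
Proof.
have : a <= rho / (B + 1) by rewrite !ge_min lexx !orbT.
rewrite ler_pdivlMr ?ltr_wpDl//; apply: le_trans.
by rewrite ler_wpM2l ?(ltW a0)// lerDl.
Qed.

(** The iterates are defined for all times, and constant outside [[- a, a]]. *)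
Let cl := clamp (- a) a.
Let clP t : `|cl t| <= a.
Proof.
have /(clamp_itv t) : - a <= a by have := a0; lra.
by rewrite ler_norml.
Qed.
Let cl_cont : continuous cl.
Proof.
move=> t; apply: (lipschitz_at_continuous ltr01) => s.
by rewrite mul1r; exact: clamp_lip.
Qed.
Let cl_id t : `|t| <= a -> cl t = t.
Proof. by rewrite ler_norml; exact: clamp_id. Qed.

Let step (z : R -> 'rV[R]_N) (t : R) : 'rV[R]_N :=
  \row_i (y0 0 i + primitive (fun s => G (z s) 0 i) (cl t)).

Let Gz_cont (z : R -> 'rV[R]_N) i : continuous z -> continuous (fun s => G (z s) 0 i).
Proof.
move=> zc s; apply: (@continuous_coord R R N (fun s => G (z s))).
by apply: continuous_comp; [exact: zc|exact: G_cont].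
Qed.

Let prim_der (z : R -> 'rV[R]_N) i (t : R) : continuous z -> `|t| <= a ->
  is_derive t 1 (primitive (fun s => G (z s) 0 i)) (G (z t) 0 i).
Proof.
move=> zc ta; apply: (@is_derive_primitive _ (fun s => G (z s) 0 i)).
  exact: Gz_cont.
exact: le_lt_trans ta a1.
Qed.

Let step_cont (z : R -> 'rV[R]_N) : continuous z -> continuous (step z).
Proof.
move=> zc t; apply: row_continuous => i.
have E : (fun s => step z s 0 i) =
    (fun s => y0 0 i + primitive (fun s => G (z s) 0 i) (cl s)).
  by apply/funext => s; rewrite mxE.
rewrite E; apply: continuousD; first exact: cst_continuous.
apply: continuous_comp; first exact: cl_cont.
exact: (is_derive1_continuous (prim_der i zc (clP t))).
Qed.

Let step_diff (z z' : R -> 'rV[R]_N) M : continuous z -> continuous z' ->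
  (forall t, `|z' t - z t| <= M) -> forall t, `|step z' t - step z t| <= M / 2.
Proof.
move=> zc zc' zz t.
have M0 : 0 <= M by exact: le_trans (zz 0).
apply: row_norm_le; first by rewrite divr_ge0.
move=> i; rewrite !mxE opprD addrACA subrr add0r.
pose h t := primitive (fun s => G (z' s) 0 i) t - primitive (fun s => G (z s) 0 i) t.
have -> : primitive (fun s => G (z' s) 0 i) (cl t) - primitive (fun s => G (z s) 0 i) (cl t)
   = h (cl t) - h 0 by rewrite /h !primitive0 subrr subr0.
apply: (@le_trans _ _ (`|cl t| * (L * M))).
  apply: (mean_value_bound (clP t)) => s sa.
  have [d ->] := is_deriveB (prim_der i zc' sa) (prim_der i zc sa).
  split => //.
  have := row_coord_le (G (z' s) - G (z s)) i; rewrite !mxE => h1.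
  apply: le_trans h1 _; apply: le_trans (G_lip _ _) _.
  by rewrite ler_wpM2l ?(ltW L0).
apply: (@le_trans _ _ (a * (L * M))).
  by rewrite ler_wpM2r ?mulr_ge0 ?(ltW L0).
by rewrite mulrA mulrC ler_wpM2l.
Qed.

Let step_near (z : R -> 'rV[R]_N) t : continuous z -> `|step z t - y0| <= rho.
Proof.
move=> zc; apply: row_norm_le; first exact: ltW.
move=> i; rewrite !mxE addrAC subrr add0r.
rewrite -[primitive _ _]subr0 -[X in _ - X](primitive0 (fun s => G (z s) 0 i)).
apply: (@le_trans _ _ (`|cl t| * B)).
  apply: (mean_value_bound (clP t)) => s sa.
  have [d ->] := prim_der i zc sa; split=> //.
  exact: le_trans (row_coord_le _ _) (G_bound _).
by apply: le_trans aB; rewrite ler_wpM2r.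
Qed.

Let z := fix z k := if k is k'.+1 then step (z k') else (fun=> y0).

Let z_cont k : continuous (z k).
Proof. by elim: k => [|k IH] /=; [exact: cst_continuous|exact: step_cont]. Qed.

Let z_cauchy k t : `|z k.+1 t - z k t| <= rho / 2 ^+ k.
Proof.
elim: k t => [|k IH] t.
  by rewrite expr0 divr1; exact: (step_near t (@z_cont 0%N)).
have := step_diff (@z_cont k) (@z_cont k.+1) IH t.
by rewrite exprSr invfM mulrA.
Qed.

Theorem picard_lindelof : exists (e : R) (y : R -> 'rV[R]_N),
  [/\ 0 < e, y 0 = y0 &
    forall t, `|t| < e -> ball y0 r (y t) /\ is_derive t 1 y (F (y t))].
Proof.
have lim t : exists l : 'rV[R]_N, forall k, `|l - z k t| <= 2 * rho / 2 ^+ k.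
  have H i : exists l, forall k, `|l - z k t 0 i| <= 2 * rho / 2 ^+ k.
    apply: geometric_cauchy => k.
    have := row_coord_le (z k.+1 t - z k t) i; rewrite !mxE => h.
    exact: le_trans h (z_cauchy _ _).
  pose l i := sval (cid (H i)).
  exists (\row_i l i) => k; apply: row_norm_le.
    by apply: divr_ge0; [apply: mulr_ge0 => //; exact: ltW|exact: exprn_ge0].
  by move=> i; rewrite !mxE; exact: (svalP (cid (H i))).
pose y t := sval (cid (lim t)).
have yz k t : `|y t - z k t| <= 2 * rho / 2 ^+ k.
  exact: (svalP (cid (lim t))).
have y_cont : continuous y.
  move=> t; apply/cvgrPdist_le => e e0.
  have [k hk] : exists k, 2 * rho / 2 ^+ k <= e / 3.
    apply: contrapT => nk.
    suff : e / 3 <= 0 by rewrite leNgt divr_gt0.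
    apply: (@le0_geometric _ _ (2 * rho)) => k.
    by rewrite leNgt; apply/negP => /ltW h; apply: nk; exists k.
  have e30 : 0 < e / 3 by rewrite divr_gt0.
  have /cvgrPdist_le/(_ _ e30) := @z_cont k t.
  apply: filterS => s zts.
  have -> : y t - y s = (y t - z k t) + (z k t - z k s) + (z k s - y s).
    by rewrite !subrKA.
  apply: le_trans (ler_normD _ _) _.
  have h1 := ler_normD (y t - z k t) (z k t - z k s).
  have h2 := le_trans (yz k t) hk; have := le_trans (yz k s) hk.
  rewrite distrC => h3; lra.
have y_fix t : y t = step y t.
  apply/eqP; rewrite -subr_eq0 -normr_le0.
  apply: (@le0_geometric _ _ (2 * rho)) => k.
  have h1 := yz k.+1 t.
  have h2 := step_diff (@z_cont k) y_cont (yz k) t.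
  have -> : y t - step y t = (y t - z k.+1 t) + (z k.+1 t - step y t).
    by rewrite subrKA.
  apply: le_trans (ler_normD _ _) _.
  rewrite [X in _ + X]distrC.
  have -> : 2 * rho / 2 ^+ k = 2 * rho / 2 ^+ k.+1 + 2 * rho / 2 ^+ k / 2.
    by rewrite exprS; field; rewrite expf_neq0.
  exact: lerD.
have y_near t : `|y t - y0| <= rho by rewrite y_fix; exact: step_near.
exists a, y; split=> //.
  rewrite y_fix; apply/rowP => i; rewrite mxE cl_id ?normr0 ?(ltW a0)//.
  by rewrite primitive0 addr0.
move=> t ta; split.
  by rewrite -[y t]K_id.
have E : F (y t) = G (y t) by rewrite /G K_id.
rewrite E; apply: is_derive_row => i.
apply: (@near_eq_is_derive _ _ _ (fun s => y0 0 i + primitive (fun s => G (y s) 0 i) s)).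
  by apply: filterS (near_norm_lt ta) => s /ltW sa; rewrite [in RHS]y_fix mxE cl_id.
have D := is_deriveD (is_derive_cst (y0 0 i : R) t 1) (prim_der i y_cont (ltW ta)).
by rewrite add0r in D.
Qed.

End Picard.

(** * Changes of charts *)

Section Charts.
Context {R : realType} {n : nat} {M : riemannian_manifold R n}.
Implicit Types (p q x y : M).

Lemma chart_cod_center x : chart_cod x (chart x x).
Proof. by apply: chart_fun; exact: mem_chart_dom. Qed.

Lemma near_chart_cod p u : chart_cod p u -> \forall w \near u, chart_cod p w.
Proof. by move=> pu; exact: open_nbhs_nbhs (conj (@open_chart_cod _ _ M p) pu). Qed.

Lemma near_chart_dom p x : chart_dom p x -> \forall y \near x, chart_dom p y.
Proof. by move=> px; exact: open_nbhs_nbhs (conj (@open_chart_dom _ _ M p) px). Qed.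

Definition overlap p q : set 'rV[R]_n :=
  [set u | chart_cod p u /\ chart_dom q (chart_inv p u)].

Definition chart_change p q (u : 'rV[R]_n) : 'rV[R]_n := chart q (chart_inv p u).

Lemma open_overlap p q : open (overlap p q).
Proof.
rewrite openE => u [pu qu].
have A := near_chart_cod pu.
have B := continuous_chart_inv pu (near_chart_dom qu).
exact: filterI A B.
Qed.

Arguments open_overlap p q : clear implicits.

Lemma overlap_chart p q x : chart_dom p x -> chart_dom q x -> overlap p q (chart p x).
Proof. by move=> px qx; split; [exact: chart_fun|rewrite chartK]. Qed.

Lemma Ck_chart_change k p q j : Ck k (overlap p q) (fun u => chart_change p q u 0 j).
Proof. exact: chart_compatible. Qed.

Lemma chart_change_diff p q u : overlap p q u -> differentiable (chart_change p q) u.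
Proof.
move=> Ou; have [] := C1_row_diff (open_overlap p q) (@Ck_chart_change 1%N p q) Ou.
by [].
Qed.

Lemma transitionE p q u : overlap p q u ->
  transition p q u = \matrix_(i, j) 'D_(basis_vec i) (fun w => chart_change p q w 0 j) u.
Proof.
move=> Ou; apply/matrixP => i j; rewrite !mxE.
have [_ ->] := C1_row_diff (open_overlap p q) (@Ck_chart_change 1%N p q) Ou.
by rewrite mxE D1form_basis.
Qed.

Lemma mul_transition p q u v : overlap p q u ->
  v *m transition p q u = 'D_v (chart_change p q) u.
Proof.
move=> Ou; rewrite deriveEjacobian//; exact: chart_change_diff.
Qed.

Lemma coord_curve_near p q (c : R -> M) (t : R) : {for t, continuous c} ->
  chart_dom p (c t) -> chart_dom q (c t) ->
  \forall s \near t, overlap p q (coord_curve p c s) /\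
    coord_curve q c s = chart_change p q (coord_curve p c s).
Proof.
move=> ct pc qc.
have Np : \forall s \near t, chart_dom p (c s).
  exact: (ct _ (near_chart_dom pc)).
have Nq : \forall s \near t, chart_dom q (c s).
  exact: (ct _ (near_chart_dom qc)).
apply: filterS2 Np Nq => s ps qs; split; first exact: overlap_chart.
by rewrite /chart_change /coord_curve chartK.
Qed.

Lemma chart_change_curve p q (u : R -> 'rV[R]_n) (t : R) (du : 'rV[R]_n) :
  overlap p q (u t) -> is_derive t 1 u du ->
  is_derive t 1 (fun s => chart_change p q (u s)) (du *m transition p q (u t)).
Proof.
move=> Ou dut; apply: is_derive_row => j.
have D := C1_chain (open_overlap p q) (@Ck_chart_change 1%N p q j) Ou dut.
apply: is_derive_congr D _ _ => //.
by rewrite mxE transitionE//; apply: eq_bigr => i _; rewrite mxE.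
Qed.

Lemma coord_curve_derive p q (c : R -> M) (t : R) (du : 'rV[R]_n) :
  {for t, continuous c} -> chart_dom p (c t) -> chart_dom q (c t) ->
  is_derive t 1 (coord_curve p c) du ->
  is_derive t 1 (coord_curve q c) (du *m transition p q (chart p (c t))).
Proof.
move=> ct pc qc dut.
have N := coord_curve_near ct pc qc.
apply: (near_eq_is_derive (f := fun s => chart_change p q (coord_curve p c s))).
  by apply: filterS N => s [_ ->].
by apply: chart_change_curve => //; exact: overlap_chart.
Qed.

Lemma transition_id p u : chart_cod p u -> transition p p u = 1%:M.
Proof.
move=> pu; have Ou : overlap p p u by split=> //; exact: chart_inv_fun.
have E (v : 'rV[R]_n) : v *m transition p p u = v.
  rewrite mul_transition// -[RHS](derive_id u v).
  apply: near_eq_derive.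
  apply: filterS (near_chart_cod pu) => w pw.
  by rewrite /chart_change chart_invK.
by apply/row_matrixP => i; rewrite !rowE E mulmx1.
Qed.

Lemma overlap_sym p q u : overlap p q u -> overlap q p (chart_change p q u).
Proof.
move=> [pu qu]; split; first exact: chart_fun.
by rewrite /chart_change chartK//; exact: chart_inv_fun.
Qed.

(** Differentiate the fact that the two changes of charts are inverse to each
    other. *)
Lemma transition_mul p q u : overlap p q u ->
  transition p q u *m transition q p (chart_change p q u) = 1%:M.
Proof.
move=> Ou; have Oq := overlap_sym Ou.
have E (v : 'rV[R]_n) : v *m (transition p q u *m transition q p (chart_change p q u)) = v.
  rewrite mulmxA !mul_transition//.
  have dpq := chart_change_diff Ou; have dqp := chart_change_diff Oq.
  rewrite !deriveE// -[LHS]/(('d (chart_change q p) (chart_change p q u) \o 'd (chart_change p q) u) v).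
  rewrite -diff_comp// -deriveE; last exact: differentiable_comp.
  rewrite -[RHS](derive_id u v); apply: near_eq_derive.
  apply: filterS (open_nbhs_nbhs (conj (open_overlap p q) Ou)) => w [pw qw].
  by rewrite /= /chart_change chartK// chart_invK.
by apply/row_matrixP => i; rewrite !rowE E mulmx1.
Qed.

Lemma transition_unit p q u : overlap p q u -> transition p q u \in unitmx.
Proof.
move=> Ou.
have T := transition_mul Ou.
have [U _] := mulmx1_unit T.
exact: U.
Qed.

Lemma chart_inv_curve_continuous p (u : R -> 'rV[R]_n) (t : R) :
  chart_cod p (u t) -> {for t, continuous u} ->
  {for t, continuous (fun s => chart_inv p (u s))}.
Proof.
move=> pu ut; apply: continuous_comp => //; exact: continuous_chart_inv.
Qed.

(** Curves of the manifold are constructed in one chart, while their regularity is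
    required in all charts. *)
Lemma chart_curve_C1 p q (u : R -> 'rV[R]_n) (t : R) :
  chart_cod p (u t) -> (\forall s \near t, derivable u s 1) ->
  {for t, continuous (derive1 u)} ->
  chart_dom q (chart_inv p (u t)) ->
  let c := fun s => chart_inv p (u s) in
  (\forall s \near t, [/\ overlap p q (u s), derivable u s 1 &
      is_derive s 1 (coord_curve q c) (derive1 u s *m transition p q (u s))]) /\
  {for t, continuous (derive1 (coord_curve q c))}.
Proof.
move=> pu du cdu qu c.
have ut : {for t, continuous u}.
  exact/differentiable_continuous/derivable1_diffP/(nbhs_singleton du).
have Ot : overlap p q (u t) by split.
have NO : \forall s \near t, overlap p q (u s).
  by apply: ut; exact: open_nbhs_nbhs (conj (open_overlap p q) Ot).
have ND : \forall s \near t, is_derive (s : R) (1 : R) (coord_curve q c) (derive1 u s *m transition p q (u s)).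
  apply: filterS2 NO du => s Os ds.
  apply: chart_change_curve; first exact: Os.
  exact: is_derive_derive1.
split.
  near=> s; split; near: s; [exact: NO|exact: du|exact: ND].
apply: (@near_continuous _ _ (fun s => derive1 u s *m transition p q (u s))).
  by apply: filterS ND => s [_ E]; rewrite [RHS]derive1E E.
apply: row_continuous => j.
apply: (@near_continuous _ _ (fun s => \sum_i derive1 u s 0 i * 'D_(basis_vec i) (fun w => chart_change p q w 0 j) (u s))).
  apply: filterS NO => s Os; rewrite mxE; apply: eq_bigr => i _.
  by rewrite transitionE// mxE.
apply: continuous_fsum => i; apply: continuousM; first exact: continuous_coord.
apply: (@continuous_comp _ _ _ u
  (fun v => 'D_(basis_vec i) (fun w => chart_change p q w 0 j) v)) => //.
exact: Ck_cont (Ck_partial i (@Ck_chart_change 1%N p q j)) Ot.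
Unshelve. all: by end_near. Qed.

End Charts.

Arguments open_overlap {R n M} p q.

(** * Inner products on tangent spaces *)

Section Bilinear.
Context {R : realType} {n : nat}.
Implicit Types (G : 'M[R]_n) (u v w : 'rV[R]_n).

Definition bil G v w : R := (v *m G *m w^T) 0 0.

Lemma bilE G v w : bil G v w = \sum_i \sum_j v 0 i * w 0 j * G i j.
Proof.
rewrite /bil mxE exchange_big/=; apply: eq_bigr => j _.
rewrite !mxE mulr_suml; apply: eq_bigr => i _.
by rewrite mulrAC.
Qed.

Lemma bilDl G u v w : bil G (u + v) w = bil G u w + bil G v w.
Proof. by rewrite /bil !mulmxDl mxE. Qed.

Lemma bilDr G u v w : bil G w (u + v) = bil G w u + bil G w v.
Proof. by rewrite /bil linearD/= mulmxDr mxE. Qed.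

Lemma bilZl G a v w : bil G (a *: v) w = a * bil G v w.
Proof. by rewrite /bil -!scalemxAl mxE. Qed.

Lemma bilZr G a v w : bil G w (a *: v) = a * bil G w v.
Proof. by rewrite /bil linearZ/= -scalemxAr mxE. Qed.

Lemma bilNl G v w : bil G (- v) w = - bil G v w.
Proof. by rewrite -scaleN1r bilZl mulN1r. Qed.

Lemma bilNr G v w : bil G w (- v) = - bil G w v.
Proof. by rewrite -scaleN1r bilZr mulN1r. Qed.

Lemma bil0l G w : bil G 0 w = 0.
Proof. by rewrite /bil !mul0mx mxE. Qed.

Lemma bil0r G w : bil G w 0 = 0.
Proof. by rewrite /bil linear0 mulmx0 mxE. Qed.

Lemma bil_mull G (A : 'M[R]_n) v w : bil G (v *m A) w = bil (A *m G) v w.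
Proof. by rewrite /bil mulmxA. Qed.

Lemma bil_mulr G (A : 'M[R]_n) v w : bil G v (w *m A) = bil (G *m A^T) v w.
Proof. by rewrite /bil trmx_mul !mulmxA. Qed.

Lemma bil_tr G v w : bil G^T v w = bil G w v.
Proof.
have E : v *m G^T *m w^T = (w *m G *m v^T)^T by rewrite !trmx_mul trmxK mulmxA.
by rewrite /bil E mxE.
Qed.

Lemma bilC G v w : G^T = G -> bil G v w = bil G w v.
Proof. by move=> GT; rewrite -bil_tr GT. Qed.

Lemma bil_invmx (G : 'M[R]_n) v (r : 'rV[R]_n) : G^T = G -> G \in unitmx ->
  bil G v (r *m invmx G) = \sum_i v 0 i * r 0 i.
Proof.
move=> GT Gu; rewrite bil_mulr trmx_inv GT mulmxV//.
rewrite /bil mulmx1 mxE; apply: eq_bigr => i _; by rewrite mxE.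
Qed.

Lemma bil_bound G v w :
  `|bil G v w| <= (\sum_i \sum_j `|G i j|) * `|v| * `|w|.
Proof.
rewrite bilE !mulr_suml; apply: le_trans (ler_norm_sum _ _ _) _.
apply: ler_sum => i _; rewrite !mulr_suml; apply: le_trans (ler_norm_sum _ _ _) _.
apply: ler_sum => j _; rewrite !normrM mulrC -mulrA ler_wpM2l//.
by apply: ler_pM => //; exact: row_coord_le.
Qed.

Lemma bil_continuous G : continuous (fun v => bil G v v).
Proof.
move=> v; have -> : (fun v => bil G v v) = (fun v => \sum_i \sum_j v 0 i * v 0 j * G i j).
  by apply/funext => w; exact: bilE.
apply: continuous_fsum => i; apply: continuous_fsum => j.
apply: continuousM; last exact: cst_continuous.
by apply: continuousM; exact: coord_continuous.
Qed.

Definition posdef G := forall v, v != 0 -> 0 < bil G v v.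

Lemma posdef_ge0 G v : posdef G -> 0 <= bil G v v.
Proof.
by move=> pG; have [->|/pG/ltW//] := eqVneq v 0; rewrite bil0l.
Qed.

Lemma posdef_unit G : posdef G -> G \in unitmx.
Proof.
move=> pG; rewrite -row_free_unit; apply/inj_row_free => v vG.
apply/eqP; apply: contraT => /pG.
by rewrite /bil vG mul0mx mxE ltxx.
Qed.

Lemma cauchy_schwarz G v w : G^T = G -> posdef G ->
  bil G v w ^+ 2 <= bil G v v * bil G w w.
Proof.
move=> GT pG; have [->|w0] := eqVneq w 0.
  by rewrite !bil0r expr0n mulr0.
have Bw := pG _ w0.
(* the vector is a multiple of the component of [v] orthogonal to [w] *)
have := @posdef_ge0 G (bil G w w *: v - bil G v w *: w) pG.
rewrite !(bilDl, bilDr, bilNl, bilNr, bilZl, bilZr) (bilC w v GT).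
move: (bil G v v) (bil G v w) (bil G w w) Bw => a b c c0 h.
have E : c * (c * a) - b * (c * b) - (c * (b * b) - b * (b * c)) = c * (a * c - b ^+ 2).
  by ring.
have {}h : 0 <= c * (a * c - b ^+ 2) by rewrite -E; apply: le_trans h _; lra.
by move: h; rewrite pmulr_rge0// subr_ge0.
Qed.

(** The form has a positive minimum on the unit sphere, which is compact. *)
Lemma posdef_coercive G : posdef G ->
  exists2 m : R, 0 < m & forall v, m * `|v| ^+ 2 <= bil G v v.
Proof.
move=> pG; pose S : set 'rV[R]_n := [set v | `|v| = 1].
have [[v0 v01]|S0] := pselect (exists v0, S v0); last first.
  exists 1 => // v; rewrite mul1r; have [->|v0] := eqVneq v 0.
    by rewrite normr0 expr0n bil0l.
  case: S0; exists (`|v|^-1 *: v); rewrite /S/= normrZ ger0_norm ?invr_ge0//.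
  by rewrite mulVf// normr_eq0.
have cS : compact S.
  apply: bounded_closed_compact.
    by exists 1; split=> // x x1 v; rewrite /S/= => ->; exact: ltW.
  apply: (preimage_closed (f := fun v : 'rV[R]_n => `|v|) (D := [set 1])).
    by move=> v _; exact: norm_continuous.
  exact: closed_eq.
have S0' : S !=set0 by exists v0.
have cB : {within S, continuous (fun v => bil G v v)}.
  exact/continuous_subspaceT/bil_continuous.
have [v vS vmin] := EVT_min_rV S0' cS cB.
have v0' : v != 0.
  by apply/eqP => vE; move: vS; rewrite inE /S/= vE normr0 => /esym/eqP; rewrite oner_eq0.
exists (bil G v v); first exact: pG.
move=> w; have [->|w0] := eqVneq w 0; first by rewrite normr0 expr0n mulr0 bil0l.
have nw : 0 < `|w| by rewrite normr_gt0.
have := vmin (`|w|^-1 *: w); rewrite inE /S/= normrZ ger0_norm ?invr_ge0//.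
rewrite mulVf ?normr_eq0// => /(_ erefl).
rewrite bilZl bilZr mulrA -invfM -expr2 mulrC ler_pdivlMr ?exprn_gt0//.
Qed.

End Bilinear.

Section Inner.
Context {R : realType} {n : nat} {M : riemannian_manifold R n}.
Implicit Types (x p : M) (u v w : 'rV[R]_n).

Lemma gram_posdef p u : chart_cod p u -> posdef (gram p u).
Proof. by move=> pu v v0; exact: gram_pos. Qed.

Lemma gram_at_posdef x : posdef (gram_at x).
Proof. exact/gram_posdef/chart_cod_center. Qed.

Lemma gram_at_sym x : (gram_at x)^T = gram_at x.
Proof. exact/gram_sym/chart_cod_center. Qed.

Lemma gram_at_unit x : gram_at x \in unitmx.
Proof. exact/posdef_unit/gram_at_posdef. Qed.

Lemma innerE x v w : inner x v w = bil (gram_at x) v w.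
Proof. by []. Qed.

Lemma innerC x v w : inner x v w = inner x w v.
Proof. exact/bilC/gram_at_sym. Qed.

Lemma inner_ge0 x v : 0 <= inner x v v.
Proof. exact/posdef_ge0/gram_at_posdef. Qed.

Lemma tnorm_ge0 x v : 0 <= tnorm x v.
Proof. exact: sqrtr_ge0. Qed.

Lemma sqr_tnorm x v : tnorm x v ^+ 2 = inner x v v.
Proof. by rewrite sqr_sqrtr// inner_ge0. Qed.

Lemma tnorm0 x : tnorm x 0 = 0.
Proof. by rewrite /tnorm innerE bil0l sqrtr0. Qed.

Lemma tnorm_gt0 x v : v != 0 -> 0 < tnorm x v.
Proof. by move=> v0; rewrite sqrtr_gt0; exact: gram_at_posdef. Qed.

Lemma tnormZ x a v : tnorm x (a *: v) = `|a| * tnorm x v.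
Proof.
rewrite /tnorm innerE bilZl bilZr mulrA -expr2 sqrtrM ?sqr_ge0//.
by rewrite sqrtr_sqr.
Qed.

Lemma tnormN x v : tnorm x (- v) = tnorm x v.
Proof. by rewrite -scaleN1r tnormZ normrN1 mul1r. Qed.

Lemma inner_le_tnorm x v w : `|inner x v w| <= tnorm x v * tnorm x w.
Proof.
rewrite -sqrtrM ?inner_ge0// -sqrtr_sqr ler_wsqrtr//.
exact: cauchy_schwarz (gram_at_sym x) (gram_at_posdef x).
Qed.

(** [opnorm] is a supremum, and dominates the values it is taken over only if these
    are bounded. *)
Lemma tnorm_mul_bound x (A : 'M[R]_n) :
  exists K, forall v, tnorm x (v *m A) <= K * tnorm x v.
Proof.
have [m m0 mv] := posdef_coercive (@gram_at_posdef x).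
pose S := \sum_i \sum_j `|(A *m (gram_at x *m A^T)) i j|.
have S0 : 0 <= S by apply: sumr_ge0 => i _; exact: sumr_ge0.
exists (Num.sqrt (S / m)) => v.
rewrite /tnorm -sqrtrM ?divr_ge0 ?(ltW m0)// ler_wsqrtr//.
rewrite innerE bil_mull bil_mulr -mulmxA.
apply: le_trans (ler_norm _) _; apply: le_trans (bil_bound _ _ _) _.
rewrite -/S -!mulrA ler_wpM2l// -expr2 mulrC ler_pdivlMr// mulrC.
exact: mv.
Qed.

Lemma tnorm_mul_le x (A : 'M[R]_n) v : tnorm x (v *m A) <= opnorm x A * tnorm x v.
Proof.
have [->|v0] := eqVneq v 0; first by rewrite mul0mx tnorm0 mulr0.
have tv := tnorm_gt0 x v0.
rewrite -ler_pdivrMr// mulrC -[_^-1]ger0_norm ?invr_ge0 ?tnorm_ge0// -tnormZ.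
rewrite scalemxAl; apply: ub_le_sup.
  have [K HK] := tnorm_mul_bound x A; exists `|K| => _ [w /= w1 <-].
  apply: le_trans (HK w) _; rewrite -[leRHS]mulr1.
  apply: le_trans (ler_wpM2r (tnorm_ge0 _ _) (ler_norm K)) _.
  by rewrite ler_wpM2l.
exists ((tnorm x v)^-1 *: v) => //=.
by rewrite tnormZ ger0_norm ?invr_ge0 ?tnorm_ge0// mulVf// gt_eqF.
Qed.

End Inner.

(** * Length and distance *)

Section Integral01.
Context {R : realType}.

Lemma continuous01_integrable (g : R -> R) :
  (forall t, 0 <= t <= 1 -> {for t, continuous g}) ->
  lebesgue_measure.-integrable `[0, 1] (EFin \o g).
Proof.
move=> gc; apply: continuous_compact_integrable; first exact: segment_compact.
by apply: continuous_in_subspaceT => t; rewrite inE/= in_itv/=; exact: gc.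
Qed.

Lemma integral01_cst (g : R -> R) C : (forall t, 0 <= t <= 1 -> g t = C) ->
  \int[lebesgue_measure]_(t in `[0, 1]) g t = C.
Proof.
move=> gC; rewrite (@eq_Rintegral _ _ _ _ _ (cst C)); last first.
  by move=> t; rewrite inE/= in_itv/=; exact: gC.
by rewrite Rintegral_cst//= lebesgue_measure_itv/= lte_fin ltr01 oppr0 adde0/= mulr1.
Qed.

Lemma integral01_le (g : R -> R) C :
  (forall t, 0 <= t <= 1 -> {for t, continuous g}) ->
  (forall t, 0 <= t <= 1 -> g t <= C) ->
  \int[lebesgue_measure]_(t in `[0, 1]) g t <= C.
Proof.
move=> gc gC; rewrite -[leRHS](@integral01_cst (cst C) C)//.
apply: le_Rintegral => //; first exact: continuous01_integrable.
  by apply: continuous01_integrable => t _; exact: cst_continuous.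
Qed.

End Integral01.

Section Speed.
Context {R : realType} {n : nat} {M : riemannian_manifold R n}.
Implicit Types (p q x y z : M) (c : R -> M).

Lemma gram_transport p q u v w : overlap p q u ->
  bil (gram p u) v w =
  bil (gram q (chart_change p q u)) (v *m transition p q u) (w *m transition p q u).
Proof.
move=> [pu qu]; rewrite (gram_compatible pu qu) bil_mull bil_mulr.
by rewrite /bil !mulmxA.
Qed.

(** The velocity at [t] is defined in the chart at [c t]; its norm may be computed
    in any other chart, as the metric transforms accordingly. *)
Lemma inner_velocity p c (t : R) (du : 'rV[R]_n) : {for t, continuous c} ->
  chart_dom p (c t) -> is_derive t 1 (coord_curve p c) du ->
  inner (c t) (velocity c t) (velocity c t) = bil (gram p (coord_curve p c t)) du du.
Proof.
move=> ct pc D.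
have O : overlap p (c t) (coord_curve p c t) by exact: overlap_chart (mem_chart_dom _).
have [_ E] := coord_curve_derive ct pc (mem_chart_dom _) D.
rewrite (gram_transport _ _ O) -E /velocity derive1E innerE /gram_at.
by rewrite /chart_change /coord_curve chartK.
Qed.

Lemma C1_curve_near c (t : R) p : C1_curve c -> 0 <= t <= 1 -> chart_dom p (c t) ->
  \forall s \near t, [/\ {for s, continuous c}, chart_dom p (c s) &
     derivable (coord_curve p c) s 1].
Proof.
move=> Cc t01 pc; have [ct /(_ p pc)[dc _]] := Cc t t01.
have Np : \forall s \near t, chart_dom p (c s).
  exact: (ct _ (near_chart_dom pc)).
apply: filterS2 (near_join Np) dc => s Nps ds; split=> //; last exact: (nbhs_singleton Nps).
apply: (@near_continuous _ _ (fun s' => chart_inv p (coord_curve p c s'))).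
  by apply: filterS Nps => s' ps'; rewrite /coord_curve chartK.
apply: chart_inv_curve_continuous.
  by apply: chart_fun; exact: (nbhs_singleton Nps).
by apply: differentiable_continuous; exact/derivable1_diffP.
Qed.

Lemma bil_curve_continuous p (u v : R -> 'rV[R]_n) (t : R) : chart_cod p (u t) ->
  {for t, continuous u} -> {for t, continuous v} ->
  {for t, continuous (fun s => bil (gram p (u s)) (v s) (v s))}.
Proof.
move=> pu uc vc.
have -> : (fun s => bil (gram p (u s)) (v s) (v s)) =
   (fun s => \sum_i \sum_j v s 0 i * v s 0 j * gram p (u s) i j).
  by apply/funext => s; exact: bilE.
apply: continuous_fsum => i; apply: continuous_fsum => j; apply: continuousM.
  by apply: continuousM; exact: continuous_coord.
apply: (@continuous_comp _ _ _ u (fun w => gram p w i j)) => //.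
exact: (Ck_cont (gram_smooth p i j 0) pu).
Qed.

Definition speed c (t : R) := tnorm (c t) (velocity c t).

(** The chart in which the velocity is defined moves along the curve. The chart at
    [c t] may be used for all times close to [t], which makes the speed
    continuous and, below, differentiable. *)
Lemma speed_sqr_near c (t : R) : C1_curve c -> 0 <= t <= 1 ->
  \forall s \near t, inner (c s) (velocity c s) (velocity c s) =
    bil (gram (c t) (coord_curve (c t) c s)) (derive1 (coord_curve (c t) c) s)
      (derive1 (coord_curve (c t) c) s).
Proof.
move=> Cc t01; have N := C1_curve_near Cc t01 (mem_chart_dom (c t)).
apply: filterS N => s [cs ps ds].
apply: inner_velocity; [exact: cs|exact: ps|].
exact: is_derive_derive1.
Qed.

Lemma speed_continuous c (t : R) : C1_curve c -> 0 <= t <= 1 ->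
  {for t, continuous (speed c)}.
Proof.
move=> Cc t01; have N := speed_sqr_near Cc t01.
have [ct /(_ _ (mem_chart_dom (c t)))[dc cdc]] := Cc t t01.
have E : \forall s \near t, Num.sqrt (bil (gram (c t) (coord_curve (c t) c s)) (derive1 (coord_curve (c t) c) s)
      (derive1 (coord_curve (c t) c) s)) = speed c s.
  by apply: filterS N => s H; rewrite /speed /tnorm H.
apply: near_continuous E _.
apply: (@continuous_comp _ _ _ (fun s => bil (gram (c t) (coord_curve (c t) c s)) (derive1 (coord_curve (c t) c) s)
      (derive1 (coord_curve (c t) c) s)) (@Num.sqrt R)); last exact: sqrt_continuous.
apply: bil_curve_continuous => //.
- exact: chart_cod_center.
- exact/differentiable_continuous/derivable1_diffP/(nbhs_singleton dc).
Qed.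

Lemma curve_length_ge0 c : 0 <= curve_length c.
Proof. by apply: Rintegral_ge0 => t _; exact: tnorm_ge0. Qed.

Lemma curve_length_le c C : C1_curve c ->
  (forall t, 0 <= t <= 1 -> speed c t <= C) -> curve_length c <= C.
Proof.
by move=> Cc H; apply: integral01_le => // t t01; exact: speed_continuous.
Qed.

Definition reverse c : R -> M := fun t => c (1 - t).

Lemma onem01 (t : R) : 0 <= t <= 1 -> 0 <= 1 - t <= 1.
Proof. by move=> /andP[t0 t1]; rewrite subr_ge0 t1/= gerBl. Qed.

Lemma onem_continuous (t : R) : {for t, continuous (fun s : R => 1 - s)}.
Proof. by apply: continuousB; [exact: cst_continuous|exact: cvg_id]. Qed.

Lemma near_onem (P : set R) (t : R) : (\forall s \near 1 - t, P s) ->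
  \forall s \near t, P (1 - s).
Proof. exact: (@onem_continuous t). Qed.

Lemma coord_reverse_derive c p (t : R) : derivable (coord_curve p c) (1 - t) 1 ->
  is_derive t 1 (coord_curve p (reverse c)) (- derive1 (coord_curve p c) (1 - t)).
Proof.
rewrite -[X in is_derive _ _ _ X]scaleN1r => d.
have D1 : is_derive t 1 (fun s : R => 1 - s) (-1 : R).
  have := is_deriveB (is_derive_cst (1 : R) t 1) (is_derive_id t (1 : R)).
  by rewrite sub0r.
exact: (@is_derive_reparam _ _ (coord_curve p c) _ _ _ _ D1 (is_derive_derive1 d)).
Qed.

Lemma C1_reverse c : C1_curve c -> C1_curve (reverse c).
Proof.
move=> Cc t t01; have [ct H] := Cc _ (onem01 t01); split.
  by apply: (@continuous_comp R R M (fun s : R => 1 - s) c t); [exact: onem_continuous|].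
move=> p pc; have [dc cdc] := H p pc.
have N : \forall s \near t, derivable (coord_curve p c) (1 - s) 1.
  exact: (near_onem dc).
split; first by apply: filterS N => s /coord_reverse_derive[].
apply: (@near_continuous R 'rV[R]_n (fun s => - derive1 (coord_curve p c) (1 - s))).
  by apply: filterS N => s /coord_reverse_derive[_ E]; rewrite [RHS]derive1E E.
apply: continuousN.
by apply: (@continuous_comp _ _ _ (fun s : R => 1 - s) (derive1 (coord_curve p c)));
  [exact: onem_continuous|exact: cdc].
Qed.

Lemma speed_reverse c (t : R) : C1_curve c -> 0 <= t <= 1 ->
  speed (reverse c) t = speed c (1 - t).
Proof.
move=> Cc t01; have [ct H] := Cc _ (onem01 t01).
have [dc cdc] := H _ (mem_chart_dom (c (1 - t))).
have [_ E] := coord_reverse_derive (nbhs_singleton dc).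
by rewrite /speed /velocity [X in tnorm _ X]derive1E E tnormN.
Qed.

Lemma curve_length_reverse c : C1_curve c -> curve_length (reverse c) = curve_length c.
Proof.
move=> Cc; rewrite [RHS](Rintegration_by_substitution_onem (r := 1)); last 2 first.
- by rewrite ler01 lexx.
- apply: continuous_in_subspaceT => t; rewrite inE/= in_itv/=; exact: speed_continuous.
rewrite unstable.onem1; apply: eq_Rintegral => t; rewrite inE/= in_itv/= => t01.
exact: speed_reverse.
Qed.

Lemma joins_cat x y z cs cs' : piecewise_C1_joins x cs y ->
  piecewise_C1_joins y cs' z -> piecewise_C1_joins x (cs ++ cs') z.
Proof. by elim: cs x => [x /= ->//|c cs IH x /= [? ? /IH H /H]]. Qed.

Lemma joins_reverse x y cs : piecewise_C1_joins x cs y ->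
  exists2 cs', piecewise_C1_joins y cs' x &
    \sum_(c <- cs') curve_length c = \sum_(c <- cs) curve_length c.
Proof.
elim: cs x => [x /= ->|c cs IH x /= [Cc c0 /IH[cs' J E]]]; first by exists [::].
exists (cs' ++ [:: reverse c]).
  apply: joins_cat J _; split; first exact: C1_reverse.
    by rewrite /reverse subr0.
  by rewrite /= /reverse subrr.
by rewrite big_cat/= big_seq1 big_cons E addrC curve_length_reverse.
Qed.

Lemma dist_le_joins x y cs : piecewise_C1_joins x cs y ->
  (dist x y <= (\sum_(c <- cs) curve_length c)%:E)%E.
Proof. by move=> J; apply: ereal_inf_lbound; exists cs. Qed.

Lemma dist_le_curve c : C1_curve c -> (dist (c 0%R) (c 1%R) <= (curve_length c)%:E)%E.
Proof.
move=> Cc; have := @dist_le_joins (c 0) (c 1) [:: c].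
by rewrite big_seq1; apply.
Qed.

Lemma dist_ltP x y a : (dist x y < a%:E)%E -> exists2 cs,
  piecewise_C1_joins x cs y & \sum_(c <- cs) curve_length c < a.
Proof. by move=> /ereal_inf_lt[_ [cs J <-]]; rewrite lte_fin; exists cs. Qed.

Lemma dist_ge0 x y : (0 <= dist x y)%E.
Proof.
apply/ereal_infP => _ [cs _ <-]; rewrite lee_fin; apply: sumr_ge0 => c _.
exact: curve_length_ge0.
Qed.

Lemma dist_lt_sym x y a : (dist x y < a%:E)%E -> (dist y x < a%:E)%E.
Proof.
move=> /dist_ltP[cs /joins_reverse[cs' J <-] La].
by apply: le_lt_trans (dist_le_joins J) _; rewrite lte_fin.
Qed.

Lemma dist_sym x y : dist x y = dist y x.
Proof.
suff H a b : (@dist R n M a b <= @dist R n M b a)%E.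
  by apply/eqP; rewrite eq_le !H.
have := dist_ge0 b a; case E : (dist b a) => [r| |] // _; last by rewrite leey.
apply/lee_addgt0Pr => e e0; rewrite -EFinD ltW//; apply: dist_lt_sym.
by rewrite E lte_fin ltrDl.
Qed.

Lemma dist_lt_trans x y z a b : (dist x y < a%:E)%E -> (dist y z < b%:E)%E ->
  (dist x z < (a + b)%:E)%E.
Proof.
move=> /dist_ltP[cs J La] /dist_ltP[cs' J' Lb].
apply: le_lt_trans (dist_le_joins (joins_cat J J')) _.
by rewrite big_cat/= lte_fin ltrD.
Qed.

(** A straight segment of the chart at [x] is a curve of [M] whose speed is bounded,
    as the coefficients of the metric are locally bounded. *)
Lemma dist_near x (e : R) : 0 < e -> \forall y \near x, (dist x y < e%:E)%E.
Proof.
move=> e0; pose u0 := chart x x.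
have xx := @mem_chart_dom _ _ M x.
have cx : chart_cod x u0 := chart_cod_center x.
pose S (w : 'rV[R]_n) : R := \sum_i \sum_j `|gram x w i j|.
have cS : {for u0, continuous S}.
  apply: continuous_fsum => i; apply: continuous_fsum => j.
  apply: (@continuous_comp _ _ _ (fun w => gram x w i j) (@Num.Def.normr R R)).
    exact: (Ck_cont (gram_smooth x i j 0) cx).
  exact: norm_continuous.
have NG : \forall w \near u0, chart_cod x w /\ `|S w - S u0| <= 1.
  exact: filterI (near_chart_cod cx) (continuous_near_le cS ltr01).
have /nbhs_ballP[r /= r0 Hr] := NG.
pose K := 1 + S u0.
have K0 : 0 <= K by apply: addr_ge0 => //; apply: sumr_ge0 => i _; exact: sumr_ge0.
have KG w : ball u0 r w -> S w <= K.
  by move=> /Hr[_ h]; rewrite -lerBlDr; exact: le_trans (ler_norm _) h.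
have K1 : 0 < Num.sqrt K + 1 by rewrite ltr_wpDl// sqrtr_ge0.
pose r' := Num.min r (e / (Num.sqrt K + 1)).
have r'0 : 0 < r' by rewrite lt_min r0 divr_gt0.
have Nb : \forall y \near x, ball u0 r' (chart x y).
  exact: (continuous_chart xx (nbhsx_ballx u0 _ r'0)).
apply: filterS2 (near_chart_dom xx) Nb => y xy.
rewrite -ball_normE/= lt_min => /andP[yr ye].
pose v := chart x y - u0; pose u (t : R) := u0 + t *: v.
have vu : `|u0 - chart x y| = `|v| by rewrite distrC.
rewrite vu in yr ye.
have du (t : R) : is_derive t 1 u v := is_derive_affine u0 v t.
have u'E : derive1 u = (fun=> v).
  by apply/funext => t; rewrite derive1E; have [_ ->] := du t.
have ub (t : R) : 0 <= t <= 1 -> ball u0 r (u t).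
  move=> /andP[t0 t1]; rewrite -ball_normE/= /u opprD addNKr normrN normrZ.
  by rewrite ger0_norm//; apply: le_lt_trans yr; rewrite ler_piMl.
pose c (t : R) := chart_inv x (u t).
have c0 : c 0 = x by rewrite /c /u scale0r addr0 chartK.
have c1 : c 1 = y by rewrite /c /u scale1r /v subrKC chartK.
have U (t : R) (t01 : 0 <= t <= 1) : chart_cod x (u t) := (Hr _ (ub t t01)).1.
have du' (t : R) : \forall s \near t, derivable u s 1 by near=> s; have [] := du s.
have cdu (t : R) : {for t, continuous (derive1 u)}.
  by rewrite u'E; exact: cst_continuous.
have Cc : C1_curve c.
  move=> t t01; split.
    apply: (chart_inv_curve_continuous (U t t01)).
    exact: is_derive1_continuous (du t).
  move=> q qc; have [N cd] := chart_curve_C1 (U t t01) (du' t) (cdu t) qc.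
  split; last exact: cd.
  by apply: filterS N => s [_ _ [D _]]; exact: D.
apply: (@le_lt_trans _ _ (curve_length c)%:E).
  by rewrite -{1}c0 -c1; exact: dist_le_curve.
rewrite lte_fin; apply: (@le_lt_trans _ _ (Num.sqrt K * `|v|)).
  apply: curve_length_le => // t t01.
  have xc : chart_dom x (c t) by exact: chart_inv_fun (U t t01).
  have ct : {for t, continuous c} := (Cc t t01).1.
  have [N _] := chart_curve_C1 (U t t01) (du' t) (cdu t) xc.
  have [_ _ D] := nbhs_singleton N.
  rewrite u'E transition_id ?mulmx1 in D; last exact: U.
  have vE : `|v| = Num.sqrt (`|v| ^+ 2) by rewrite sqrtr_sqr normr_id.
  rewrite /speed /tnorm (inner_velocity ct xc D) vE.
  rewrite -sqrtrM// ler_wsqrtr//; apply: le_trans (ler_norm _) _.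
  apply: le_trans (bil_bound _ _ _) _; rewrite -mulrA -expr2 ler_wpM2r ?sqr_ge0//.
  by apply: KG; rewrite /coord_curve /c chart_invK; [exact: ub|exact: U].
apply: (@le_lt_trans _ _ ((Num.sqrt K + 1) * `|v|)).
  by rewrite ler_wpM2r// lerDl.
by rewrite mulrC -ltr_pdivlMr.
Unshelve. all: by end_near. Qed.

End Speed.

(** * The geodesic equation *)

Section GramDerivative.
Context {R : realType} {n : nat} {M : riemannian_manifold R n}.
Implicit Types (p q : M) (u v w z a e : 'rV[R]_n).

Definition dgram p u a : 'M[R]_n :=
  \matrix_(i, j) D1form (fun x => gram p x i j) u a.

Lemma dgram_sym p u a : chart_cod p u -> (dgram p u a)^T = dgram p u a.
Proof.
move=> pu; apply/matrixP => i j; rewrite !mxE /D1form; apply: eq_bigr => l _.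
congr (_ * _); apply: near_eq_derive; apply: filterS (near_chart_cod pu) => w pw.
by rewrite -[in RHS](gram_sym pw) mxE.
Qed.

Lemma is_derive_bil_gram p (u v w : R -> 'rV[R]_n) (t : R) (du dv dw : 'rV[R]_n) :
  chart_cod p (u t) -> is_derive t 1 u du -> is_derive t 1 v dv -> is_derive t 1 w dw ->
  is_derive t 1 (fun s => bil (gram p (u s)) (v s) (w s))
    (bil (dgram p (u t) du) (v t) (w t) +
     bil (gram p (u t)) dv (w t) + bil (gram p (u t)) (v t) dw).
Proof.
move=> pu Du Dv Dw.
have D i j : is_derive t 1 (fun s => v s 0 i * w s 0 j * gram p (u s) i j)
   ((dv 0 i * w t 0 j + v t 0 i * dw 0 j) * gram p (u t) i j +
    v t 0 i * w t 0 j * dgram p (u t) du i j).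
  rewrite [dgram _ _ _ _ _]mxE; apply: is_derive_mul.
    by apply: is_derive_mul; exact: is_derive_coord.
  exact: (C1_chain (@open_chart_cod _ _ M p) (gram_smooth p i j 1%N) pu Du).
apply: is_derive_congr (is_derive_fsum (index_enum 'I_n) (fun i => is_derive_fsum (index_enum 'I_n) (D i))) _ _.
  by apply/funext => s; rewrite bilE.
rewrite !bilE -!big_split/=; apply: eq_bigr => i _.
rewrite -!big_split/=; apply: eq_bigr => j _.
by rewrite mulrDl [LHS]addrC addrA.
Qed.

(** Koszul's formula: pairing with [z] through the metric cancels the inverse metric
    in the Christoffel symbols. *)
Lemma bil_christoffel p u v w z : chart_cod p u ->
  bil (gram p u) z (christoffel_form p u v w) =
  2^-1 * (bil (dgram p u v) w z + bil (dgram p u w) v z - bil (dgram p u z) v w).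
Proof.
move=> pu; pose d l i j := 'D_(basis_vec l) (fun x => gram p x i j) u.
pose kappa : 'rV[R]_n := \row_l
  (2^-1 * \sum_i \sum_j v 0 i * w 0 j * (d i j l + d j i l - d l i j)).
have -> : christoffel_form p u v w = kappa *m invmx (gram p u).
  apply/rowP => k; rewrite !mxE /christoffel.
  under [RHS]eq_bigr do rewrite mxE mulrAC -mulrA mulr_sumr.
  rewrite -mulr_sumr [in RHS]exchange_big mulr_sumr/=; apply: eq_bigr => i _.
  under [in RHS]eq_bigr do rewrite mulr_sumr.
  rewrite [in RHS]exchange_big mulr_sumr/=; apply: eq_bigr => j _.
  rewrite mulrCA; congr (_ * _); rewrite mulr_sumr; apply: eq_bigr => l _.
  have IT : (invmx (gram p u))^T = invmx (gram p u) by rewrite trmx_inv gram_sym.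
  have {}IT : invmx (gram p u) k l = invmx (gram p u) l k by rewrite -[in LHS]IT mxE.
  by rewrite IT mulrCA.
rewrite bil_invmx; [|exact: gram_sym|exact/posdef_unit/gram_posdef].
have E a b c : bil (dgram p u a) b c =
    \sum_l \sum_i \sum_j a 0 l * (b 0 i * c 0 j) * d l i j.
  rewrite bilE; under eq_bigr do under eq_bigr do rewrite mxE mulr_sumr.
  under eq_bigr do rewrite exchange_big/=.
  rewrite exchange_big/=; apply: eq_bigr => l _; apply: eq_bigr => i _.
  by apply: eq_bigr => j _; rewrite mulrCA mulrA.
have E1 : bil (dgram p u v) w z = \sum_l \sum_i \sum_j z 0 l * (v 0 i * w 0 j) * d i j l.
  rewrite E [RHS]exchange_big/=; apply: eq_bigr => i _.
  rewrite [RHS]exchange_big/=; apply: eq_bigr => j _.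
  by apply: eq_bigr => l _; congr (_ * _); ring.
have E2 : bil (dgram p u w) v z = \sum_l \sum_i \sum_j z 0 l * (v 0 i * w 0 j) * d j i l.
  rewrite E [RHS]exchange_big/= [LHS]exchange_big/=; apply: eq_bigr => i _.
  rewrite [RHS]exchange_big/=; apply: eq_bigr => j _.
  by apply: eq_bigr => l _; congr (_ * _); ring.
rewrite E1 E2 E -!big_split/= -sumrB mulr_sumr; apply: eq_bigr => l _.
rewrite mxE mulrCA -!big_split/= -sumrB mulr_sumr; congr (_ * _); apply: eq_bigr => i _.
rewrite -!big_split/= -sumrB mulr_sumr; apply: eq_bigr => j _.
by rewrite !mulrDr !mulrN !mulrA.
Qed.

Lemma bil_christoffel_diag p u v z : chart_cod p u ->
  bil (gram p u) z (christoffel_form p u v v) =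
  bil (dgram p u v) v z - 2^-1 * bil (dgram p u z) v v.
Proof.
move=> pu; rewrite bil_christoffel//.
by move: (bil _ v z) (bil _ v v) => x y; field.
Qed.

(** The Euler-Lagrange form of the geodesic equation. It is free of the inverse
    metric, and being tested against all vectors [e] it can be evaluated at the
    velocity (conservation of speed) or moved to another chart. *)
Lemma geodesic_EL p u v a : chart_cod p u ->
  a + christoffel_form p u v v = 0 <->
  forall e, bil (gram p u) e a + bil (dgram p u v) v e = 2^-1 * bil (dgram p u e) v v.
Proof.
move=> pu; have key e : bil (gram p u) e (a + christoffel_form p u v v) =
    bil (gram p u) e a + bil (dgram p u v) v e - 2^-1 * bil (dgram p u e) v v.
  by rewrite bilDr bil_christoffel_diag// addrA.
split=> [E e|H]; first by apply/eqP; rewrite -subr_eq0 -key E bil0r.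
apply/eqP; apply: contraT => /(gram_posdef pu).
by rewrite key H subrr ltxx.
Qed.

End GramDerivative.

Section Geodesics.
Context {R : realType} {n : nat} {M : riemannian_manifold R n}.
Implicit Types (p q : M) (c : R -> M).

(** The velocity is taken as the test vector in [geodesic_EL]. *)
Lemma geodesic_speed_derive c (t : R) : geodesic c -> 0 <= t <= 1 ->
  is_derive t 1 (fun s => inner (c s) (velocity c s) (velocity c s)) 0.
Proof.
move=> [Cc geo] t01; have [d2 acc] := geo t t01.
have [ct /(_ _ (mem_chart_dom (c t)))[dc cdc]] := Cc t t01.
pose p := c t; pose u := coord_curve p c.
have pu : chart_cod p (u t) := chart_cod_center p.
apply: (@near_eq_is_derive _ _ _ (fun s => bil (gram p (u s)) (derive1 u s) (derive1 u s))).
  by apply: filterS (speed_sqr_near Cc t01) => s ->.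
have Du : is_derive t 1 u (derive1 u t) := is_derive_derive1 (nbhs_singleton dc).
pose a := derive1 (derive1 u) t.
have Da : is_derive t 1 (derive1 u) a := is_derive_derive1 d2.
apply: is_derive_congr (is_derive_bil_gram pu Du Da Da) (erefl _) _.
have := (geodesic_EL (derive1 u t) a pu).1 acc (derive1 u t).
rewrite (bilC a _ (gram_sym pu)).
move: (bil (dgram p (u t) _) _ _) (bil (gram p (u t)) _ _) => x y h; lra.
Qed.

Lemma geodesic_speed c (t : R) : geodesic c -> 0 <= t <= 1 -> speed c t = speed c 0.
Proof.
move=> gc /andP[t0 t1].
suff E : inner (c t) (velocity c t) (velocity c t) = inner (c 0) (velocity c 0) (velocity c 0).
  by rewrite /speed /tnorm E.
have D (s : R) : s \in `[0, t] ->
    is_derive s 1 (fun s => inner (c s) (velocity c s) (velocity c s)) 0.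
  rewrite in_itv/= => /andP[s0 st]; apply: geodesic_speed_derive gc _.
  by rewrite s0 (le_trans st).
have [s _] := mean_value t0 D.
by rewrite mul0r => /eqP; rewrite subr_eq0 => /eqP.
Qed.

Lemma geodesic_length c (t : R) : geodesic c -> 0 <= t <= 1 -> curve_length c = speed c t.
Proof.
move=> gc t01; rewrite geodesic_speed//; apply: integral01_cst => s s01.
exact: (geodesic_speed gc s01).
Qed.

(** In [geodesic_EL] the left-hand side is the derivative along the curve of the
    inner product of [e] with the velocity [v], and the right-hand side is half the
    derivative in the direction [e] of the squared norm of [v]. Computed in the
    second chart, both contain one term with the second derivative of the change
    of charts, applied to [(v, e)] and to [(e, v)]. These terms cancel by the
    symmetry of second derivatives, and what remains is the equation in the second
    chart, tested against the image of [e]. *)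
Lemma geodesic_transport p q (u : R -> 'rV[R]_n) (t : R) (a : 'rV[R]_n) :
  overlap p q (u t) -> (\forall s \near t, derivable u s 1) ->
  is_derive t 1 (derive1 u) a ->
  a + christoffel_form p (u t) (derive1 u t) (derive1 u t) = 0 ->
  let w := fun s => chart_change p q (u s) in
  exists2 b, is_derive t 1 (derive1 w) b &
    b + christoffel_form q (w t) (derive1 w t) (derive1 w t) = 0.
Proof.
have L (x1 x2 x3 x4 x5 x6 x7 : R) : x1 + x2 = x3 + x4 + x5 -> x6 = x7 + x4 + x4 ->
  x2 + x1 = 2^-1 * x6 -> x5 + x3 = 2^-1 * x7 by lra.
move=> Ou du Da geo w.
have oO := open_overlap p q.
have pu : chart_cod p (u t) by case: Ou.
set v := derive1 u t in geo *.
have Du : is_derive t 1 u v := is_derive_derive1 (nbhs_singleton du).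
have NO : \forall s \near t, overlap p q (u s).
  by apply: (is_derive1_continuous Du); exact: open_nbhs_nbhs (conj oO Ou).
pose phi j := fun x : 'rV[R]_n => chart_change p q x 0 j.
have Cphi j : Ck 2 (overlap p q) (phi j) := @Ck_chart_change _ _ _ 2%N p q j.
have NDw : \forall s \near t, is_derive (s : R) (1 : R) w (derive1 u s *m transition p q (u s)).
  apply: filterS2 NO du => s Os ds; apply: chart_change_curve; first exact: Os.
  exact: is_derive_derive1.
have w'E : \forall s \near t, derive1 w s = derive1 u s *m transition p q (u s).
  by apply: filterS NDw => s [_ E]; rewrite derive1E E.
have wj j : \forall s \near t, derive1 (fun s => phi j (u s)) s = derive1 w s 0 j.
  apply: filterS NDw => s Dw; rewrite [LHS]derive1E [in RHS]derive1E.
  by have [_ ->] := is_derive_coord j Dw; have [_ ->] := Dw.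
pose b : 'rV[R]_n := \row_j (D2form (phi j) (u t) v v + D1form (phi j) (u t) a).
have Dw' : is_derive t 1 (derive1 w) b.
  apply: is_derive_row => j.
  have [_ D] := C2_chain2 oO (Cphi j) Ou du Da.
  by apply: near_eq_is_derive (wj j) _; rewrite mxE; exact: D.
exists b; first exact: Dw'.
have Dw : is_derive t 1 w (derive1 w t).
  by rewrite (nbhs_singleton w'E); exact: (nbhs_singleton NDw).
have qw : chart_cod q (w t) by have [] := overlap_sym Ou.
have push (c : R -> 'rV[R]_n) (r : R) (dc e : 'rV[R]_n) : c r = u t ->
    is_derive r 1 c dc -> is_derive r 1 (fun s => \row_j D1form (phi j) (c s) e)
      (\row_j D2form (phi j) (u t) dc e).
  move=> cr Dc; apply: is_derive_row => j.
  have Oc : overlap p q (c r) by rewrite cr.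
  have D := is_derive_D1form e oO (Cphi j) Oc Dc; rewrite cr in D.
  by rewrite mxE; apply: is_derive_congr D _ (erefl _); apply/funext => s; rewrite mxE.
have pushE x e : overlap p q x -> \row_j D1form (phi j) x e = e *m transition p q x.
  move=> Ox; apply/rowP => j; rewrite !mxE; apply: eq_bigr => i _.
  by rewrite transitionE// mxE.
apply/(geodesic_EL _ _ qw) => e'.
pose T := transition p q (u t).
have Tunit : T \in unitmx := transition_unit Ou.
pose e := e' *m invmx T.
have eT : e *m T = e' by rewrite /e mulmxKV.
(* [dT] is the second derivative of the change of charts, the term that occurs in
   both computations *)
pose dT := \row_j D2form (phi j) (u t) v e.
have D1p := is_derive_bil_gram pu Du (is_derive_cst (e : 'rV[R]_n) t (1 : R)) Da.
have D1q := is_derive_bil_gram qw Dw (push u t v e (erefl _) Du) Dw'.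
have {D1q}D1q : is_derive t 1 (fun s => bil (gram p (u s)) e (derive1 u s))
    (bil (dgram q (w t) (derive1 w t)) e' (derive1 w t) +
     bil (gram q (w t)) dT (derive1 w t) + bil (gram q (w t)) e' b).
  rewrite pushE// -/T eT in D1q; apply: near_eq_is_derive D1q.
  by apply: filterS2 NO w'E => s Os w's; rewrite (gram_transport _ _ Os) -w's pushE.
pose y (s : R) := u t + s *: e.
have y0 : y 0 = u t by rewrite /y scale0r addr0.
have Dy : is_derive (0 : R) 1 y e := is_derive_affine (u t) e 0.
have py : chart_cod p (y 0) by rewrite y0.
have Oy : overlap p q (y 0) by rewrite y0.
have NOy : \forall s \near (0 : R), overlap p q (y s).
  by apply: (is_derive1_continuous Dy); exact: open_nbhs_nbhs (conj oO Oy).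
have Dv : is_derive (0 : R) 1 (fun=> v) 0.
  exact: (is_derive_cst (v : 'rV[R]_n) (0 : R) (1 : R)).
have D2p := is_derive_bil_gram py Dy Dv Dv.
have qy : chart_cod q (chart_change p q (y 0)) by have [] := overlap_sym Oy.
have DV := push y 0 e v y0 Dy.
have D2q := is_derive_bil_gram qy (chart_change_curve Oy Dy) DV DV.
have dTC : \row_j D2form (phi j) (u t) e v = dT.
  by apply/rowP => j; rewrite !mxE; exact: (D2formC e v oO (Cphi j) Ou).
have w't : v *m T = derive1 w t by rewrite (nbhs_singleton w'E).
have {D2q}D2q : is_derive (0 : R) 1 (fun s => bil (gram p (y s)) v v)
    (bil (dgram q (w t) e') (derive1 w t) (derive1 w t) +
     bil (gram q (w t)) dT (derive1 w t) + bil (gram q (w t)) (derive1 w t) dT).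
  rewrite dTC pushE// y0 -/T eT w't in D2q; apply: near_eq_is_derive D2q.
  by apply: filterS NOy => s Os; rewrite (gram_transport _ _ Os) pushE.
have [_ E1p] := D1p; have [_ E1q] := D1q; have {E1p E1q}E1 := etrans (esym E1p) E1q.
have [_ E2p] := D2p; have [_ E2q] := D2q; have {E2p E2q}E2 := etrans (esym E2p) E2q.
have EL := (geodesic_EL v a pu).1 geo e.
rewrite bil0l addr0 in E1.
rewrite bil0l bil0r [X in X + 0]addr0 [X in X = _]addr0 y0 (bilC _ dT (gram_sym qw)) in E2.
rewrite (bilC v e (dgram_sym v pu)) in EL.
rewrite (bilC _ e' (dgram_sym _ qw)).
have E1' : bil (dgram p (u t) v) e v + bil (gram p (u t)) e a =
  bil (dgram q (w t) (derive1 w t)) e' (derive1 w t) +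
  bil (gram q (w t)) dT (derive1 w t) + bil (gram q (w t)) e' b := E1.
exact: L E1' E2 EL.
Qed.

End Geodesics.

(** * Existence of geodesics *)

Section CkGram.
Context {R : realType} {n : nat}.

Lemma Ck_det k m (U : set 'rV[R]_n) (A : 'rV[R]_n -> 'M[R]_m) : open U ->
  (forall i j, Ck k U (fun u => A u i j)) -> Ck k U (fun u => \det (A u)).
Proof.
move=> oU CA; apply: Ck_sum => // s; apply: CkM => //; first exact: Ck_cst.
by apply: Ck_prod => // i; exact: CA.
Qed.

Context {M : riemannian_manifold R n}.
Implicit Types (p q : M).

(** Cramer's formula expresses the inverse by determinants. *)
Lemma Ck_invgram k p i j : Ck k (chart_cod p) (fun u => invmx (gram p u) i j).
Proof.
have oc := @open_chart_cod _ _ M p.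
have Cg a b : Ck k (chart_cod p) (fun u => gram p u a b) by exact: gram_smooth.
apply: (@eq_Ck _ _ _ _ (fun u => (\det (gram p u))^-1 *
   ((-1) ^+ (j + i) * \det (row' j (col' i (gram p u)))))) => //.
  move=> u pu; rewrite /invmx ifT; last exact/posdef_unit/gram_posdef.
  by rewrite !mxE.
apply: CkM => //.
  apply: CkV => //; last exact: Ck_det.
  move=> u pu; have := posdef_unit (gram_posdef pu).
  by rewrite unitmxE unitfE.
apply: CkM => //; first exact: Ck_cst.
by apply: Ck_det => // a b; apply: (eq_Ck _ _ (Cg (lift j a) (lift i b))) => // u _; rewrite !mxE.
Qed.

Lemma Ck_christoffel k p a b c : Ck k (chart_cod p) (fun u => christoffel p u a b c).
Proof.
have oc := @open_chart_cod _ _ M p.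
have Cdg l i j : Ck k (chart_cod p) (fun u => 'D_(basis_vec l) (fun w => gram p w i j) u).
  exact: (Ck_partial l (gram_smooth p i j k.+1)).
apply: CkM => //; first exact: Ck_cst.
apply: Ck_sum => // l; apply: CkM => //; first exact: Ck_invgram.
by apply: CkB => //; apply: CkD.
Qed.

Lemma christoffel_formZ p u v (e : R) :
  christoffel_form p u (e *: v) (e *: v) = e *: (e *: christoffel_form p u v v).
Proof.
apply/rowP => k; rewrite !mxE !mulr_sumr; apply: eq_bigr => i _.
rewrite !mulr_sumr; apply: eq_bigr => j _; rewrite !mxE.
by rewrite !mulrA; congr (_ * _); rewrite -!mulrA; congr (_ * _); rewrite mulrCA.
Qed.

End CkGram.

Section RowLipschitz.
Context {R : realType} {n m : nat}.

Lemma C1_row_lipschitz (U : set 'rV[R]_n) (F : 'rV[R]_n -> 'rV[R]_m) u :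
  open U -> (forall j, Ck 1 U (fun w => F w 0 j)) -> U u ->
  exists L r : R, [/\ 0 < L, 0 < r &
    forall w w', ball u r w -> ball u r w' -> `|F w' - F w| <= L * `|w' - w|].
Proof.
move=> oU CF Uu.
have /choice[L /choice[r H]] := fun j => C1_lipschitz oU (CF j) Uu.
pose L' := 1 + \sum_j L j; pose r' := \big[Num.min/1]_j r j.
have L0 j : 0 <= L j by have [/ltW] := H j.
have L'0 : 0 < L' by rewrite ltr_wpDr// sumr_ge0.
have r'0 : 0 < r'.
  by apply: lt_bigmin => [|j _]; [exact: ltr01|have [] := H j].
exists L', r'; split=> // w w' bw bw'.
apply: row_norm_le; first by rewrite mulr_ge0// ltW.
move=> j; rewrite !mxE; have [_ _ _ Hj] := H j.
have rr : r' <= r j by exact: bigmin_le.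
apply: le_trans (Hj w w' (le_ball rr bw) (le_ball rr bw')) _.
rewrite ler_wpM2r// /L' (bigD1 j)//= addrCA lerDl addr_ge0// sumr_ge0// => i _.
Qed.

End RowLipschitz.

Section GeodesicExistence.
Context {R : realType} {n : nat} {M : riemannian_manifold R n}.
Implicit Types (p q x : M).

(** The definition of a geodesic reads the acceleration in a chart that depends on
    time; by [geodesic_transport] the equation in one fixed chart suffices. *)
Lemma chart_geodesic p (u : R -> 'rV[R]_n) :
  (forall t, 0 <= t <= 1 -> [/\ chart_cod p (u t),
     \forall s \near t, derivable u s 1 &
     is_derive t 1 (derive1 u)
       (- christoffel_form p (u t) (derive1 u t) (derive1 u t))]) ->
  geodesic (fun t => chart_inv p (u t)).
Proof.
move=> H; set c := fun t => _; split.
  move=> t t01; have [pu du d2u] := H t t01; split.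
    apply: (chart_inv_curve_continuous pu).
    by apply: differentiable_continuous; exact/derivable1_diffP/(nbhs_singleton du).
  move=> q qc; have [N cd] := chart_curve_C1 pu du (is_derive1_continuous d2u) qc.
  split; last exact: cd.
  by apply: filterS N => s [_ _ [D _]]; exact: D.
move=> t t01; have [pu du d2u] := H t t01.
pose q := c t.
have Ou : overlap p q (u t) by split=> //; exact: mem_chart_dom.
have [|b Dw' geo] := geodesic_transport Ou du d2u; first exact: addNr.
have [d2 d2E] := Dw'.
split; first exact: d2.
move: geo; rewrite -d2E -derive1E; exact.
Qed.

Lemma lsubmx_continuous : continuous (@lsubmx R 1 n n).
Proof.
move=> y; apply: row_continuous => i.
have -> : (fun y : 'rV[R]_(n + n) => lsubmx y 0 i) = (fun y => y 0 (lshift n i)).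
  by apply/funext => z; rewrite mxE.
exact: coord_continuous.
Qed.

(** The geodesic equation as a first-order system for position and velocity. *)
Definition geodesic_field p (y : 'rV[R]_(n + n)) : 'rV[R]_(n + n) :=
  row_mx (rsubmx y) (- christoffel_form p (lsubmx y) (rsubmx y) (rsubmx y)).

Lemma C1_geodesic_field p : open [set y : 'rV[R]_(n + n) | chart_cod p (lsubmx y)] /\
  forall j, Ck 1 [set y : 'rV[R]_(n + n) | chart_cod p (lsubmx y)]
     (fun y => geodesic_field p y 0 j).
Proof.
set U := [set y | _].
have oU : open U.
  by apply: (@open_comp _ _ (@lsubmx R 1 n n)); [move=> y _; exact: lsubmx_continuous|exact: open_chart_cod].
split=> // j; case: (splitP j) => k jk.
  apply: (eq_Ck oU _ (Ck_coord 1 U (rshift n k))) => y Uy.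
  have -> : j = lshift n k by exact: val_inj.
  by rewrite /geodesic_field row_mxEl mxE.
have Cv i : Ck 1 U (fun y => y 0 (rshift n i)) by exact: Ck_coord.
have CG a b : Ck 1 U (fun y => christoffel p (lsubmx y) a b k).
  apply: (@Ck_comp _ _ _ 1%N U (chart_cod p) (@lsubmx R 1 n n)
    (fun u => christoffel p u a b k) oU (@open_chart_cod _ _ M p)); [by []| |exact: Ck_christoffel].
  move=> i; apply: (eq_Ck oU _ (Ck_coord 1 U (lshift n i))) => y _.
  by rewrite mxE.
apply: (@eq_Ck _ _ _ _ (fun y => - \sum_a \sum_b y 0 (rshift n a) * y 0 (rshift n b) *
   christoffel p (lsubmx y) a b k)) => //.
  move=> y Uy; have -> : j = rshift n k by exact: val_inj.
  rewrite /geodesic_field row_mxEr !mxE; congr (- _).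
  by apply: eq_bigr => a _; apply: eq_bigr => b _; rewrite !mxE.
apply: CkN => //; apply: Ck_sum => // a; apply: Ck_sum => // b.
by apply: CkM => //; exact: CkM.
Qed.

(** The first-order system has a solution on some interval [(- e, e)]; slowing down
    time makes it a geodesic parametrized by [[0, 1]], with a shorter initial
    velocity. *)
Lemma geodesic_exists x (v : 'rV[R]_n) (O : set M) : nbhs x O ->
  exists (eta : R) (c : R -> M), [/\ 0 < eta, geodesic c, c 0 = x,
    curve_in c O & velocity c 0 = eta *: v].
Proof.
move=> Ox.
pose F := @geodesic_field x.
have [oU CF] := @C1_geodesic_field x.
set U := [set y | _] in oU CF.
pose u0 := chart x x.
have xu0 : chart_cod x u0 := chart_cod_center x.
pose y0 : 'rV[R]_(n + n) := row_mx u0 v.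
have Uy0 : U y0 by rewrite /U/= row_mxKl.
have [L [r [L0 r0 HL]]] := C1_row_lipschitz oU CF Uy0.
have lO : {for y0, continuous (fun y => chart_inv x (@lsubmx R 1 n n y))}.
  apply: (@continuous_comp _ _ _ (@lsubmx R 1 n n) (chart_inv x)); first exact: lsubmx_continuous.
  by rewrite row_mxKl; exact: continuous_chart_inv.
have NO : \forall y \near y0, O (chart_inv x (lsubmx y)).
  by apply: lO; rewrite row_mxKl chartK//; exact: mem_chart_dom.
have NU : \forall y \near y0, U y by exact: open_nbhs_nbhs (conj oU Uy0).
have N1 : \forall y \near y0, O (chart_inv x (lsubmx y)) /\ U y by exact: filterI NO NU.
have /nbhs_ballP[r1 /= r10 Hr1] := N1.
pose r' := Num.min r r1.
have r'0 : 0 < r' by rewrite lt_min r0 r10.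
have rr : r' <= r by rewrite ge_min lexx.
have rr1 : r' <= r1 by rewrite ge_min lexx orbT.
have HL' w w' : ball y0 r' w -> ball y0 r' w' -> `|F w' - F w| <= L * `|w' - w|.
  by move=> bw bw'; apply: HL; exact: (le_ball rr).
have [e [y [e0 y0E Hy]]] := picard_lindelof L0 r'0 HL'.
pose a (t : R) : 'rV[R]_n := lsubmx (y t); pose b (t : R) : 'rV[R]_n := rsubmx (y t).
have Dab (t : R) : `|t| < e -> is_derive t 1 a (b t) /\
    is_derive t 1 b (- christoffel_form x (a t) (b t) (b t)).
  move=> te; have [_ D] := Hy t te; split; apply: is_derive_row => j.
    have D' := is_derive_coord (lshift n j) D; rewrite /F /geodesic_field row_mxEl in D'.
    apply: is_derive_congr D' _ _; last by [].
    by apply/funext => s; rewrite mxE.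
  have D' := is_derive_coord (rshift n j) D; rewrite /F /geodesic_field row_mxEr in D'.
  apply: is_derive_congr D' _ _; last by [].
  by apply/funext => s; rewrite mxE.
(* The factor 4 leaves room around [[0, 1]], where two-sided derivatives at the
   endpoints are needed. *)
pose eta := e / 4.
have eta0 : 0 < eta by rewrite divr_gt0.
have eta_e (t : R) : `|t| < 4 -> `|eta * t| < e.
  by move=> t4; rewrite normrM (gtr0_norm eta0) /eta mulrAC ltr_pdivrMr// ltr_pM2l.
have scale (t : R) : is_derive t 1 (fun s : R => eta * s) eta.
  have := is_derive_affine (0 : R) eta t.
  by rewrite (_ : (fun s => _) = (fun s : R => eta * s))//; apply/funext => s; rewrite add0r mulrC.
pose u (t : R) := a (eta * t).
have Du (t : R) : `|t| < 4 -> is_derive t 1 u (eta *: b (eta * t)).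
  by move=> /eta_e/Dab[D _]; exact: (is_derive_reparam (scale t)).
have u'E (t : R) : `|t| < 4 -> derive1 u t = eta *: b (eta * t).
  by move=> /Du[_]; rewrite derive1E.
have N4 (t : R) : `|t| < 4 -> \forall s \near t, `|s| < 4.
  exact: near_norm_lt.
have t4 (t : R) : 0 <= t <= 1 -> `|t| < 4.
  by move=> /andP[t0 t1]; rewrite ger0_norm// (le_lt_trans t1)// ltr1n.
have Dv (t : R) : `|t| < 4 -> is_derive t 1 (derive1 u)
    (- christoffel_form x (u t) (derive1 u t) (derive1 u t)).
  move=> h4; have [_ D] := Dab _ (eta_e _ h4).
  have D1 := is_derive_reparam (scale t) D.
  have D2 : is_derive t 1 (fun s => eta *: b (eta * s))
     (eta *: (eta *: - christoffel_form x (u t) (b (eta * t)) (b (eta * t)))).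
    exact: is_deriveZ.
  rewrite u'E// christoffel_formZ -!scalerN.
  apply: near_eq_is_derive D2.
  by apply: filterS (N4 t h4) => s s4; rewrite u'E.
have Uu (t : R) : `|t| < 4 -> O (chart_inv x (u t)) /\ chart_cod x (u t).
  by move=> /eta_e/Hy[bt _]; have := Hr1 _ (le_ball rr1 bt).
exists eta, (fun t => chart_inv x (u t)).
have c0 : chart_inv x (u 0) = x.
  by rewrite /u mulr0 /a y0E row_mxKl chartK//; exact: mem_chart_dom.
split.
- exact: eta0.
- apply: chart_geodesic => t /t4 h4; split.
  + by have [] := Uu t h4.
  + by apply: filterS (N4 t h4) => s /Du[].
  + exact: Dv.
- exact: c0.
- by move=> t /t4/Uu[].
- have z4 : `|0 : R| < 4 by rewrite normr0.
  rewrite /velocity c0.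
  have N : \forall s \near (0 : R), u s = coord_curve x (fun t => chart_inv x (u t)) s.
    by apply: filterS (N4 0 z4) => s s4; rewrite /coord_curve chart_invK//; have [] := Uu s s4.
  rewrite derive1E -(near_eq_derive _ N) -derive1E u'E// mulr0 /b y0E row_mxKr.
  by [].
Qed.

End GeodesicExistence.



(** * Gradient and Hessian *)

Section Forms.
Context {R : realType} {n : nat}.
Implicit Types (g : 'rV[R]_n -> R) (u v w : 'rV[R]_n).

Lemma D1formZ g u a v : D1form g u (a *: v) = a * D1form g u v.
Proof. by rewrite /D1form mulr_sumr; apply: eq_bigr => i _; rewrite mxE mulrA. Qed.

Lemma D1formN g u v : D1form g u (- v) = - D1form g u v.
Proof. by rewrite -scaleN1r D1formZ mulN1r. Qed.

Lemma D1form0 g u : D1form g u 0 = 0.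
Proof. by rewrite /D1form big1// => i _; rewrite mxE mul0r. Qed.

End Forms.

Section Gradient.
Context {R : realType} {n : nat} {M : riemannian_manifold R n}.
Variable f : M -> R.
Hypothesis f2 : C2_on_manifold f.
Implicit Types (p q x : M) (c : R -> M).

Let F p := fun u => f (chart_inv p u).
Let CF p : Ck 2 (chart_cod p) (F p). Proof. exact: f2. Qed.
Let oc p := @open_chart_cod _ _ M p.

Lemma bil_grad_chart p u v : chart_cod p u ->
  bil (gram p u) v (grad_chart f p u) = D1form (F p) u v.
Proof.
move=> pu; rewrite bil_invmx; last 2 first.
- exact: gram_sym.
- exact/posdef_unit/gram_posdef.
by apply: eq_bigr => i _; rewrite mxE.
Qed.

Lemma inner_grad x v : inner x v (grad f x) = D1form (F x) (chart x x) v.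
Proof. exact/bil_grad_chart/chart_cod_center. Qed.

Lemma grad_chart_C1 p j : Ck 1 (chart_cod p) (fun u => grad_chart f p u 0 j).
Proof.
apply: (@eq_Ck _ _ _ _ (fun u => \sum_k 'D_(basis_vec k) (F p) u * invmx (gram p u) k j)).
- exact: oc.
- by move=> u pu; rewrite mxE; apply: eq_bigr => k _; rewrite mxE.
- apply: Ck_sum => [|k]; first exact: oc.
  by apply: CkM; [exact: oc|exact: Ck_partial|exact: Ck_invgram].
Qed.

Lemma is_derive_f_curve c (t : R) : C1_curve c -> 0 <= t <= 1 ->
  is_derive t 1 (fun s => f (c s)) (inner (c t) (velocity c t) (grad f (c t))).
Proof.
move=> Cc t01; have N := C1_curve_near Cc t01 (mem_chart_dom (c t)).
pose p := c t; pose u := coord_curve p c.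
have pu : chart_cod p (u t) := chart_cod_center p.
apply: (@near_eq_is_derive _ _ _ (fun s => F p (u s))).
  by apply: filterS N => s [_ ps _]; rewrite /F /u /coord_curve chartK.
rewrite inner_grad; apply: (C1_chain (@oc p) (CkW (@CF p)) pu).
have [_ _ du] := nbhs_singleton N.
exact: is_derive_derive1.
Qed.

Lemma is_derive2_f_curve c (t : R) (a : 'rV[R]_n) : C1_curve c -> 0 <= t <= 1 ->
  is_derive t 1 (derive1 (coord_curve (c t) c)) a ->
  is_derive t 1 (derive1 (fun s => f (c s)))
    (D2form (F (c t)) (chart (c t) (c t)) (velocity c t) (velocity c t)
     + D1form (F (c t)) (chart (c t) (c t)) a).
Proof.
move=> Cc t01 Da; have N := C1_curve_near Cc t01 (mem_chart_dom (c t)).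
pose p := c t; pose u := coord_curve p c.
have pu : chart_cod p (u t) := chart_cod_center p.
have du : \forall s \near t, derivable u s 1 by apply: filterS N => s [].
have [_ D] := C2_chain2 (@oc p) (@CF p) pu du Da.
apply: near_eq_is_derive D.
have N2 := near_join N.
apply: filterS N2 => s Ns; rewrite !derive1E; apply: near_eq_derive.
by apply: filterS Ns => s' [_ ps' _]; rewrite /F /u /coord_curve chartK.
Qed.

(** Along the line [u0 + s v] the inner product of [v] with the gradient is the
    derivative of [f] in the direction [v]. Differentiating this identity brings in
    the derivative of the metric, which is what [bil_christoffel] expresses by the
    Christoffel symbols. *)
Lemma hess_quadratic x v : inner x v (v *m hess f x) =
  D2form (F x) (chart x x) v v
  - D1form (F x) (chart x x) (christoffel_form x (chart x x) v v).
Proof.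
set u0 := chart x x; pose Y := grad_chart f x.
have pu : chart_cod x u0 := chart_cod_center x.
pose dY := \row_j D1form (fun u => Y u 0 j) u0 v.
have chrE i j : christoffel_form x u0 (basis_vec i) (Y u0) 0 j =
    \sum_k Y u0 0 k * christoffel x u0 i k j.
  rewrite mxE; under eq_bigr do under eq_bigr do rewrite -mulrA.
  by under eq_bigr do rewrite -mulr_sumr; exact: sum_basis.
have -> : v *m hess f x = dY + christoffel_form x u0 v (Y u0).
  apply/rowP => j; rewrite mxE [RHS]mxE [dY _ _]mxE [christoffel_form _ _ _ _ _ _]mxE.
  rewrite -big_split/=; apply: eq_bigr => i _.
  rewrite mxE mxE chrE mulrDr; congr (_ * _ + _).
    rewrite derive_mx ?mxE//; apply/derivable_mxP => a k; rewrite ord1.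
    exact: (Ck_derivable (@grad_chart_C1 x k) pu).
  by rewrite mulr_sumr; apply: eq_bigr => k _; rewrite mulrA.
pose y (s : R) := u0 + s *: v.
have y0 : y 0 = u0 by rewrite /y scale0r addr0.
have Dy : is_derive (0 : R) 1 y v := is_derive_affine u0 v 0.
have py : chart_cod x (y 0) by rewrite y0.
have DY : is_derive (0 : R) 1 (fun s => Y (y s)) dY.
  apply: is_derive_row => j.
  by have := C1_chain (@oc x) (@grad_chart_C1 x j) py Dy; rewrite mxE y0.
have D1 := is_derive_bil_gram py Dy (is_derive_cst (v : 'rV[R]_n) (0 : R) (1 : R)) DY.
have D2 : is_derive (0 : R) 1 (fun s => bil (gram x (y s)) v (Y (y s)))
    (D2form (F x) u0 v v).
  apply: (@near_eq_is_derive _ _ _ (fun s => D1form (F x) (y s) v)).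
    have NU : \forall s \near (0 : R), chart_cod x (y s).
      by apply: (is_derive1_continuous Dy); exact: near_chart_cod.
    by apply: filterS NU => s ps; rewrite bil_grad_chart.
  by have := is_derive_D1form v (@oc x) (@CF x) py Dy; rewrite y0.
have [_ E1] := D1; have [_ E2] := D2; have {E1 E2}E := etrans (esym E1) E2.
rewrite bil0l addr0 y0 in E.
rewrite innerE bilDr bil_christoffel// -bil_grad_chart// (bilC _ _ (gram_sym pu)).
rewrite bil_christoffel_diag// (bilC (Y u0) v (dgram_sym v pu)) -E.
have L (a b c : R) : b + 2^-1 * (a + c - a) = a + b - (a - 2^-1 * c) by lra.
exact: L.
Qed.

End Gradient.

(** * Pullbacks by a retraction *)

Section Retraction.
Context {R : realType} {n : nat} {M : riemannian_manifold R n}.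
Variables (retr : M -> 'rV[R]_n -> M) (rad : M -> \bar R).
Hypothesis ret : is_retraction retr rad.
Implicit Types (p q x : M) (s v : 'rV[R]_n).

(** The smoothness of a retraction concerns the tangent bundle; a single tangent
    space is a slice of it, on which the transition matrix is the identity. *)
Lemma retr_local x s q : ((tnorm x s)%:E <= rad x)%E -> chart_dom q (retr x s) ->
  exists W : set 'rV[R]_n, [/\ open W, W s,
    forall s', W s' -> chart_dom q (retr x s') &
    forall j k, Ck k W (fun s' => chart q (retr x s') 0 j)].
Proof.
move=> sr qs; have [U [oU Us HU CU]] := retr_smooth ret sr qs.
pose emb (s' : 'rV[R]_n) : 'rV[R]_(n + n) := row_mx (chart x x) s'.
have bE s' : bundle_map retr x (emb s') = retr x s'.
  rewrite /bundle_map /emb row_mxKl row_mxKr chartK; last exact: mem_chart_dom.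
  by rewrite transition_id ?mulmx1//; exact: chart_cod_center.
have Cemb k V j : open V -> Ck k V (fun s' => emb s' 0 j).
  move=> oV; case: (splitP j) => i ji.
    apply: (eq_Ck oV _ (Ck_cst k V (chart x x 0 i))) => s' _.
    have -> : j = lshift n i by exact: val_inj.
    by rewrite /emb row_mxEl.
  apply: (eq_Ck oV _ (Ck_coord k V i)) => s' _.
  have -> : j = rshift n i by exact: val_inj.
  by rewrite /emb row_mxEr.
have cemb : continuous emb.
  move=> s'; apply: row_continuous => j.
  exact: (Ck_cont (Cemb 0%N setT j openT) (I : setT s')).
pose W := emb @^-1` U.
have oW : open W by apply: open_comp oU => s' _; exact: cemb.
exists W; split.
- exact: oW.
- exact: Us.
- by move=> s' Ws; have [_] := HU _ Ws; rewrite bE.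
- move=> j k.
  apply: (@eq_Ck _ _ _ _ (fun s' => chart q (bundle_map retr x (emb s')) 0 j)).
  + exact: oW.
  + by move=> s' _; rewrite bE.
  + apply: (@Ck_comp _ _ _ k W U emb (fun w => chart q (bundle_map retr x w) 0 j) oW oU).
    * by move=> s'.
    * by move=> i; exact: Cemb.
    * exact: CU.
Qed.

Lemma retr_continuous x s : ((tnorm x s)%:E <= rad x)%E -> {for s, continuous (retr x)}.
Proof.
move=> sr; pose q := retr x s.
have [W [oW Ws HW CW]] := retr_local sr (mem_chart_dom q).
apply: (@near_continuous _ _ (fun s' => chart_inv q (chart q (retr x s')))).
  have NW : \forall s' \near s, W s' by exact: open_nbhs_nbhs (conj oW Ws).
  by apply: filterS NW => s' Ws'; rewrite chartK//; exact: HW.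
apply: (@continuous_comp _ _ _ (fun s' => chart q (retr x s')) (chart_inv q)).
  by apply: row_continuous => j; exact: (Ck_cont (CW j 0%N) Ws).
apply: continuous_chart_inv; apply: chart_fun; exact: HW.
Qed.

Lemma retr_path_continuous x s (t : R) : 0 <= t <= 1 ->
  ((tnorm x s)%:E <= rad x)%E -> {for t, continuous (fun t : R => retr x (t *: s))}.
Proof.
move=> /andP[t0 t1] sr.
apply: (@continuous_comp _ _ _ (fun t : R => t *: s) (retr x)).
  exact: scalel_continuous.
apply: retr_continuous; apply: le_trans sr.
by rewrite lee_fin tnormZ ger0_norm// ler_piMl// tnorm_ge0.
Qed.

Variable f : M -> R.
Hypothesis f2 : C2_on_manifold f.
Let F p := fun u => f (chart_inv p u).
Let CF p : Ck 2 (chart_cod p) (F p). Proof. exact: f2. Qed.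
Let oc p := @open_chart_cod _ _ M p.
Let zero_rad x : ((tnorm x 0)%:E <= rad x)%E.
Proof. by rewrite tnorm0 ltW//; exact: (retr_radius ret). Qed.

Let psi x := fun s => chart x (retr x s).

Lemma retr_near0 x : exists W : set 'rV[R]_n, [/\ open W, W 0,
    forall s, W s -> chart_dom x (retr x s) &
    forall j k, Ck k W (fun s => chart x (retr x s) 0 j)].
Proof.
apply: retr_local; first exact: zero_rad.
by rewrite (retr_center ret); exact: mem_chart_dom.
Qed.

Lemma pullback_C2 x (W : set 'rV[R]_n) : open W ->
  (forall s, W s -> chart_dom x (retr x s)) ->
  (forall j k, Ck k W (fun s => chart x (retr x s) 0 j)) ->
  Ck 2 W (pullback f retr x).
Proof.
move=> oW HW CW; apply: (@eq_Ck _ _ _ _ (fun s => F x (psi x s))).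
- exact: oW.
- by move=> s Ws; rewrite /F /psi chartK//; exact: HW.
- apply: (@Ck_comp _ _ _ 2 W (chart_cod x) (psi x) (F x) oW (@oc x)).
  + by move=> s Ws; apply: chart_fun; exact: HW.
  + by move=> j; exact: CW.
  + exact: CF.
Qed.

Lemma psi0 x : psi x 0 = chart x x.
Proof. by rewrite /psi (retr_center ret). Qed.

Lemma partial_pullback0 x i :
  'D_(basis_vec i) (pullback f retr x) 0 = 'D_(basis_vec i) (F x) (chart x x).
Proof.
have [W [oW W0 HW CW]] := retr_near0 x.
have C2 := pullback_C2 oW HW CW.
pose y (t : R) : 'rV[R]_n := 0 + t *: basis_vec i.
have Dy := is_derive_affine (0 : 'rV[R]_n) (basis_vec i) 0.
have y0 : y 0 = 0 by rewrite /y scale0r addr0.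
have Wy : W (y 0) by rewrite y0.
have D1 := C1_chain oW (CkW C2) Wy Dy; rewrite D1form_basis y0 in D1.
have Dpsi : is_derive (0 : R) 1 (fun t => psi x (y t)) (basis_vec i).
  apply: is_derive_row => j.
  have D := C1_chain oW (CW j 1%N) Wy Dy; rewrite D1form_basis y0 in D.
  have [_ E] := is_derive_coord j (retr_rigid ret x (basis_vec i)).
  by rewrite E in D.
have NW : \forall t \near (0 : R), W (y t).
  by apply: (is_derive1_continuous Dy); exact: open_nbhs_nbhs (conj oW Wy).
have px : chart_cod x (psi x (y 0)) by apply: chart_fun; exact: HW.
have D2 := C1_chain (@oc x) (CkW (@CF x)) px Dpsi; rewrite D1form_basis y0 psi0 in D2.
have D3 : is_derive (0 : R) 1 (fun t => pullback f retr x (y t))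
    ('D_(basis_vec i) (F x) (chart x x)).
  apply: near_eq_is_derive D2.
  by apply: filterS NW => t Wt; rewrite /F /psi /pullback chartK//; exact: HW.
have [_ E1] := D1; have [_ E2] := D3.
exact: etrans (esym E1) E2.
Qed.

Lemma pullback_grad0 x : pullback_grad f retr x 0 = grad f x.
Proof.
rewrite /pullback_grad /grad /grad_chart /gram_at; congr (_ *m _).
by apply/rowP => i; rewrite !mxE; exact: partial_pullback0.
Qed.

(** The pullback lives on a vector space with a constant metric, so that no
    Christoffel symbols appear. *)
Lemma inner_pullback_hess x v w :
  inner x v (w *m pullback_hess f retr x 0) = D2form (pullback f retr x) 0 w v.
Proof.
have [W [oW W0 HW CW]] := retr_near0 x.
have C2 := pullback_C2 oW HW CW.
pose G := gram_at x.
pose pg := pullback_grad f retr x.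
have Cpg j : Ck 1 W (fun s => pg s 0 j).
  apply: (@eq_Ck _ _ _ _ (fun s => \sum_k 'D_(basis_vec k) (pullback f retr x) s * invmx G k j)).
  - exact: oW.
  - by move=> s _; rewrite mxE; apply: eq_bigr => k _; rewrite mxE.
  - apply: Ck_sum => [|k]; first exact: oW.
    by apply: CkM; [exact: oW|exact: Ck_partial|exact: Ck_cst].
have bpg v' s : bil G v' (pg s) = D1form (pullback f retr x) s v'.
  rewrite bil_invmx; [|exact: gram_at_sym|exact: gram_at_unit].
  by apply: eq_bigr => i _; rewrite mxE.
have hE : w *m pullback_hess f retr x 0 = \row_j D1form (fun s => pg s 0 j) 0 w.
  apply/rowP => j; rewrite mxE [RHS]mxE; apply: eq_bigr => i _; rewrite mxE; congr (_ * _).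
  rewrite derive_mx ?mxE//; apply/derivable_mxP => a k; rewrite ord1.
  exact: (Ck_derivable (Cpg k) W0).
pose y (t : R) : 'rV[R]_n := 0 + t *: w.
have y0 : y 0 = 0 by rewrite /y scale0r addr0.
have Dy : is_derive (0 : R) 1 y w := is_derive_affine 0 w 0.
have Wy : W (y 0) by rewrite y0.
have D1 : is_derive (0 : R) 1 (fun t => D1form (pullback f retr x) (y t) v)
    (inner x v (w *m pullback_hess f retr x 0)).
  have DG : is_derive (0 : R) 1 (fun t => pg (y t)) (w *m pullback_hess f retr x 0).
    apply: is_derive_row => j; have := C1_chain oW (Cpg j) Wy Dy.
    by rewrite hE y0 mxE.
  have bE r : bil G v r = \sum_j (v *m G) 0 j * r 0 j.
    by rewrite /bil mxE; apply: eq_bigr => j _; congr (_ * _); rewrite mxE.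
  have D := is_derive_fsum (index_enum 'I_n) (fun j => is_derive_mul
    (is_derive_cst ((v *m G) 0 j) (0 : R) (1 : R)) (is_derive_coord j DG)).
  apply: is_derive_congr D _ _; first by apply/funext => t; rewrite -bpg bE.
  by rewrite innerE bE; apply: eq_bigr => j _; rewrite mul0r add0r.
have D2 := is_derive_D1form v oW C2 Wy Dy; rewrite y0 in D2.
have [_ E1] := D1; have [_ E2] := D2.
exact: etrans (esym E1) E2.
Qed.

Lemma inner_pullback_hess_sym x v w :
  inner x v (w *m pullback_hess f retr x 0) = inner x w (v *m pullback_hess f retr x 0).
Proof.
have [W [oW W0 HW CW]] := retr_near0 x.
have C2 := pullback_C2 oW HW CW.
rewrite !inner_pullback_hess; exact: (D2formC w v oW C2 W0).
Qed.

Hypothesis ret2 : second_order_retraction retr.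

(** Both sides are the second derivative at 0 of [t |-> f (retr x (t *: v))]. Read
    in the chart at [x], this derivative is the second derivative of [f] applied to
    [(v, v)] plus its first derivative applied to the second derivative of the
    curve, which is minus the Christoffel term because the acceleration vanishes. *)
Lemma pullback_hess_quadratic x v :
  inner x v (v *m pullback_hess f retr x 0) = inner x v (v *m hess f x).
Proof.
rewrite hess_quadratic// inner_pullback_hess.
have [W [oW W0 HW CW]] := retr_near0 x.
have C2 := pullback_C2 oW HW CW.
pose y (t : R) : 'rV[R]_n := t *: v.
have Dy (t : R) : is_derive t 1 y v.
  have := is_derive_affine (0 : 'rV[R]_n) v t.
  by rewrite (_ : (fun s : R => 0 + s *: v) = y)//; apply/funext => s; rewrite add0r.
have y0 : y 0 = 0 by rewrite /y scale0r.
have Wy : W (y 0) by rewrite y0.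
have dy : \forall t \near (0 : R), derivable y t 1 by near=> t; have [] := Dy t.
have y'E : derive1 y = (fun=> v).
  by apply/funext => t; rewrite derive1E; have [_ ->] := Dy t.
have D2y : is_derive (0 : R) 1 (derive1 y) 0.
  by rewrite y'E; exact: is_derive_cst.
have [_ DA] := C2_chain2 oW C2 Wy dy D2y.
rewrite D1form0 addr0 y'E y0 in DA.
pose u (t : R) := psi x (y t).
have Cy (t : R) : W (y t) -> is_derive t 1 u
   (\row_j D1form (fun s => psi x s 0 j) (y t) v).
  move=> Wt; apply: is_derive_row => j; rewrite mxE.
  exact: (C1_chain oW (CW j 1%N) Wt (Dy t)).
have NW : \forall t \near (0 : R), W (y t).
  by apply: (is_derive1_continuous (Dy 0)); exact: open_nbhs_nbhs (conj oW Wy).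
have du : \forall t \near (0 : R), derivable u t 1.
  by apply: filterS NW => t /Cy[].
pose a : 'rV[R]_n := \row_j (D2form (fun s => psi x s 0 j) 0 v v).
have Da : is_derive (0 : R) 1 (derive1 u) a.
  apply: is_derive_row => j.
  have [_ D] := C2_chain2 oW (CW j 2%N) Wy dy D2y.
  rewrite D1form0 addr0 y'E y0 in D.
  rewrite mxE; apply: near_eq_is_derive D.
  apply: filterS NW => t /Cy Dt; rewrite derive1E [in RHS]derive1E.
  by have [_ ->] := is_derive_coord j Dt; have [_ ->] := Dt.
have u'0 : derive1 u 0 = v.
  rewrite derive1E; have [_ E] := Cy 0 Wy; rewrite E; apply/rowP => j; rewrite mxE y0.
  have [_ E2] := is_derive_coord j (retr_rigid ret x v).
  by rewrite -(C1_deriveE v oW (CW j 1%N) W0) -[RHS]E2.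
have acc : a + christoffel_form x (chart x x) v v = 0.
  have := ret2 x v; rewrite /acceleration /velocity scale0r (retr_center ret).
  have -> : derive1 (coord_curve x (fun t : R => retr x (t *: v))) 0 = v := u'0.
  have -> : derive1n 2 (coord_curve x (fun t : R => retr x (t *: v))) 0 = a.
    by have [_ <-] := Da; rewrite -derive1E.
  exact.
have xu : chart_cod x (u 0) by apply: chart_fun; exact: HW.
have [_ DB] := C2_chain2 (@oc x) (@CF x) xu du Da.
have u0 : u 0 = chart x x by rewrite /u y0 psi0.
rewrite u'0 u0 in DB.
have DB' : is_derive (0 : R) 1 (derive1 (fun t => pullback f retr x (y t)))
   (D2form (F x) (chart x x) v v + D1form (F x) (chart x x) a).
  apply: near_eq_is_derive DB.
  have N2 := near_join NW.
  apply: filterS N2 => t Nt; rewrite !derive1E; apply: near_eq_derive.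
  by apply: filterS Nt => t' Wt'; rewrite /F /u /psi /pullback chartK//; exact: HW.
have [_ E1] := DA; have [_ E2] := DB'.
have -> : D2form (pullback f retr x) 0 v v =
  D2form (F x) (chart x x) v v + D1form (F x) (chart x x) a := etrans (esym E1) E2.
have -> : a = - christoffel_form x (chart x x) v v.
  by apply/eqP; rewrite -addr_eq0 acc.
by rewrite D1formN.
Unshelve. all: by end_near. Qed.

End Retraction.

(** * Strong convexity along geodesics *)

Lemma near_at_right {R : realType} (x : R) (P : set R) :
  (\forall t \near x, P t) -> \forall t \near x^'+, P t.
Proof. by move=> N; apply: (filterS _ N) => t Pt _. Qed.

Section LambdaMin.
Context {R : realType} {n : nat}.

(** The bound [c <= 0] covers the case of an empty spectrum, whose infimum is 0 by
    convention. *)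
Lemma lambda_min_ge (A : 'M[R]_n) (c : R) : c <= 0 ->
  (forall a, eigenvalue A a -> c <= a) -> c <= lambda_min A.
Proof.
move=> c0 H; rewrite /lambda_min.
have [S0|/set0P S0] := eqVneq [set a : R | eigenvalue A a] set0.
  by rewrite S0 inf0.
by apply: lb_le_inf => // a /H.
Qed.

(** A negative infimum is not the conventional value 0, hence it is approached by
    eigenvalues. *)
Lemma lambda_min_lt (A : 'M[R]_n) (b e : R) : 0 < b -> 0 < e -> lambda_min A <= - b ->
  exists2 a, eigenvalue A a & a < - b + e.
Proof.
move=> b0 e0 Ab.
have hi : has_inf [set a : R | eigenvalue A a].
  apply: contrapT => /inf_out E; move: Ab; rewrite /lambda_min E.
  by rewrite lerNr oppr0 leNgt b0.
have [a Sa al] := inf_adherent e0 hi.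
by exists a => //; apply: lt_le_trans al _; rewrite lerD2r.
Qed.

End LambdaMin.

Section StrongConvexity.
Context {R : realType} {n : nat} {M : riemannian_manifold R n}.
Implicit Types (p q x y z : M) (c : R -> M).

Lemma dist_ball_near x y (r : R) : (dist x y < r%:E)%E ->
  \forall z \near y, (dist x z < r%:E)%E.
Proof.
move=> xy; have := dist_ge0 x y; move: (xy); case E : (dist x y) => [d| |] // dr _.
rewrite lte_fin in dr.
have e0 : 0 < (r - d) / 2 by rewrite divr_gt0// subr_gt0.
apply: filterS (dist_near y e0) => z yz.
have xy' : (dist x y < (d + (r - d) / 2)%:E)%E by rewrite E lte_fin ltrDl.
have := dist_lt_trans xy' yz.
by have -> : d + (r - d) / 2 + (r - d) / 2 = r by field.
Qed.

Lemma dist_xx x : (dist x x <= 0)%E.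
Proof. by have := @dist_le_joins _ _ _ x x [::] erefl; rewrite big_nil. Qed.

Variables (f : M -> R) (gamma delta : R) (xs : M).
Hypotheses (f2 : C2_on_manifold f) (g0 : 0 < gamma) (d0 : 0 < delta).
Hypothesis xs_min : local_minimizer f xs.
Let B : set M := [set y | (dist xs y < (2 * delta)%:E)%E].
Hypothesis cvx : geodesically_strongly_convex f gamma B.

Let xsB : B xs.
Proof. by apply: le_lt_trans (dist_xx xs) _; rewrite lte_fin mulr_gt0. Qed.

(** [L] is the length of a geodesic from the minimizer [xs] to [y] inside the ball.
    Strong convexity along it gives quadratic growth, because the function does not
    decrease at the end [xs]. The tangent inequality at the other end bounds
    [f y - f xs] by [|grad| L - gamma / 2 * L ^+ 2], which is maximal at
    [L = |grad| / gamma]. *)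
Lemma strong_convexity_bounds y : B y ->
  exists L : R, [/\ 0 <= L, (dist xs y <= L%:E)%E,
    f xs + gamma / 2 * L ^+ 2 <= f y &
    f y - f xs <= tnorm y (grad f y) ^+ 2 / (2 * gamma)].
Proof.
move=> By; have [cv H] := cvx.
have [c [gc c0 c1 cB]] := cv xs y xsB By.
have [Cc _] := gc.
pose L := curve_length c; pose h := fun t => f (c t).
have L0 : 0 <= L := curve_length_ge0 c.
have z01 : 0 <= (0 : R) <= 1 by rewrite lexx ler01.
have o01 : 0 <= (1 : R) <= 1 by rewrite lexx ler01.
have Dh (t : R) (t01 : 0 <= t <= 1) := is_derive_f_curve f2 Cc t01.
have h_const : L = 0 -> h 1 = h 0.
  move=> L00; have D (t : R) : t \in `[0, 1] -> is_derive t 1 h 0.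
    rewrite in_itv/= => t01; apply: is_derive_congr (Dh t t01) (erefl _) _.
    apply/eqP; rewrite -normr_le0; apply: le_trans (inner_le_tnorm _ _ _) _.
    by rewrite -/(speed c t) -(geodesic_length gc t01) -/L L00 mul0r.
  have [s _] := mean_value ler01 D.
  by rewrite mul0r => /eqP; rewrite subr_eq0 => /eqP.
exists L; split=> //.
- by rewrite -c0 -c1; exact: dist_le_curve.
- have [L00|Lne] := eqVneq L 0.
    have E := h_const L00.
    by move: E; rewrite /h c0 c1 => ->; rewrite L00 expr0n mulr0 addr0.
  have Lp : 0 < L by rewrite lt_neqAle eq_sym Lne.
  have sc := H c gc cB Lp.
  have Nmin : \forall t \near (0 : R)^'+, h 0 <= h t.
    have ct : {for 0, continuous c} := (Cc 0 z01).1.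
    have N : \forall t \near (0 : R), f xs <= f (c t).
      have xs_min' : nbhs (c 0) [set y | f xs <= f y] by rewrite c0; exact: xs_min.
      exact: (ct _ xs_min').
    by apply: near_at_right; apply: filterS N => t; rewrite /h c0.
  set mu := gamma * L ^+ 2 in sc.
  have mu0 : 0 < mu by rewrite mulr_gt0// exprn_gt0.
  have -> : gamma / 2 * L ^+ 2 = mu / 2 by rewrite /mu mulrAC.
  rewrite -c0 -c1 -/(h 0) -/(h 1); apply/ler_addgt0Pr => e e0.
  near (0 : R)^'+ => t.
  have t0 : 0 < t by near: t; exact: nbhs_right_gt.
  have t1 : t <= 1 by near: t; exact: nbhs_right_le.
  have te : t <= e / (mu / 2) by near: t; apply: nbhs_right_le; rewrite !divr_gt0.
  have ht : h 0 <= h t by near: t; exact: Nmin.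
  have := sc 0 1 t z01 o01; rewrite t1 (ltW t0) => /(_ isT).
  rewrite mulr0 add0r mulr1 subr0 expr1n mulr1 -/(h t) -/(h 0) -/(h 1).
  rewrite ler_pdivlMr ?divr_gt0// in te.
  move=> S; rewrite -(ler_pM2l t0).
  have : t * (t * (mu / 2)) <= t * e by rewrite ler_pM2l.
  move: S ht; move: (h 0) (h t) (h 1) => h0 ht h1; nra.
- pose gn := tnorm y (grad f y).
  have gn0 : 0 <= gn := tnorm_ge0 _ _.
  have key : h 1 - h 0 <= gn * L - gamma / 2 * L ^+ 2.
    have I1 : inner (c 1) (velocity c 1) (grad f (c 1)) <= gn * L.
      apply: le_trans (ler_norm _) _; apply: le_trans (inner_le_tnorm _ _ _) _.
      by rewrite -/(speed c 1) -(geodesic_length gc o01) c1 mulrC.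
    have [L00|Lne] := eqVneq L 0.
      by rewrite (h_const L00) subrr L00 expr0n !mulr0 subr0.
    have Lp : 0 < L by rewrite lt_neqAle eq_sym Lne.
    have sc := H c gc cB Lp.
    have := strongly_convex_tangent sc o01 z01 (Dh 1 o01).
    rewrite -/(h 0) -/(h 1) sub0r mulrN1 sqrrN expr1n mulr1 -/L.
    move: I1; move: (inner _ _ _) (h 0) (h 1) => I h0 h1; lra.
  have -> : f y - f xs = h 1 - h 0 by rewrite /h c0 c1.
  apply: le_trans key _; rewrite ler_pdivlMr ?mulr_gt0// -/gn.
  have := sqr_ge0 (gn - gamma * L).
  have : (gn - gamma * L) ^+ 2 = gn ^+ 2 - (gn * L - gamma / 2 * L ^+ 2) * (2 * gamma) by field.
  by move=> ->; rewrite subr_ge0.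
Unshelve. all: by end_near. Qed.

(** A short geodesic issued from [x] with velocity parallel to [v] stays in the
    ball. Strong convexity bounds the second derivative of [f] along it from below,
    and this derivative is the quadratic form of the Hessian since the geodesic has
    no acceleration. *)
Lemma strong_convexity_hess x v : B x ->
  gamma * inner x v v <= inner x v (v *m hess f x).
Proof.
move=> Bx; have [->|v0] := eqVneq v 0.
  by rewrite mul0mx !innerE bil0r mulr0.
have [cv H] := cvx.
have [eta [c [eta0 gc c0 cB cv0]]] := geodesic_exists v (dist_ball_near Bx).
have [Cc geo] := gc.
have z01 : 0 <= (0 : R) <= 1 by rewrite lexx ler01.
have LE : curve_length c = eta * tnorm x v.
  by rewrite (geodesic_length gc z01) /speed c0 cv0 tnormZ gtr0_norm.
have L0 : 0 < curve_length c by rewrite LE mulr_gt0// tnorm_gt0.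
have sc := H c gc cB L0.
pose h := fun t => f (c t).
have Dh (t : R) (t01 : 0 <= t <= 1) := is_derive_f_curve f2 Cc t01.
have {}Dh (t : R) : 0 <= t <= 1 -> is_derive t 1 h (derive1 h t).
  by move=> t01; apply: is_derive_derive1; have [] := Dh t t01.
set mu := gamma * curve_length c ^+ 2 in sc.
have mono (t : R) : 0 < t <= 1 -> mu * t <= derive1 h t - derive1 h 0.
  move=> /andP[t0 t1]; have t01 : 0 <= t <= 1 by rewrite (ltW t0).
  have A := strongly_convex_tangent sc z01 t01 (Dh 0 z01).
  have B' := strongly_convex_tangent sc t01 z01 (Dh t t01).
  rewrite -/h subr0 sub0r in A B'.
  rewrite -(ler_pM2l t0); move: A B'; rewrite -/(h 0) -/(h t).
  move: (h 0) (h t) (derive1 h 0) (derive1 h t) => a b a' b'; rewrite sqrrN; lra.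
have [d2 acc] := geo 0 z01.
pose a := derive1 (derive1 (coord_curve (c 0) c)) 0.
have Da : is_derive (0 : R) 1 (derive1 (coord_curve (c 0) c)) a := is_derive_derive1 d2.
have D2 := is_derive2_f_curve f2 Cc z01 Da.
have aE : a = - christoffel_form x (chart x x) (eta *: v) (eta *: v).
  move: acc; rewrite /acceleration cv0 c0 => acc.
  by apply/eqP; rewrite -addr_eq0 /a c0; apply/eqP.
rewrite aE D1formN cv0 c0 -hess_quadratic// in D2.
set Q := inner x _ _ in D2.
have QE : Q = eta ^+ 2 * inner x v (v *m hess f x).
  by rewrite /Q -scalemxAl !innerE bilZl bilZr mulrA -expr2.
have muQ : mu <= Q.
  apply/ler_addgt0Pr => e e0.
  have N := is_derive1_near D2 e0.
  have N' : \forall t \near (0 : R)^'+,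
     `|derive1 h (0 + t) - derive1 h 0 - t *: Q| <= e * `|t|.
    exact: near_at_right N.
  near (0 : R)^'+ => t.
  have t0 : 0 < t by near: t; exact: nbhs_right_gt.
  have t1 : t <= 1 by near: t; exact: nbhs_right_le.
  have : `|derive1 h (0 + t) - derive1 h 0 - t *: Q| <= e * `|t| by near: t; exact: N'.
  rewrite add0r (gtr0_norm t0) ler_norml => /andP[_].
  have := mono t; rewrite t0 t1 => /(_ isT) A Bd.
  rewrite -(ler_pM2l t0); rewrite /GRing.scale/= in Bd.
  move: A Bd; move: (derive1 h t) (derive1 h 0) => p q; lra.
move: muQ; rewrite QE /mu LE exprMn sqr_tnorm mulrCA.
by rewrite ler_pM2l// exprn_gt0.
Unshelve. all: by end_near. Qed.

(** By [strong_convexity_bounds] the gradient bound makes [f x - f xs] smaller than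
    [gamma / 2 * delta ^+ 2], and every point of the ball of radius [2 * delta]
    where [f] is at most [f x] is then at distance less than [delta] from [xs]. A
    path on which [f] does not exceed its initial value would have to cross the
    shell between the two radii in order to leave; by connectedness it cannot. *)
Lemma strong_convexity_trap x (P : R -> M) : (dist x xs <= delta%:E)%E ->
  tnorm x (grad f x) < gamma * delta -> P 0 = x ->
  (forall t, 0 <= t <= 1 -> {for t, continuous P} /\ f (P t) <= f x) ->
  (dist (P 1%R) xs <= delta%:E)%E.
Proof.
move=> xd gx P0 HP.
have d2 : delta < 2 * delta by rewrite ltr_pMl// ltr1n.
have Bx : B x.
  by rewrite /B/= dist_sym; apply: le_lt_trans xd _; rewrite lte_fin.
have fx : f x - f xs < gamma / 2 * delta ^+ 2.
  have [L [_ _ _ H]] := strong_convexity_bounds Bx.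
  apply: le_lt_trans H _; rewrite ltr_pdivrMr ?mulr_gt0//.
  have -> : gamma / 2 * delta ^+ 2 * (2 * gamma) = (gamma * delta) ^+ 2 by field.
  by rewrite ltr_pXn2r// ?nnegrE ?tnorm_ge0// mulr_ge0 ?ltW.
have near_xs y : B y -> f y <= f x -> (dist xs y < delta%:E)%E.
  move=> By fy; have [L [L0 dL H _]] := strong_convexity_bounds By.
  apply: le_lt_trans dL _; rewrite lte_fin.
  have : gamma / 2 * L ^+ 2 < gamma / 2 * delta ^+ 2.
    by move: fx H fy; move: (f x) (f xs) (f y) => a b c; lra.
  by rewrite ltr_pM2l ?divr_gt0// ltr_pXn2r// ?nnegrE// ltW.
pose T := [set t : R | (0 <= t <= 1) /\ B (P t)].
have TE : T = `[0, 1]%classic.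
  apply: (@segment_connected R 0 1).
  - by exists 0; split; [rewrite lexx ler01|rewrite P0].
  - exists (interior [set t | B (P t)]); first exact: open_interior.
    apply/seteqP; split=> [t [t01 Bt]|t [/= t01 /interior_subset Bt]].
      split; first by rewrite /= in_itv.
      by have [Pt _] := HP t t01; apply: Pt; exact: dist_ball_near.
    by split=> //; move: t01; rewrite in_itv.
  - exists (closure T); first exact: closed_closure.
    apply/seteqP; split=> [t Tt|t [/= t01 cT]].
      split; last exact: subset_closure.
      by case: Tt; rewrite /= in_itv.
    have {}t01 : 0 <= t <= 1 by move: t01; rewrite in_itv.
    have [Pt _] := HP t t01.
    have N : \forall s \near t, (dist (P t) (P s) < delta%:E)%E.
      exact: (Pt _ (dist_near (P t) d0)).
    have [s [[s01 Bs] ts]] := cT _ N.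
    split=> //; rewrite /B/=.
    have xsPs := near_xs _ Bs (HP s s01).2.
    by have := dist_lt_trans xsPs (dist_lt_sym ts); rewrite -mulr2n mulr_natl.
have o01 : 0 <= (1 : R) <= 1 by rewrite lexx ler01.
have [_ B1] : T 1 by rewrite TE/= in_itv.
rewrite dist_sym; apply: ltW; apply: near_xs B1 _; exact: (HP 1 o01).2.
Qed.

End StrongConvexity.

(** * One trust-region iteration *)

Section TrustRegionStep.
Context {R : realType} {n : nat} {M : riemannian_manifold R n}.
Variables (f : M -> R) (retr : M -> 'rV[R]_n -> M) (rad : M -> \bar R).
Hypotheses (f2 : C2_on_manifold f) (ret : is_retraction retr rad)
  (ret2 : second_order_retraction retr).
Variables (x : M) (s : 'rV[R]_n) (Delta : R).
Hypotheses (Delta0 : 0 < Delta) (sD : tnorm x s <= Delta).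
Hypothesis smin : forall v, tnorm x v <= Delta ->
  model f retr x s <= model f retr x v.

Let g := grad f x.
Let H := pullback_hess f retr x 0.
Let quad v := inner x v (v *m H).

Lemma tnormD v w : tnorm x (v + w) <= tnorm x v + tnorm x w.
Proof.
have nn : 0 <= tnorm x v + tnorm x w by rewrite addr_ge0 ?tnorm_ge0.
rewrite -(ler_pXn2r (n := 2))// ?nnegrE ?tnorm_ge0// sqr_tnorm sqrrD !sqr_tnorm.
rewrite innerE bilDl !bilDr -!innerE (innerC x w v).
have := le_trans (ler_norm _) (inner_le_tnorm x v w).
move: (inner x v v) (inner x v w) (inner x w w) (tnorm x v * tnorm x w) => a b c d.
by lra.
Qed.

Definition model_decrease : R := model f retr x 0 - model f retr x s.

Let modelE v : model f retr x v = f x + inner x v g + 2^-1 * quad v.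
Proof. by []. Qed.

Let model0 : model f retr x 0 = f x.
Proof. by rewrite modelE /quad !innerE !bil0l mulr0 !addr0. Qed.

Lemma model_decreaseE : model_decrease = - inner x s g - 2^-1 * quad s.
Proof.
rewrite /model_decrease model0 modelE; move: (f x) (inner x s g) (quad s) => a b c.
by ring.
Qed.

Lemma model_decrease_ge v : tnorm x v <= Delta ->
  - inner x v g - 2^-1 * quad v <= model_decrease.
Proof.
move=> /smin; rewrite /model_decrease model0 !modelE.
move: (f x) (inner x s g) (quad s) (inner x v g) (quad v) => a b c d e; lra.
Qed.

Lemma model_decrease_ge0 : 0 <= model_decrease.
Proof.
have := @model_decrease_ge 0; rewrite tnorm0 /quad !innerE !bil0l oppr0 mulr0 subr0.
by apply; exact: ltW.
Qed.

Lemma quadZ a v : quad (a *: v) = a ^+ 2 * quad v.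
Proof. by rewrite /quad -scalemxAl !innerE bilZl bilZr mulrA -expr2. Qed.

(** The step along the negative gradient whose length is the smaller one of
    [Delta] and of the minimizer of a quadratic with curvature [kappa]. *)
Lemma cauchy_decrease (kappa a : R) : 0 < kappa -> opnorm x H <= kappa ->
  0 < a -> a <= tnorm x g ->
  2^-1 * Num.min (Delta * a) (a ^+ 2 / kappa) <= model_decrease.
Proof.
move=> k0 Hk a0 ag; set G := tnorm x g in ag.
have G0 : 0 < G := lt_le_trans a0 ag.
pose t := Num.min (Delta / G) kappa^-1.
have t0 : 0 < t by rewrite lt_min divr_gt0//= invr_gt0.
have tD : t * G <= Delta by rewrite -ler_pdivlMr// ge_min lexx.
have tk : t * kappa <= 1 by rewrite -ler_pdivlMr// div1r ge_min lexx orbT.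
have nv : tnorm x (- t *: g) <= Delta by rewrite tnormZ normrN gtr0_norm.
have Q : quad (- t *: g) <= t ^+ 2 * (kappa * G ^+ 2).
  rewrite quadZ sqrrN ler_pM2l ?exprn_gt0//.
  apply: le_trans (ler_norm _) _; apply: le_trans (inner_le_tnorm _ _ _) _.
  rewrite -/G mulrC expr2 mulrA ler_pM2r//.
  by apply: le_trans (tnorm_mul_le _ _ _) _; rewrite -/G ler_pM2r.
have := model_decrease_ge nv.
rewrite [inner x (- t *: g) g]innerE bilZl -innerE -sqr_tnorm -/G.
move=> md; apply: (@le_trans _ _ (2^-1 * (t * G ^+ 2))).
  rewrite ler_pM2l ?invr_gt0// /t.
  have [_|_] := leP (Delta / G) kappa^-1.
    rewrite expr2 mulrA divfK ?gt_eqF//.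
    by rewrite ge_min; apply/orP; left; rewrite ler_pM2l.
  rewrite ge_min; apply/orP; right; rewrite mulrC ler_pM2l ?invr_gt0//.
  by rewrite ler_pXn2r// nnegrE ltW.
apply: le_trans md.
have : t * (t * kappa * G ^+ 2) <= t * (1 * G ^+ 2).
  by rewrite ler_pM2l// ler_wpM2r// sqr_ge0.
have E : t ^+ 2 * (kappa * G ^+ 2) = t * (t * kappa * G ^+ 2) by ring.
rewrite mul1r -E mulNr opprK; move: Q.
move: (t ^+ 2 * (kappa * G ^+ 2)) (quad _) (t * G ^+ 2) => a' b' c'; lra.
Qed.

(** One of [v] and [- v] is not an ascent direction; follow it up to the boundary of
    the trust region. *)
Lemma curvature_decrease (b : R) v : v != 0 -> quad v <= - b * tnorm x v ^+ 2 ->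
  2^-1 * (b * Delta ^+ 2) <= model_decrease.
Proof.
move=> v0 qv; have tv := tnorm_gt0 x v0.
suff key w : w != 0 -> inner x w g <= 0 -> quad w <= - b * tnorm x w ^+ 2 ->
    2^-1 * (b * Delta ^+ 2) <= model_decrease.
  have [vg|vg] := leP (inner x v g) 0; first exact: (key v).
  apply: (key (- v)).
  - by rewrite oppr_eq0.
  - by rewrite innerE bilNl -innerE oppr_le0 ltW.
  - by rewrite tnormN -scaleN1r quadZ sqrrN expr1n mul1r.
move=> w0 wg qw; have tw := tnorm_gt0 x w0.
pose t := Delta / tnorm x w.
have t0 : 0 < t by rewrite divr_gt0.
have tE : t * tnorm x w = Delta by rewrite divfK// gt_eqF.
have nw : tnorm x (t *: w) <= Delta by rewrite tnormZ gtr0_norm// tE.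
apply: le_trans (model_decrease_ge nw).
rewrite quadZ innerE bilZl -innerE -tE exprMn.
have : t ^+ 2 * quad w <= t ^+ 2 * (- b * tnorm x w ^+ 2) by rewrite ler_pM2l// exprn_gt0.
have : t * inner x w g <= 0 by rewrite pmulr_rle0.
have -> : t ^+ 2 * (- b * tnorm x w ^+ 2) = - (b * (t ^+ 2 * tnorm x w ^+ 2)) by ring.
move: (b * _) (t ^+ 2 * quad w) (t * inner x w g) => a' b' c'; lra.
Qed.

(** The smallest eigenvalue is only available as an infimum, hence the limit
    argument with eigenvalues close to it. *)
Lemma saddle_decrease (b : R) : 0 < b -> lambda_min (hess f x) <= - b ->
  2^-1 * (b * Delta ^+ 2) <= model_decrease.
Proof.
move=> b0 lb; apply/ler_addgt0Pr => e e0.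
pose e' := e / Delta ^+ 2.
have D2 : 0 < Delta ^+ 2 by rewrite exprn_gt0.
have e'0 : 0 < e' by rewrite divr_gt0.
have [l /eigenvalueP[v vl v0] ll] := lambda_min_lt b0 e'0 lb.
have qv : quad v <= - (b - e') * tnorm x v ^+ 2.
  have -> : quad v = inner x v (v *m hess f x) by apply: pullback_hess_quadratic ret _ f2 ret2 x v.
  rewrite vl innerE bilZr -innerE -sqr_tnorm ler_pM2r ?exprn_gt0 ?tnorm_gt0//.
  by rewrite opprB addrC ltW.
have := curvature_decrease v0 qv.
have -> : (b - e') * Delta ^+ 2 = b * Delta ^+ 2 - e by rewrite mulrBl divfK// gt_eqF.
move: (b * _) model_decrease => a' b'; lra.
Qed.

(** First-order optimality of [s] for the model: the second-order term of a short
    move along a feasible direction is negligible. *)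
Lemma model_first_order w e0 : 0 < e0 ->
  (forall e, 0 < e <= e0 -> tnorm x (s + e *: w) <= Delta) ->
  0 <= inner x w (g + s *m H).
Proof.
move=> e00 nw; rewrite leNgt; apply/negP => neg; set a := inner x w _ in neg.
have Q1 : 0 < `|quad w| + 1 by rewrite ltr_wpDl.
pose e := Num.min e0 (- a / (`|quad w| + 1)).
have e_gt0 : 0 < e by rewrite lt_min e00 divr_gt0// oppr_gt0.
have ea : e * (`|quad w| + 1) <= - a by rewrite -ler_pdivlMr// ge_min lexx orbT.
have sym : inner x s (w *m H) = inner x w (s *m H).
  exact: (inner_pullback_hess_sym ret f2).
have : model f retr x (s + e *: w) = model f retr x s + e * (a + 2^-1 * (e * quad w)).
  rewrite !modelE /a /quad mulmxDl -scalemxAl !innerE !(bilDl, bilDr, bilZl, bilZr).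
  rewrite -!innerE sym.
  move: (f x) (inner x s g) (inner x w g) (inner x s (s *m H)) => b b1 b2 b3.
  by move: (inner x w (s *m H)) (inner x w (w *m H)) => b4 b5; field.
have := @smin (s + e *: w); rewrite nw; last by rewrite e_gt0 ge_min lexx.
move=> /(_ isT) + E; rewrite E lerDl pmulr_rge0//.
have := ler_norm (quad w); rewrite -(ler_pM2l e_gt0); move: ea; rewrite mulrDr mulr1.
move: (e * `|quad w|) (e * quad w) => u v; move: e_gt0 neg; move: (e) (a) => e1 a1; lra.
Qed.

(** Shrinking [s] is a feasible move. *)
Lemma radial_step : inner x s g + quad s <= 0.
Proof.
have : 0 <= inner x (- s) (g + s *m H).
  apply: (@model_first_order _ 1) => // e /andP[e0 e1].
  have -> : s + e *: - s = (1 - e) *: s by rewrite scalerN scalerBl scale1r.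
  rewrite tnormZ ger0_norm ?subr_ge0//; apply: le_trans sD.
  by rewrite ler_piMl ?tnorm_ge0// gerBl ltW.
by rewrite innerE bilNl bilDr -!innerE oppr_ge0.
Qed.

Lemma radial_decrease : 2^-1 * quad s <= model_decrease.
Proof.
rewrite model_decreaseE; have := radial_step.
move: (inner x s g) (quad s) => a b; lra.
Qed.

Section Convex.
Variable gamma : R.
Hypotheses (g0 : 0 < gamma) (Hg : forall v, gamma * inner x v v <= quad v).

Lemma quad_ge0 v : 0 <= quad v.
Proof. by apply: le_trans (Hg v); rewrite mulr_ge0 ?inner_ge0// ltW. Qed.

Lemma convex_decrease_norm : 2^-1 * (gamma * tnorm x s ^+ 2) <= model_decrease.
Proof.
apply: le_trans radial_decrease; rewrite ler_pM2l ?invr_gt0// sqr_tnorm; exact: Hg.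
Qed.

Lemma convex_step_norm : gamma * tnorm x s <= tnorm x g.
Proof.
have [->|s0] := eqVneq s 0; first by rewrite tnorm0 mulr0 tnorm_ge0.
have ts := tnorm_gt0 x s0.
rewrite -(ler_pM2r ts) -mulrA -expr2 sqr_tnorm.
apply: le_trans (Hg s) _.
have : quad s <= - inner x s g by have := radial_step; move: (inner x s g) (quad s) => a b; lra.
move=> h; apply: le_trans h _; apply: le_trans (ler_norm _) _; rewrite normrN mulrC.
exact: inner_le_tnorm.
Qed.

End Convex.

Lemma interior_step : tnorm x s < Delta -> g + s *m H = 0.
Proof.
move=> sint; apply/eqP; apply: contraT => r0; set r := g + _ in r0.
have tr := tnorm_gt0 x r0.
have : 0 <= inner x (- r) r.
  apply: (@model_first_order _ ((Delta - tnorm x s) / tnorm x r)).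
    by rewrite divr_gt0// subr_gt0.
  move=> e /andP[e0]; rewrite ler_pdivlMr// => er.
  apply: le_trans (tnormD _ _) _; rewrite tnormZ tnormN gtr0_norm//.
  by rewrite addrC -lerBrDr.
by rewrite innerE bilNl -innerE -sqr_tnorm oppr_ge0 leNgt exprn_gt0.
Qed.

Variables (eta1 L : R).
Hypotheses (eta0 : 0 < eta1) (eta_lt1 : eta1 < 1) (L0 : 0 < L).
Hypothesis Drad : (Delta%:E <= rad x)%E.
Hypothesis cubic : forall v, ((tnorm x v)%:E <= rad x)%E ->
  f (retr x v) <= f x + inner x v (grad f x) +
    2^-1 * inner x v (v *m pullback_hess f retr x 0) + L / 6 * tnorm x v ^+ 3.

Let rho := decrease_ratio f retr x s.

Lemma accepted_decrease : eta1 <= rho -> eta1 * model_decrease <= f x - f (retr x s).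
Proof.
move=> er; have md := model_decrease_ge0.
have mp : 0 < model_decrease.
  rewrite lt_neqAle md andbT eq_sym; apply/eqP => m0.
  move: er; rewrite /rho /decrease_ratio -/model_decrease m0 invr0 mulr0.
  by rewrite leNgt eta0.
by rewrite -ler_pdivlMr.
Qed.

(** The actual decrease differs from the one of the model by at most the cubic
    term. *)
Lemma cubic_gap : (1 - eta1) * model_decrease >= L / 6 * tnorm x s ^+ 3 ->
  0 < model_decrease -> eta1 <= rho.
Proof.
move=> h mp; rewrite /rho /decrease_ratio -/model_decrease ler_pdivlMr//.
have sr : ((tnorm x s)%:E <= rad x)%E by apply: le_trans Drad; rewrite lee_fin.
have := cubic sr; rewrite -/g -/H -/(quad s) -modelE.
have : model_decrease = f x - model f retr x s by rewrite /model_decrease model0.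
move: h; move: model_decrease (model f retr x s) (L / 6 * _) (f x) (f (retr x s)).
move=> a b c d e; lra.
Qed.

Lemma rejected_gap : rho < eta1 -> 0 < model_decrease ->
  (1 - eta1) * model_decrease < L / 6 * tnorm x s ^+ 3.
Proof.
move=> re mp; rewrite ltNge; apply/negP => h.
by move: re; rewrite ltNge cubic_gap.
Qed.

(** Positive curvature and [radial_step] make the model decrease along the whole
    segment from 0 to [s], by an amount that dominates the cubic term when [s] is
    short. This provides the path required by [strong_convexity_trap]. *)
Lemma descent_path gamma : 0 < gamma -> (forall v, gamma * inner x v v <= quad v) ->
  L / 6 * tnorm x s <= 2^-1 * gamma ->
  forall t, 0 <= t <= 1 -> f (retr x (t *: s)) <= f x.
Proof.
move=> gm0 Hg Ls t /andP[t0 t1].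
have tr : ((tnorm x (t *: s))%:E <= rad x)%E.
  apply: le_trans Drad; rewrite lee_fin tnormZ ger0_norm//; apply: le_trans sD.
  by rewrite ler_piMl ?tnorm_ge0.
apply: le_trans (cubic tr) _; rewrite -/g -/H -/(quad _) quadZ tnormZ ger0_norm//.
rewrite [inner x (t *: s) g]innerE bilZl -innerE exprMn.
have cs := radial_step; have q0 := quad_ge0 gm0 Hg s.
have c3 : L / 6 * tnorm x s ^+ 3 <= 2^-1 * quad s.
  rewrite exprS mulrA; apply: (@le_trans _ _ (2^-1 * gamma * tnorm x s ^+ 2)).
    by rewrite ler_wpM2r ?sqr_ge0.
  by rewrite -mulrA ler_pM2l ?invr_gt0// sqr_tnorm.
have h1 : t * inner x s g <= t * (- quad s).
  by rewrite ler_wpM2l//; move: cs; move: (inner x s g) (quad s) => a b; lra.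
have h2 : t ^+ 3 * (L / 6 * tnorm x s ^+ 3) <= t ^+ 3 * (2^-1 * quad s).
  by rewrite ler_wpM2l ?exprn_ge0.
have t2 : t ^+ 2 * quad s <= t * quad s.
  by rewrite ler_wpM2r// expr2 ler_piMr.
have t3 : t ^+ 3 * quad s <= t * quad s.
  rewrite ler_wpM2r// exprS ler_piMr//.
  by rewrite exprn_ile1.
have -> : L / 6 * (t ^+ 3 * tnorm x s ^+ 3) = t ^+ 3 * (L / 6 * tnorm x s ^+ 3) by ring.
have E3 : t ^+ 3 * (2^-1 * quad s) = 2^-1 * (t ^+ 3 * quad s) by ring.
rewrite E3 in h2; rewrite mulrN in h1.
move: h1 h2 t2 t3; move: (f x) (t * inner x s g) (t * quad s) (t ^+ 2 * quad s) (t ^+ 3 * quad s).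
move: (t ^+ 3 * _) => a b c d e e'; lra.
Qed.

End TrustRegionStep.

(** * Constants of the complexity bound *)

Section RealConstants.
Context {R : realType}.

Lemma powR_two_thirds (a : R) : 0 < a -> (a `^ (2 / 3)) ^+ 3 = a ^+ 2.
Proof.
move=> a0; rewrite -powR_mulrn ?powR_ge0// -powRrM.
by rewrite divfK ?pnatr_eq0// powR_mulrn// ltW.
Qed.

Lemma powR_four_thirds (a : R) : 0 < a -> a `^ (4 / 3) = (a `^ (2 / 3)) ^+ 2.
Proof.
move=> a0; rewrite -powR_mulrn ?powR_ge0// -powRrM; congr (_ `^ _); by field.
Qed.

Lemma powR_third (a : R) : 0 < a -> (a `^ 3^-1) ^+ 3 = a.
Proof.
by move=> a0; rewrite -powR_mulrn ?powR_ge0// -powRrM mulVf// powRr1// ltW.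
Qed.

(** The radius [p] at which the cubic error [p ^+ 3] is of the order of the Cauchy
    decrease [a ^+ 2]. *)
Lemma two_thirds_bounds (a : R) : 0 < a -> a <= 1 -> let p := a `^ (2 / 3) in
  [/\ 0 < p, p <= 1, a <= p & p ^+ 2 <= a].
Proof.
move=> a0 a1 p; have p3 := powR_two_thirds a0; rewrite -/p in p3.
have p0 : 0 < p by rewrite powR_gt0.
have p1 : p <= 1.
  by rewrite -(ler_pXn2r (n := 3))// ?nnegrE ?(ltW p0)// p3 expr1n exprn_ile1// ltW.
have ap : a <= p.
  rewrite -(ler_pXn2r (n := 3))// ?nnegrE ?(ltW p0) ?(ltW a0)// p3.
  by rewrite exprS ler_piMl// sqr_ge0.
split=> //.
rewrite -(ler_pM2r p0) -exprSr p3 expr2 ler_pM2l//.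
Qed.

(** The underlined thresholds of the complexity bound. *)
Definition capped (t : R) : R := Num.min 1 t.

Lemma capped_bounds (t : R) : 0 < t -> [/\ 0 < capped t, capped t <= 1 & capped t <= t].
Proof. by move=> t0; rewrite /capped lt_min ltr01 t0 !ge_min !lexx orbT. Qed.

Lemma saddle_min_bounds (alpha beta gamma delta : R) :
  0 < alpha -> 0 < beta -> 0 < gamma -> 0 < delta ->
  let a := capped alpha in let b := capped beta in let g := capped gamma in
  let d := capped delta in let p := a `^ (2 / 3) in
  let S := saddle_min alpha beta gamma delta in
  [/\ 0 < S, S <= 1 & [/\ S <= a ^+ 2, S <= p ^+ 2 * b, S <= p ^+ 2 * g, S <= b ^+ 3 &
    [/\ S <= b ^+ 2 * g, S <= b * g ^+ 2, S <= g ^+ 3 & S <= g ^+ 2 * d]]].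
Proof.
move=> al0 be0 ga0 de0 a b g d p S.
have [a0 a1 _] := capped_bounds al0; have [b0 b1 _] := capped_bounds be0.
have [g0 g1 _] := capped_bounds ga0; have [d0 d1 _] := capped_bounds de0.
have p43 : a `^ (4 / 3) = p ^+ 2 := powR_four_thirds a0.
have p0 : 0 < p by rewrite powR_gt0.
have S0 : 0 < S.
  rewrite /S /saddle_min -/(capped alpha) -/(capped beta) -/(capped gamma) -/(capped delta).
  rewrite -/a -/b -/g -/d p43 -/p /minimum /= !lt_min.
  by rewrite !mulr_gt0 ?exprn_gt0.
have Sa : S <= a ^+ 2.
  by rewrite /S /saddle_min /minimum /= !ge_min lexx ?orbT.
split=> //; first by apply: le_trans Sa _; rewrite exprn_ile1// ltW.
split=> //; last split;
  by rewrite /S /saddle_min /minimum /= -/(capped alpha) -/a ?p43 !ge_min lexx ?orbT.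
Qed.

Variables (eta1 tau1 L kappa : R).
Hypotheses (eta_lt1 : eta1 < 1) (tau0 : 0 < tau1) (L0 : 0 < L) (k0 : 0 < kappa).
Let c := c_Delta eta1 tau1 L kappa.

Lemma c_Delta_bounds : [/\ 0 < c, c <= 1, c <= tau1 * Num.sqrt (3 * (1 - eta1) / L),
  c <= tau1 * (3 * (1 - eta1) / (kappa * L)) `^ 3^-1 &
  c <= 3 * tau1 * ((1 - eta1) / L)].
Proof.
have e0 : 0 < 1 - eta1 by rewrite subr_gt0.
have A1 : 0 < tau1 * Num.sqrt (3 * (1 - eta1) / L).
  by rewrite mulr_gt0// sqrtr_gt0 divr_gt0// mulr_gt0.
have A2 : 0 < tau1 * (3 * (1 - eta1) / (kappa * L)) `^ 3^-1.
  by rewrite mulr_gt0// powR_gt0// divr_gt0 ?mulr_gt0.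
have A3 : 0 < 3 * tau1 * ((1 - eta1) / L) by rewrite mulr_gt0 ?divr_gt0// mulr_gt0.
rewrite /c /c_Delta /minimum /= !lt_min !ge_min !lexx ?orbT; split=> //.
by rewrite ltr01 A1 A2 A3.
Qed.

Let K := 3 * (1 - eta1) / L.

Let K0 : 0 < K.
Proof. by rewrite divr_gt0// mulr_gt0// subr_gt0. Qed.

(** The hypothesis is the inequality between the model decrease [2^-1 * X] and the
    cubic error satisfied by a rejected step. *)
Lemma rejection_solve (X Y : R) :
  (1 - eta1) * (2^-1 * X) < L / 6 * Y -> K * X < Y.
Proof.
move=> h; have -> : K * X = 6 / L * ((1 - eta1) * (2^-1 * X)).
  by rewrite /K; field; rewrite gt_eqF.
have -> : Y = 6 / L * (L / 6 * Y) by field; rewrite gt_eqF.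
by rewrite ltr_pM2l// divr_gt0.
Qed.

(** Each branch of the minimum gives a lower bound for [Delta] which is one of the
    terms of [c_Delta]. *)
Lemma radius_after_rejection_cauchy (a Delta : R) : 0 < a -> a <= 1 -> 0 < Delta ->
  (1 - eta1) * (2^-1 * Num.min (Delta * a) (a ^+ 2 / kappa)) < L / 6 * Delta ^+ 3 ->
  c * a `^ (2 / 3) <= tau1 * Delta.
Proof.
move=> a0 a1 D0 /rejection_solve; have [c0 c1 cs cc _] := c_Delta_bounds.
have [p0 p1 ap pa] := two_thirds_bounds a0 a1.
have p3 := powR_two_thirds a0.
set p := a `^ (2 / 3) in p0 p1 ap pa p3 *.
have solve r : c <= tau1 * r -> r * p <= Delta -> c * p <= tau1 * Delta.
  move=> cr rD; apply: (@le_trans _ _ (tau1 * r * p)); first by rewrite ler_pM2r.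
  by rewrite -mulrA ler_pM2l.
have [_|_] := leP (Delta * a) (a ^+ 2 / kappa) => h.
  apply: (solve _ cs); rewrite -/K -(ler_pXn2r (n := 2))//; last 2 first.
  - by rewrite nnegrE mulr_ge0 ?sqrtr_ge0 ?(ltW p0).
  - by rewrite nnegrE ltW.
  rewrite exprMn sqr_sqrtr ?(ltW K0)//; apply: (@le_trans _ _ (K * a)).
    by rewrite ler_pM2l.
  by rewrite ltW// -(ltr_pM2l D0) mulrCA -exprS.
apply: (solve _ cc); rewrite -(ler_pXn2r (n := 3))//; last 2 first.
- by rewrite nnegrE mulr_ge0 ?powR_ge0 ?(ltW p0).
- by rewrite nnegrE ltW.
rewrite exprMn powR_third ?p3; last by rewrite divr_gt0 ?mulr_gt0 ?subr_gt0.
apply: le_trans (ltW h); rewrite le_eqVlt; apply/orP; left; apply/eqP.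
by rewrite /K; field; rewrite !gt_eqF.
Qed.

(** For a model decrease quadratic in the step, the bound comes from the last term
    of [c_Delta]. *)
Lemma radius_after_rejection_curvature (b sn Delta : R) : 0 < b -> 0 <= sn -> sn <= Delta ->
  (1 - eta1) * (2^-1 * (b * sn ^+ 2)) < L / 6 * sn ^+ 3 ->
  c * b <= tau1 * Delta.
Proof.
move=> b0 sn0 sD /rejection_solve h; have [c0 c1 _ _ cc] := c_Delta_bounds.
have snp : 0 < sn.
  by rewrite lt_neqAle sn0 andbT eq_sym; apply/eqP => sn00; move: h; rewrite sn00 !expr0n/= !mulr0 ltxx.
have key : K * b <= sn.
  by rewrite ltW// -(ltr_pM2r (exprn_gt0 2 snp)) -mulrA -exprS.
apply: (@le_trans _ _ (3 * tau1 * ((1 - eta1) / L) * b)); first by rewrite ler_pM2r.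
have -> : 3 * tau1 * ((1 - eta1) / L) * b = tau1 * (K * b) by rewrite /K; ring.
by rewrite ler_pM2l//; exact: le_trans key sD.
Qed.

Lemma c_Q_bounds (nu_R kappa_S kappa_R Lhat : R) : 0 < nu_R -> 0 < kappa_S ->
  0 < kappa_R -> 0 < Lhat ->
  let cQ := c_Q eta1 L nu_R kappa_S kappa_R Lhat in
  [/\ 0 < cQ, cQ <= 3 * (1 - eta1) / L, cQ <= nu_R, cQ <= 2^-1 &
    cQ * (kappa_R * Lhat) <= 1].
Proof.
move=> n0 s0 r0 l0 cQ; have e0 : 0 < 1 - eta1 by rewrite subr_gt0.
have q0 : 0 < kappa_R * Lhat by rewrite mulr_gt0.
rewrite -ler_pdivlMr// div1r.
rewrite /cQ /c_Q /minimum /= !lt_min !ge_min !lexx ?orbT; split=> //.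
by rewrite n0 !invr_gt0 s0 q0 divr_gt0 ?mulr_gt0//= ltr0n.
Qed.

Lemma quadratic_steps (A : R) (j : nat) : 2 ^+ (2 ^ j) < A -> j%:R <= loglog2 A.
Proof.
move=> hA; rewrite /loglog2 /log2 le_max; apply/orP; right.
have l2 : 0 < ln (2 : R) by rewrite ln_gt0// ltr1n.
have A0 : 0 < A by apply: lt_trans hA; rewrite exprn_gt0.
have h1 : 2 ^+ j <= ln A / ln 2 :> R.
  rewrite ler_pdivlMr// -natrX mulr_natl -lnXn// ler_ln ?posrE ?exprn_gt0//.
  exact: ltW.
rewrite ler_pdivlMr// mulr_natl -lnXn// ler_ln ?posrE ?exprn_gt0//.
by apply: lt_le_trans h1; rewrite exprn_gt0.
Qed.

End RealConstants.

Section Region3.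
Context {R : realType} {n : nat} {M : riemannian_manifold R n}.
Variables (f : M -> R) (gamma delta : R).
Hypotheses (f2 : C2_on_manifold f) (g0 : 0 < gamma) (d0 : 0 < delta).
Implicit Types x : M.

Lemma region3_hess x v : region3 f gamma delta x ->
  gamma * inner x v v <= inner x v (v *m hess f x).
Proof.
move=> [xs [xm xd cv]]; apply: (strong_convexity_hess f2 cv).
rewrite /= dist_sym; apply: le_lt_trans xd _.
by rewrite lte_fin ltr_pMl// ltr1n.
Qed.

Lemma region3_lambda_min x (e : R) : 0 < e -> region3 f gamma delta x ->
  - e <= lambda_min (hess f x).
Proof.
move=> e0 x3; apply: lambda_min_ge; first by rewrite oppr_le0 ltW.
move=> a /eigenvalueP[v va v0]; have := region3_hess v x3.
have vp : 0 < inner x v v by rewrite -sqr_tnorm exprn_gt0// tnorm_gt0.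
rewrite va [inner x v (a *: v)]innerE bilZr -innerE ler_pM2r// => ga.
by apply: le_trans ga; rewrite lerNl (le_trans _ (ltW e0))// oppr_le0 ltW.
Qed.

(** The minimizer that witnesses the membership of [x] also serves for [P 1]. *)
Lemma region3_trap x (P : R -> M) : region3 f gamma delta x ->
  tnorm x (grad f x) < gamma * delta -> P 0 = x ->
  (forall t, 0 <= t <= 1 -> {for t, continuous P} /\ f (P t) <= f x) ->
  region3 f gamma delta (P 1).
Proof.
move=> [xs [xm xd cv]] gx P0 HP; exists xs; split=> //.
exact: (strong_convexity_trap f2 g0 d0 xm cv xd gx P0 HP).
Qed.

End Region3.

(** * Counting successful iterations *)

Section Minima.
Context {R : realType}.
Implicit Types x y z t u v : R.

Lemma min3_le x y z : [/\ Num.min x (Num.min y z) <= x,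
  Num.min x (Num.min y z) <= y & Num.min x (Num.min y z) <= z].
Proof. by split; rewrite !ge_min !lexx ?orbT. Qed.

Lemma min3_gt0 x y z : 0 < x -> 0 < y -> 0 < z -> 0 < Num.min x (Num.min y z).
Proof. by move=> hx hy hz; rewrite !lt_min hx hy hz. Qed.

Lemma le_mul_min3 t u x y z : t <= u * x -> t <= u * y -> t <= u * z ->
  t <= u * Num.min x (Num.min y z).
Proof. by move=> hx hy hz; rewrite /Num.min; do 2 case: ifP. Qed.

Lemma lt_mul_min3 t u x y z : t < u * x -> t < u * y -> t < u * z ->
  t < u * Num.min x (Num.min y z).
Proof. by move=> hx hy hz; rewrite /Num.min; do 2 case: ifP. Qed.

End Minima.

Section IterationConstant.
Context {R : realType}.
Variables (kappa cD Delta0 cQ : R).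

Definition radius_factor : R := cD * capped Delta0.

Definition newton_factor : R := Num.min radius_factor cQ.

Definition decrease_factor : R :=
  Num.min radius_factor
    (Num.min kappa^-1 (Num.min (radius_factor ^+ 2) (newton_factor ^+ 2))).

(** Each long step decreases [f] by [eta * 2^-1 * decrease_factor] times
    [saddle_min] and pays for two successful iterations. The absolute value makes
    the constant positive for all arguments, including meaningless ones. *)
Definition iteration_constant (nu_R kappa_R Lhat eta gap : R) : R :=
  1 + `|2 * gap / (eta * (2^-1 * decrease_factor)) + 1|.

End IterationConstant.

Section TrustRegionRun.
Context {R : realType} {n : nat} {M : riemannian_manifold R n}.
Variables (f : M -> R) (retr : M -> 'rV[R]_n -> M) (rad : M -> \bar R)
  (alpha beta gamma delta : R)
  (x0 : M) (Delta0 Deltabar eta1 eta2 tau1 tau2 : R)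
  (x : nat -> M) (Delta : nat -> R) (s : nat -> 'rV[R]_n)
  (L_H kappa_H fstar Lhat kappa_R nu_R kappa_S eps_g eps_H : R).
Hypotheses (f2 : C2_on_manifold f) (ret : is_retraction retr rad)
  (ret2 : second_order_retraction retr)
  (al0 : 0 < alpha) (be0 : 0 < beta) (ga0 : 0 < gamma) (de0 : 0 < delta)
  (saddle : strict_saddle f alpha beta gamma delta)
  (D00 : 0 < Delta0 < Deltabar) (e10 : 0 < eta1) (e12 : eta1 < eta2) (e21 : eta2 < 1)
  (t1 : 0 < tau1 < 1) (t2 : 1 < tau2)
  (run : rtr_run f retr x0 Delta0 Deltabar eta1 eta2 tau1 tau2 x Delta s)
  (L0 : 0 < L_H) (cubic : pullback_cubic_bound f retr rad L_H x)
  (Drad : forall k, ((Delta k)%:E <= rad (x k))%E)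
  (k0 : 0 < kappa_H)
  (Hk : forall k, opnorm (x k) (pullback_hess f retr (x k) 0) <= kappa_H)
  (fs : forall y, fstar <= f y)
  (Lh0 : 0 < Lhat)
  (HLhat : forall k, region3 f gamma delta (x k) ->
     tnorm (x k) (pullback_grad f retr (x k) (s k) -
                  pullback_grad f retr (x k) 0 -
                  s k *m pullback_hess f retr (x k) 0)
       <= Lhat / 2 * tnorm (x k) (s k) ^+ 2)
  (kR1 : 1 < kappa_R) (nR0 : 0 < nu_R)
  (HkR : forall y v, region3 f gamma delta y -> tnorm y v <= nu_R ->
     ((tnorm y v)%:E <= rad y)%E ->
     tnorm (retr y v) (grad f (retr y v))
       <= kappa_R * tnorm y (pullback_grad f retr y v))
  (kS0 : 0 < kappa_S) (eg0 : 0 < eps_g) (eH0 : 0 < eps_H).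

Let R1 := region1 f alpha.
Let R2 := region2 f beta.
Let R3 := region3 f gamma delta.
Let gn k := tnorm (x k) (grad f (x k)).
Let sn k := tnorm (x k) (s k).
Let succ k : bool := eta1 <= decrease_ratio f retr (x k) (s k).
Let target k := gn k <= eps_g /\ - eps_H <= lambda_min (hess f (x k)).
Let md k := model_decrease f retr (x k) (s k).
Let nsucc k := successful_before f retr eta1 x s k.

(** Up to the end, [Dmin] is a lower bound for the radius. A step in [R3] counts as
    short if its squared length is less than [T2]. The gradient after a short step
    is at most [q / 2] times its squared length. *)
Let a := capped alpha. Let b := capped beta. Let g := capped gamma. Let d := capped delta.
Let p := a `^ (2 / 3).
Let S := saddle_min alpha beta gamma delta.
Let cD := c_Delta eta1 tau1 L_H kappa_H.
Let cQ := c_Q eta1 L_H nu_R kappa_S kappa_R Lhat.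
Let D0 := capped Delta0.
Let rD := radius_factor cD Delta0.
Let Dmin := rD * Num.min p (Num.min b g).
Let c0 := newton_factor cD Delta0 cQ.
Let T2 := c0 ^+ 2 * Num.min (p ^+ 2) (Num.min (b ^+ 2) (Num.min (g ^+ 2) (g * d))).
Let c1 := decrease_factor kappa_H cD Delta0 cQ.
Let q := kappa_R * Lhat.

Let eta_lt1 : eta1 < 1. Proof. exact: lt_trans e12 e21. Qed.
Let tau0 : 0 < tau1. Proof. by case/andP: t1. Qed.
Let D0p : 0 < Delta0. Proof. by case/andP: D00. Qed.
Let kR0 : 0 < kappa_R. Proof. exact: lt_trans ltr01 kR1. Qed.
Let q0 : 0 < q. Proof. exact: mulr_gt0. Qed.
Let aP := capped_bounds al0.
Let bP := capped_bounds be0.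
Let gP := capped_bounds ga0.
Let dP := capped_bounds de0.
Let a0 : 0 < a. Proof. by have [] := aP. Qed.
Let b0 : 0 < b. Proof. by have [] := bP. Qed.
Let g0 : 0 < g. Proof. by have [] := gP. Qed.
Let d0 : 0 < d. Proof. by have [] := dP. Qed.
Let a1 : a <= 1. Proof. by have [] := aP. Qed.
Let ggamma : g <= gamma. Proof. by have [] := gP. Qed.
Let g1 : g <= 1. Proof. by have [] := gP. Qed.
Let pP := two_thirds_bounds a0 a1.
Let p0 : 0 < p. Proof. by have [] := pP. Qed.
Let p1 : p <= 1. Proof. by have [] := pP. Qed.
Let cDP := c_Delta_bounds eta_lt1 tau0 L0 k0.
Let cD0 : 0 < cD. Proof. by have [] := cDP. Qed.
Let D0P := capped_bounds D0p.
Let D0pos : 0 < D0. Proof. by have [] := D0P. Qed.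
Let D01 : D0 <= 1. Proof. by have [] := D0P. Qed.
Let rD0 : 0 < rD. Proof. exact: mulr_gt0. Qed.
Let rDcD : rD <= cD. Proof. by rewrite /rD ler_piMr// ltW. Qed.
Let rDD0 : rD <= D0. Proof. by rewrite /rD ler_piMl ?(ltW D0pos)//; have [] := cDP. Qed.
Let cQP := c_Q_bounds eta_lt1 L0 nR0 kS0 kR0 Lh0.
Let cQ0 : 0 < cQ. Proof. by have [] := cQP. Qed.
Let c00 : 0 < c0. Proof. by rewrite lt_min rD0 cQ0. Qed.
Let c0r : c0 <= rD. Proof. by rewrite ge_min lexx. Qed.
Let c0Q : c0 <= cQ. Proof. by rewrite ge_min lexx orbT. Qed.
Let c0half : c0 <= 2^-1. Proof. by apply: le_trans c0Q _; have [] := cQP. Qed.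
Let c0q : c0 * q <= 1.
Proof.
have [_ _ _ _ h] := cQP; apply: le_trans h; by rewrite ler_pM2r.
Qed.
Let c10 : 0 < c1.
Proof. by rewrite !lt_min rD0 invr_gt0 k0 !exprn_gt0. Qed.
Let Dmin0 : 0 < Dmin. Proof. by apply: mulr_gt0 => //; exact: min3_gt0. Qed.
Let SP := saddle_min_bounds al0 be0 ga0 de0.
Let S0 : 0 < S. Proof. by have [] := SP. Qed.

Let Dmin_p : Dmin <= rD * p. Proof. by rewrite ler_pM2l//; have [] := min3_le p b g. Qed.
Let Dmin_b : Dmin <= rD * b. Proof. by rewrite ler_pM2l//; have [] := min3_le p b g. Qed.
Let Dmin_g : Dmin <= rD * g. Proof. by rewrite ler_pM2l//; have [] := min3_le p b g. Qed.

Lemma strict_saddleP y : [\/ R1 y, R2 y | R3 y].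
Proof.
have : (region1 f alpha `|` region2 f beta `|` region3 f gamma delta) y.
  by rewrite saddle.
by move=> [[h|h]|h]; [apply: Or31|apply: Or32|apply: Or33].
Qed.

Lemma radius_bounds k : 0 < Delta k <= Deltabar.
Proof.
have [D0' Db] := andP D00.
elim: k => [|k /andP[IH1 IH2]]; first by rewrite (run_Delta0 run) D0' ltW.
rewrite (run_next_Delta run); case: ifP => _.
  by rewrite lt_min mulr_gt0 ?(lt_trans ltr01 t2)//= (lt_trans D0' Db) ge_min lexx orbT.
case: ifP => _; first by rewrite IH1.
rewrite mulr_gt0//= (le_trans _ IH2)// ler_piMl ?(ltW IH1)//.
by case/andP: t1 => _ /ltW.
Qed.

Let Dk0 k : 0 < Delta k. Proof. by have /andP[] := radius_bounds k. Qed.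

(** No decrease even if the radius is capped by [Deltabar], by [radius_bounds]. *)
Lemma radius_success k : succ k -> Delta k <= Delta k.+1.
Proof.
move=> sk; rewrite (run_next_Delta run); case: ifP => _; last by rewrite -/(succ k) sk.
have /andP[h1 h2] := radius_bounds k.
by rewrite le_min h2 andbT ler_peMl ?ltW.
Qed.

Lemma radius_failure k : ~~ succ k -> Delta k.+1 = tau1 * Delta k /\ x k.+1 = x k.
Proof.
move=> sk; rewrite (run_next_Delta run) (run_next_x run) -/(succ k) (negbTE sk).
split=> //; rewrite ifF//; apply/negbTE; move: sk; rewrite /succ -!leNgt -ltNge => /ltW h.
exact: le_trans h (ltW e12).
Qed.

Let smin k := @run_step_minimizer _ _ _ _ _ _ _ _ _ _ _ _ _ _ _ run k.
Let sD k := run_step_feasible run k.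
Let cub k := @cubic k.

Lemma nsuccS k : nsucc k.+1 = (nsucc k + succ k)%N.
Proof. by rewrite /nsucc /successful_before big_ord_recr. Qed.

Lemma R3_hess y v : R3 y -> gamma * inner y v v <= inner y v (v *m pullback_hess f retr y 0).
Proof.
move=> y3; rewrite (pullback_hess_quadratic ret f2 ret2).
exact: (region3_hess f2 de0 v y3).
Qed.

(** In [R3] the second-order condition holds by strong convexity. *)
Lemma R3_nontarget k : R3 (x k) -> ~ target k -> eps_g < gn k.
Proof.
move=> k3 nt; rewrite ltNge; apply/negP => h; apply: nt; split=> //.
exact: (region3_lambda_min f2 ga0 de0 eH0 k3).
Qed.

Lemma R1_decrease k : R1 (x k) -> 2^-1 * Num.min (Delta k * a) (a ^+ 2 / kappa_H) <= md k.
Proof.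
move=> k1; apply: (cauchy_decrease (Dk0 k) (@smin k) k0 (Hk k) a0).
by have [_ _ aa] := aP; apply: le_trans aa k1.
Qed.

Lemma R2_decrease k : R2 (x k) -> 2^-1 * (b * Delta k ^+ 2) <= md k.
Proof.
move=> k2; apply: (@le_trans _ _ (2^-1 * (beta * Delta k ^+ 2))); last first.
  exact: (saddle_decrease f2 ret ret2 (Dk0 k) (@smin k) be0 k2).
by rewrite ler_pM2l// ler_pM2r ?exprn_gt0//; have [] := bP.
Qed.

Lemma R3_decrease k : R3 (x k) -> 2^-1 * (g * sn k ^+ 2) <= md k.
Proof.
move=> k3; apply: (@le_trans _ _ (2^-1 * (gamma * sn k ^+ 2))).
  by rewrite ler_pM2l// ler_wpM2r ?sqr_ge0.
exact: (convex_decrease_norm f2 ret (sD k) (@smin k) (fun v => R3_hess v k3)).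
Qed.

Lemma R3_step k : R3 (x k) -> gamma * sn k <= gn k.
Proof.
move=> k3.
exact: (convex_step_norm f2 ret (sD k) (@smin k) (fun v => R3_hess v k3)).
Qed.

Lemma R3_sn_gt0 k : R3 (x k) -> ~ target k -> 0 < sn k.
Proof.
move=> k3 nt; rewrite lt_neqAle tnorm_ge0 andbT eq_sym; apply/eqP => s00.
have sz : s k = 0 by apply/eqP; apply: contraT => /(tnorm_gt0 (x k)); rewrite -/(sn k) s00 ltxx.
have sint : tnorm (x k) (s k) < Delta k by rewrite -/(sn k) s00.
have := interior_step f2 ret (@smin k) sint.
rewrite sz mul0mx addr0 => gz.
have := R3_nontarget k3 nt; rewrite /gn gz tnorm0 ltNge => /negP; apply.
exact: ltW.
Qed.

Lemma md_gt0 k : ~ target k -> 0 < md k.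
Proof.
move=> nt; have [k1|k2|k3] := strict_saddleP (x k).
- apply: lt_le_trans (R1_decrease k1).
  by rewrite mulr_gt0// lt_min mulr_gt0//= divr_gt0// exprn_gt0.
- by apply: lt_le_trans (R2_decrease k2); apply: mulr_gt0 => //; apply: mulr_gt0 => //; apply: exprn_gt0.
- apply: lt_le_trans (R3_decrease k3).
  by apply: mulr_gt0 => //; apply: mulr_gt0 => //; apply: exprn_gt0; apply: R3_sn_gt0.
Qed.

(** A rejection means that the cubic error exceeds a fixed fraction of the model
    decrease. In each region the model decrease is known from below in terms of the
    radius or of the step, so that the radius was large before the rejection. *)
Lemma radius_rejection k : ~ target k -> ~~ succ k -> Dmin <= Delta k.+1.
Proof.
move=> nt ns; have [-> _] := radius_failure ns.
have rej := rejected_gap (sD k) (Drad k) (@cub k) _ (md_gt0 nt).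
have {}rej : (1 - eta1) * md k < L_H / 6 * sn k ^+ 3 by apply: rej; rewrite ltNge.
have e0 : 0 < 1 - eta1 by rewrite subr_gt0.
have snD : L_H / 6 * sn k ^+ 3 <= L_H / 6 * Delta k ^+ 3.
  rewrite ler_pM2l ?divr_gt0// lerXn2r ?nnegrE ?tnorm_ge0 ?(ltW (Dk0 k))//; exact: sD.
have gap m : m <= md k -> (1 - eta1) * m < L_H / 6 * sn k ^+ 3.
  by move=> h; apply: le_lt_trans rej; rewrite ler_pM2l.
have [k1|k2|k3] := strict_saddleP (x k).
- have h := lt_le_trans (gap _ (R1_decrease k1)) snD.
  apply: le_trans Dmin_p _; apply: (@le_trans _ _ (cD * p)); first by rewrite ler_pM2r.
  exact: (radius_after_rejection_cauchy eta_lt1 tau0 L0 k0 a0 a1 (Dk0 k) h).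
- have h := lt_le_trans (gap _ (R2_decrease k2)) snD.
  apply: le_trans Dmin_b _; apply: (@le_trans _ _ (cD * b)); first by rewrite ler_pM2r.
  exact: (radius_after_rejection_curvature eta_lt1 tau0 L0 k0 b0 (ltW (Dk0 k)) (lexx _) h).
- have h := gap _ (R3_decrease k3).
  apply: le_trans Dmin_g _; apply: (@le_trans _ _ (cD * g)); first by rewrite ler_pM2r.
  exact: (radius_after_rejection_curvature eta_lt1 tau0 L0 k0 g0 (tnorm_ge0 _ _) (sD k) h).
Qed.

Lemma radius_next k : ~ target k -> Dmin <= Delta k -> Dmin <= Delta k.+1.
Proof.
move=> nt h; have [sk|sk] := boolP (succ k).
  exact: le_trans h (radius_success sk).
exact: radius_rejection.
Qed.

Lemma radius_init : Dmin <= Delta 0%N.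
Proof.
rewrite (run_Delta0 run); have [_ _ h] := D0P; apply: le_trans h.
apply: le_trans rDD0; rewrite /Dmin ler_piMr ?(ltW rD0)//.
by rewrite ge_min p1.
Qed.

Definition rtr_unit_decrease : R := eta1 * (2^-1 * (c1 * S)).
Let D := rtr_unit_decrease.
Let D_gt0 : 0 < D. Proof. by rewrite /D /rtr_unit_decrease !mulr_gt0. Qed.

(** Iterates at which a successful step decreases [f] by a fixed amount. *)
Definition long_step k := [\/ R1 (x k), R2 (x k) | R3 (x k) /\ T2 <= sn k ^+ 2].

(** With [Dmin] for the radius and [T2] for the squared step, the model decreases in
    the three regions are, up to constants, minima of products of capped
    thresholds, each of which dominates a term of [saddle_min]. *)
Lemma long_step_decrease k : Dmin <= Delta k -> long_step k -> c1 * S <= 2 * md k.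
Proof.
move=> Dk; have [_ _ [Sa Sb Sg Sb3 [Sbg Sbgg Sg3 Sgd]]] := SP.
have [_ _ ap pa] := pP.
rewrite -/S -/a -/b -/g -/d -/p in Sa Sb Sg Sb3 Sbg Sbgg Sg3 Sgd ap pa.
have S0' := ltW S0.
have c1r : c1 <= rD by rewrite ge_min lexx.
have c1k : c1 <= kappa_H^-1 by rewrite !ge_min lexx orbT.
have c1r2 : c1 <= rD ^+ 2 by rewrite !ge_min lexx !orbT.
have c1c : c1 <= c0 ^+ 2 by rewrite !ge_min lexx !orbT.
have twice u : 2^-1 * u <= md k -> u <= 2 * md k by move: (md k) => w; lra.
move=> [k1|k2|[k3 sT]].
- apply: le_trans (twice _ (R1_decrease k1)); rewrite le_min; apply/andP; split.
    apply: (@le_trans _ _ (Dmin * a)); last by rewrite ler_pM2r.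
    rewrite /Dmin -mulrA; apply: ler_pM => //; first exact: ltW.
    have [h1 h2 h3] : [/\ S <= p * a, S <= b * a & S <= g * a].
      split.
      - by apply: le_trans Sa _; rewrite expr2 ler_pM2r.
      - by apply: le_trans Sb _; rewrite mulrC ler_pM2l.
      - by apply: le_trans Sg _; rewrite mulrC ler_pM2l.
    by rewrite mulrC; apply: le_mul_min3; rewrite mulrC.
  rewrite mulrC; apply: ler_pM => //; exact: ltW.
- apply: le_trans (twice _ (R2_decrease k2)).
  apply: (@le_trans _ _ (b * Dmin ^+ 2)); last first.
    by rewrite ler_pM2l// lerXn2r ?nnegrE ?(ltW Dmin0) ?(ltW (Dk0 k)).
  rewrite /Dmin exprMn mulrCA; apply: ler_pM => //; first exact: ltW.
  have [h1 h2 h3] : [/\ S <= b * p ^+ 2, S <= b * b ^+ 2 & S <= b * g ^+ 2].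
    by rewrite [b * p ^+ 2]mulrC -exprS.
  by rewrite /Num.min; do 2 case: ifP.
- apply: le_trans (twice _ (R3_decrease k3)).
  apply: (@le_trans _ _ (g * T2)); last by rewrite ler_pM2l.
  rewrite /T2 mulrCA; apply: ler_pM => //; first exact: ltW.
  have [h1 h2] : S <= g * p ^+ 2 /\ S <= g * b ^+ 2 by split; rewrite mulrC.
  have [h3 h4] : S <= g * g ^+ 2 /\ S <= g * (g * d).
    by split; [rewrite -exprS|rewrite mulrA -expr2].
  by rewrite /Num.min; do 3 case: ifP.
Qed.

Lemma success_decrease k : succ k -> eta1 * md k <= f (x k) - f (x k.+1).
Proof.
move=> sk; rewrite (run_next_x run) -/(succ k) sk.
exact: (accepted_decrease (Dk0 k) (@smin k) e10 sk).
Qed.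

Lemma step_decrease k : f (x k.+1) <= f (x k).
Proof.
have [sk|sk] := boolP (succ k); last by have [_ ->] := radius_failure sk.
rewrite -subr_ge0; apply: le_trans (success_decrease sk).
by rewrite mulr_ge0 ?(ltW e10)//; exact: (model_decrease_ge0 (Dk0 k) (@smin k)).
Qed.

Lemma long_step_success k : Dmin <= Delta k -> long_step k -> succ k -> D <= f (x k) - f (x k.+1).
Proof.
move=> Dk lk sk; apply: le_trans (success_decrease sk).
rewrite /D /rtr_unit_decrease ler_pM2l//; have := long_step_decrease Dk lk.
by move: (md k) (c1 * S) => u v; lra.
Qed.

(** A short step lies in the interior of the trust region, so that it is a Newton
    step: the model gradient vanishes, and the gradient after the step is quadratic
    in its length. The cubic error is too small for a rejection. Finally, [f]
    decreases along the whole path to the next iterate, as needed for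
    [region3_trap]. *)
Lemma short_step k : ~ target k -> Dmin <= Delta k -> R3 (x k) -> sn k ^+ 2 < T2 ->
  [/\ succ k, gn k.+1 <= q / 2 * sn k ^+ 2 &
    gn k < gamma * delta -> R3 (x k.+1)].
Proof.
move=> nt Dk k3 sT.
have sn0 : 0 <= sn k := tnorm_ge0 _ _.
have sq_lt u : 0 < u -> c0 ^+ 2 * u ^+ 2 >= T2 -> sn k < c0 * u.
  move=> u0 hT; rewrite -(ltr_pXn2r (n := 2))// ?nnegrE ?mulr_ge0 ?(ltW c00) ?(ltW u0)//.
  by rewrite exprMn; apply: lt_le_trans sT hT.
have sp : sn k < c0 * p by apply: sq_lt => //; rewrite ler_pM2l ?exprn_gt0// ge_min lexx.
have sb : sn k < c0 * b by apply: sq_lt => //; rewrite ler_pM2l ?exprn_gt0// !ge_min lexx !orbT.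
have sg : sn k < c0 * g by apply: sq_lt => //; rewrite ler_pM2l ?exprn_gt0// !ge_min lexx !orbT.
have sint : sn k < Delta k.
  apply: lt_le_trans Dk; apply: (@lt_le_trans _ _ (c0 * Num.min p (Num.min b g))).
    exact: lt_mul_min3.
  by rewrite ler_pM2r//; exact: min3_gt0.
have sQ : sn k <= cQ * g by apply: le_trans (ltW sg) _; rewrite ler_pM2r.
have [_ cQL cQn _ _] := cQP; rewrite -/cQ in cQL cQn.
have sL : L_H / 6 * sn k <= (1 - eta1) * (2^-1 * g).
  have h : sn k <= 3 * (1 - eta1) / L_H * g by apply: le_trans sQ _; rewrite ler_pM2r.
  have -> : (1 - eta1) * (2^-1 * g) = L_H / 6 * (3 * (1 - eta1) / L_H * g).
    by field; rewrite gt_eqF.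
  by rewrite ler_pM2l// divr_gt0.
have sk : succ k.
  apply: (cubic_gap (sD k) (Drad k) (@cub k)); last exact: md_gt0.
  have e0 : 0 < 1 - eta1 by rewrite subr_gt0.
  apply: (@le_trans _ _ ((1 - eta1) * (2^-1 * (g * sn k ^+ 2)))); last first.
    by rewrite ler_pM2l//; exact: R3_decrease.
  rewrite -/(sn k) exprS mulrA.
  have -> : (1 - eta1) * (2^-1 * (g * sn k ^+ 2)) = (1 - eta1) * (2^-1 * g) * sn k ^+ 2 by ring.
  by rewrite ler_wpM2r// sqr_ge0.
have xS : x k.+1 = retr (x k) (s k) by rewrite (run_next_x run) -/(succ k) sk.
have srad : ((tnorm (x k) (s k))%:E <= rad (x k))%E.
  by apply: le_trans (Drad k); rewrite lee_fin; exact: sD.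
split=> //.
- have snu : tnorm (x k) (s k) <= nu_R.
    by apply: le_trans sQ _; apply: le_trans cQn; rewrite ler_piMr// ltW.
  rewrite /gn xS; apply: le_trans (HkR k3 snu srad) _.
  rewrite /q -!mulrA ler_pM2l// mulrA.
  have := HLhat k3; rewrite (pullback_grad0 ret f2).
  rewrite -addrA -opprD (interior_step f2 ret (@smin k) sint) subr0; exact.
- move=> gk; rewrite xS -[s k]scale1r.
  apply: (region3_trap f2 ga0 de0 (P := fun t => retr (x k) (t *: s k)) k3 gk).
    by rewrite scale0r (retr_center ret).
  move=> t t01; split; first exact: (retr_path_continuous ret t01 srad).
  apply: (descent_path f2 ret (sD k) (@smin k) (Drad k) (@cub k) ga0 (fun v => R3_hess v k3)) => //.
  apply: le_trans sL _; apply: (@le_trans _ _ (2^-1 * g)); last by rewrite ler_pM2l.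
  by rewrite ler_piMl ?mulr_ge0 ?(ltW g0)// gerBl ltW.
Qed.

Let A := 2 * gamma ^+ 2 / (q * eps_g).
Let e k := q / (2 * gamma ^+ 2) * gn k.

(** The [j]-th iterate of the final phase of quadratic convergence, in which the
    normalized gradient norm [e k] has been squared [j] times. The other conditions
    guarantee that the phase goes on. *)
Definition newton_phase j k := [/\ R3 (x k), gn k < gamma * delta,
  (gn k / gamma) ^+ 2 < T2 & e k <= (2 ^+ (2 ^ j))^-1].

Let gn0 k : 0 <= gn k := tnorm_ge0 _ _.
Let qg0 : 0 < q / (2 * gamma ^+ 2).
Proof. by apply: divr_gt0 => //; apply: mulr_gt0 => //; apply: exprn_gt0. Qed.

(** After a short step the gradient is too small for [R1] but the iterate may lie in
    [R2] outside [R3], in which case the next successful step is a long one. *)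
Lemma short_step_newton_phase k : ~ target k -> Dmin <= Delta k -> R3 (x k) ->
  sn k ^+ 2 < T2 -> succ k /\ ((R1 (x k.+1) \/ R2 (x k.+1)) \/ newton_phase 0 k.+1).
Proof.
move=> nt Dk k3 sT; have [sk gq _] := short_step nt Dk k3 sT; split=> //.
have [k1|k2|k31] := strict_saddleP (x k.+1); [by left; left|by left; right|right].
have s20 : 0 <= sn k ^+ 2 := sqr_ge0 _.
have qs : q ^+ 2 * sn k ^+ 2 <= g ^+ 2.
  apply: (@le_trans _ _ (q ^+ 2 * (c0 ^+ 2 * g ^+ 2))).
    rewrite ler_pM2l ?exprn_gt0//; apply: le_trans (ltW sT) _.
    rewrite /T2 ler_pM2l ?exprn_gt0//.
    have [_ _ h] := min3_le (p ^+ 2) (b ^+ 2) (Num.min (g ^+ 2) (g * d)).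
    by apply: le_trans h _; rewrite ge_min lexx.
  rewrite mulrA -exprMn mulrC ler_piMr ?sqr_ge0// exprn_ile1//.
    by rewrite mulr_ge0 ?(ltW q0) ?(ltW c00).
  by rewrite mulrC.
have qsg : q ^+ 2 * sn k ^+ 2 <= gamma ^+ 2.
  by apply: le_trans qs _; rewrite lerXn2r ?nnegrE ?(ltW g0) ?(ltW ga0).
have gg : gn k.+1 ^+ 2 <= gamma ^+ 2 / 4 * sn k ^+ 2.
  apply: (@le_trans _ _ ((q / 2 * sn k ^+ 2) ^+ 2)).
    by rewrite lerXn2r ?nnegrE//; exact: le_trans gq.
  have -> : (q / 2 * sn k ^+ 2) ^+ 2 = q ^+ 2 * sn k ^+ 2 / 4 * sn k ^+ 2 by field.
  by rewrite ler_wpM2r// ler_pM2r// invr_gt0.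
split=> //.
- apply: le_lt_trans gq _.
  apply: (@lt_le_trans _ _ (q / 2 * T2)); first by rewrite ltr_pM2l// divr_gt0.
  apply: (@le_trans _ _ (q / 2 * (c0 ^+ 2 * (g * d)))).
    rewrite ler_pM2l ?divr_gt0//  /T2 ler_pM2l ?exprn_gt0//.
    have [_ _ h] := min3_le (p ^+ 2) (b ^+ 2) (Num.min (g ^+ 2) (g * d)).
    by apply: le_trans h _; rewrite ge_min lexx orbT.
  have -> : q / 2 * (c0 ^+ 2 * (g * d)) = (c0 * q) * (c0 / 2) * (g * d) by field.
  have [_ _ dd] := dP.
  have gd : g * d <= gamma * delta by apply: ler_pM => //; apply: ltW.
  apply: le_trans gd; rewrite ler_piMl ?mulr_ge0 ?(ltW g0) ?(ltW d0)//.
  apply: mulr_ile1 => //; first by apply: mulr_ge0; apply: ltW.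
    by apply: divr_ge0 => //; exact: ltW.
  by move: c0half; move: (c0) => u; lra.
- apply: le_lt_trans sT; rewrite expr_div_n ler_pdivrMr ?exprn_gt0//.
  apply: le_trans gg _; rewrite mulrC ler_pM2l//; last first.
    by rewrite exprn_gt0 ?R3_sn_gt0.
  by rewrite ler_pdivrMr// ler_peMr ?sqr_ge0// ler1n.
- rewrite expn0 expr1.
  apply: (@le_trans _ _ (q / (2 * gamma ^+ 2) * (q / 2 * sn k ^+ 2))).
    by rewrite /e ler_pM2l.
  have -> : q / (2 * gamma ^+ 2) * (q / 2 * sn k ^+ 2) =
            q ^+ 2 * sn k ^+ 2 / gamma ^+ 2 / 4 by field; rewrite gt_eqF.
  have : q ^+ 2 * sn k ^+ 2 / gamma ^+ 2 <= 1.
    by rewrite ler_pdivrMr ?exprn_gt0// mul1r.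
  by move: (_ / gamma ^+ 2) => u; lra.
Qed.

(** In [R3] a step is bounded by the gradient norm divided by [gamma], hence short,
    and [short_step] squares the normalized gradient norm. Before the target is
    reached this norm exceeds the one for [eps_g], which bounds [j]. *)
Lemma newton_phaseS j k : ~ target k -> Dmin <= Delta k -> newton_phase j k ->
  [/\ succ k, newton_phase j.+1 k.+1 & j.+1%:R <= 1 + loglog2 A].
Proof.
move=> nt Dk [k3 ggd gT ej].
have sgn : sn k <= gn k / gamma by rewrite ler_pdivlMr// mulrC; exact: R3_step.
have sn0 : 0 <= sn k := tnorm_ge0 _ _.
have s2 : sn k ^+ 2 <= (gn k / gamma) ^+ 2.
  by rewrite lerXn2r ?nnegrE// divr_ge0// ltW.
have [sk gq trap] := short_step nt Dk k3 (le_lt_trans s2 gT).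
have e0 : 0 <= e k by rewrite /e mulr_ge0// ltW.
have ee : e k.+1 <= e k ^+ 2.
  have -> : e k ^+ 2 = q / (2 * gamma ^+ 2) * (q / 2 * (gn k / gamma) ^+ 2).
    by rewrite /e; field; rewrite gt_eqF.
  rewrite /e ler_pM2l//; apply: le_trans gq _.
  by rewrite ler_pM2l// divr_gt0.
have two0 m : 0 < (2 : R) ^+ m by rewrite exprn_gt0.
have e1 : e k <= 1.
  by apply: le_trans ej _; rewrite invf_le1// exprn_ege1// ler1n.
have gle : gn k.+1 <= gn k.
  have : e k.+1 <= e k by apply: le_trans ee _; rewrite expr2 ler_piMl.
  by rewrite /e ler_pM2l.
split=> //.
  split; first exact: trap.
  - exact: le_lt_trans gle ggd.
  - apply: le_lt_trans gT; rewrite lerXn2r ?nnegrE ?divr_ge0 ?(ltW ga0)//.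
    by rewrite ler_pM2r ?invr_gt0.
  - apply: le_trans ee _; rewrite expnSr exprM -exprVn.
    by rewrite lerXn2r ?nnegrE ?invr_ge0 ?(ltW (two0 _)).
rewrite -natr1 addrC lerD2l; apply: quadratic_steps.
rewrite /A ltr_pdivlMr ?mulr_gt0// -ltr_pdivlMl ?two0//.
have : q / (2 * gamma ^+ 2) * eps_g < (2 ^+ (2 ^ j))^-1.
  by apply: lt_le_trans ej; rewrite /e ltr_pM2l//; exact: R3_nontarget.
have gg0 : 0 < 2 * gamma ^+ 2 by rewrite mulr_gt0// exprn_gt0.
by rewrite mulrAC ltr_pdivrMr.
Qed.

(** [u] counts the long successful steps. Each of them pays for itself and for one
    short step before it. The cases are: everything is paid for; one short step is
    to be paid for by the long step to come; the final phase, in which the short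
    steps are counted by [j] and one of them precedes the phase. *)
Definition rtr_invariant k := exists u : nat,
  [/\ u%:R * D <= f x0 - f (x k), Dmin <= Delta k &
   [\/ (nsucc k <= 2 * u)%N,
      (nsucc k <= (2 * u).+1)%N /\ (R1 (x k) \/ R2 (x k)) |
      exists j, [/\ (nsucc k <= (2 * u).+1 + j)%N, j%:R <= 1 + loglog2 A & newton_phase j k]]].

Lemma rtr_invariant0 : rtr_invariant 0%N.
Proof.
exists 0%N; rewrite mul0r (run_x0 run) subrr; split=> //; first exact: radius_init.
by apply: Or31; rewrite /nsucc /successful_before big_ord0.
Qed.

Lemma invariant_long_step k u : Dmin <= Delta k -> ~ target k -> long_step k ->
  u%:R * D <= f x0 - f (x k) -> (nsucc k <= (2 * u).+1)%N -> succ k -> rtr_invariant k.+1.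
Proof.
move=> Dk nt lk fu nu sk; exists u.+1; split.
- have := long_step_success Dk lk sk; rewrite -natr1 mulrDl mul1r.
  by move: fu; move: (u%:R * D) D (f x0) (f (x k)) (f (x k.+1)) => v1 v2 v3 v4 v5; lra.
- exact: radius_next.
- by apply: Or31; rewrite nsuccS sk addn1 mulnS add2n ltnS.
Qed.

Lemma invariant_failure k : ~ target k -> rtr_invariant k -> ~~ succ k -> rtr_invariant k.+1.
Proof.
move=> nt [u [fu Dk nu]] sk; have [_ xk] := radius_failure sk.
exists u; rewrite /newton_phase /e /gn nsuccS (negbTE sk) addn0 xk; split=> //.
exact: radius_next.
Qed.

Lemma rtr_invariantS k : ~ target k -> rtr_invariant k -> rtr_invariant k.+1.
Proof.
move=> nt Ik; have [sk|sk] := boolP (succ k); last exact: invariant_failure.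
have [u [fu Dk cases]] := Ik.
have Dk1 := radius_next nt Dk.
have fu1 : u%:R * D <= f x0 - f (x k.+1).
  by apply: le_trans fu _; rewrite lerD2l lerN2; exact: step_decrease.
have long_free : long_step k -> (nsucc k <= (2 * u).+1)%N -> rtr_invariant k.+1.
  by move=> lk nu; exact: (invariant_long_step Dk nt lk fu nu sk).
case: cases => [nu|[nu [k1|k2]]|[j [nu jA lj]]].
- have nu1 : (nsucc k <= (2 * u).+1)%N by exact: leqW.
  have [k1|k2|k3] := strict_saddleP (x k).
  + by apply: long_free => //; apply: Or31.
  + by apply: long_free => //; apply: Or32.
  have [sT|sT] := leP T2 (sn k ^+ 2).
    by apply: long_free => //; apply: Or33.
  have [_ [k12|lk]] := short_step_newton_phase nt Dk k3 sT; exists u; split=> //.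
    by apply: Or32; rewrite nsuccS sk addn1 ltnS.
  apply: Or33; exists 0%N; split=> //; first by rewrite addn0 nsuccS sk addn1 ltnS.
  by rewrite addr_ge0// /loglog2 le_max lexx.
- by apply: long_free => //; apply: Or31.
- by apply: long_free => //; apply: Or32.
- have [_ lk jA1] := newton_phaseS nt Dk lj.
  exists u; split=> //; apply: Or33; exists j.+1; split=> //.
  by rewrite nsuccS sk addn1 addnS ltnS.
Qed.

Lemma invariant_bound k : rtr_invariant k ->
  (nsucc k)%:R <= 2 * (f x0 - fstar) / D + 2 + loglog2 A.
Proof.
move=> [u [fu _ cases]].
have uD : 2 * u%:R <= 2 * (f x0 - fstar) / D.
  rewrite ler_pdivlMr// -mulrA ler_pM2l//; apply: le_trans fu _.
  by rewrite lerD2l lerN2.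
have l0 : 0 <= loglog2 A by rewrite /loglog2 le_max lexx.
have [j [nu jA]] : exists j, (nsucc k <= (2 * u).+1 + j)%N /\ j%:R <= 1 + loglog2 A.
  have jz : (0%N)%:R <= 1 + loglog2 A by rewrite addr_ge0.
  case: cases => [nu|[nu _]|[j [nu jA _]]]; [exists 0%N|exists 0%N|by exists j].
    by rewrite addn0 leqW.
  by rewrite addn0.
apply: (@le_trans _ _ ((2 * u).+1 + j)%:R); first by rewrite ler_nat.
rewrite natrD -natr1 natrM; move: uD jA.
by move: (_ / D) (loglog2 A) (u%:R) (j%:R) => v1 v2 v3 v4; lra.
Qed.

Lemma leq_nsucc k l : (k <= l)%N -> (nsucc k <= nsucc l)%N.
Proof.
move=> kl; rewrite -(subnKC kl); elim: (l - k)%N => [|i IH]; first by rewrite addn0.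
by rewrite addnS nsuccS; apply: leq_trans IH (leq_addr _ _).
Qed.

Lemma eventually_rejected (B : nat) : (forall k, (nsucc k <= B)%N) ->
  exists K, forall k, (K <= k)%N -> ~~ succ k.
Proof.
move=> bnd; pose P m := `[< exists k, nsucc k = m >].
have exP : exists m, P m by exists (nsucc 0%N); apply/asboolP; exists 0%N.
have ubP m : P m -> (m <= B)%N by move=> /asboolP[k <-].
have [m /asboolP[K Km] mmax] := ex_maxnP exP ubP.
exists K => k Kk; apply/negP => sk.
have : (nsucc k.+1 <= m)%N by apply: mmax; apply/asboolP; exists k.+1.
by rewrite nsuccS sk addn1 -Km ltnNge leq_nsucc.
Qed.

(** The radius is then a geometric sequence. *)
Lemma radius_rejected K : (forall k, (K <= k)%N -> ~~ succ k) ->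
  exists k, (K <= k)%N /\ Delta k < Dmin.
Proof.
move=> rejK; have Deltaj j : Delta (K + j)%N = tau1 ^+ j * Delta K.
  elim: j => [|j IH]; first by rewrite addn0 mul1r.
  by rewrite addnS (radius_failure (rejK _ (leq_addr _ _))).1 IH exprS mulrA.
have tau_norm : `|tau1| < 1 by case/andP: t1 => _; rewrite ger0_norm// ltW.
have eps0 : 0 < Dmin / Delta K by exact: divr_gt0.
have /cvgr0Pnorm_lt /(_ _ eps0) [j _ /(_ j (leqnn j))] := cvg_expr tau_norm.
rewrite ger0_norm ?exprn_ge0 ?(ltW tau0)// => tj.
exists (K + j)%N; split; first exact: leq_addr.
by rewrite Deltaj -ltr_pdivlMr.
Qed.

(** If the target were never reached, the invariant would hold forever. The number
    of successful iterations would be bounded, from some iteration on all steps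
    would be rejected, and the radius would tend to 0, contradicting its lower
    bound. *)
Lemma rtr_iteration_bound : exists k,
  target k /\ (nsucc k)%:R <= 2 * (f x0 - fstar) / D + 2 + loglog2 A.
Proof.
have invk k : (forall j, (j < k)%N -> ~ target j) -> rtr_invariant k.
  elim: k => [|k IH] nt; first exact: rtr_invariant0.
  by apply: rtr_invariantS; [exact: nt|apply: IH => j jk; apply: nt; exact: ltnW].
have exT : exists k, `[< target k >].
  apply: contrapT => noT.
  have nt k : ~ target k by move=> tk; apply: noT; exists k; exact/asboolP.
  have inv_all k : rtr_invariant k by exact: invk.
  pose B := Num.bound `|2 * (f x0 - fstar) / D + 2 + loglog2 A|.
  have [K rejK] : exists K, forall k, (K <= k)%N -> ~~ succ k.
    apply: (eventually_rejected (B := B)) => k.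
    rewrite -(ler_nat R); apply: le_trans (invariant_bound (inv_all k)) _.
    exact: ltW (le_lt_trans (ler_norm _) (archi_boundP (normr_ge0 _))).
  have [k [_ Dk]] := radius_rejected rejK.
  by have [u [_]] := inv_all k; rewrite leNgt Dk.
have [k /asboolP tk kmin] := ex_minnP exT.
exists k; split=> //; apply: invariant_bound; apply: invk => j jk tj.
by move: jk; rewrite ltnNge kmin//; exact/asboolP.
Qed.

End TrustRegionRun.

Theorem theorem3p16 (R : realType) :
  exists C : R -> R -> R -> R -> R -> R -> R -> R -> R -> R,
  (forall kappa_H cDelta Delta0 nu_R kappa_R Lhat_H eta1 cQ gap,
     0 < C kappa_H cDelta Delta0 nu_R kappa_R Lhat_H eta1 cQ gap) /\
  forall (n : nat) (M : riemannian_manifold R n) (f : M -> R)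
    (retr : M -> 'rV[R]_n -> M) (rad : M -> \bar R)
    (alpha beta gamma delta : R)
    (x0 : M) (Delta0 Deltabar eta1 eta2 tau1 tau2 : R)
    (x : nat -> M) (Delta : nat -> R) (s : nat -> 'rV[R]_n)
    (L_H kappa_H fstar Lhat_H kappa_R nu_R nu_S kappa_S eps_g eps_H : R),
  (0 < n)%N ->
  C2_on_manifold f ->
  is_retraction retr rad ->
  second_order_retraction retr ->
  0 < alpha -> 0 < beta -> 0 < gamma -> 0 < delta ->
  strict_saddle f alpha beta gamma delta ->
  compact (region3 f gamma delta) ->
  0 < Delta0 < Deltabar ->
  0 < eta1 -> eta1 < eta2 -> eta2 < 1 ->
  0 < tau1 < 1 -> 1 < tau2 ->
  rtr_run f retr x0 Delta0 Deltabar eta1 eta2 tau1 tau2 x Delta s ->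
  0 < L_H ->
  pullback_cubic_bound f retr rad L_H x ->
  (forall k, ((Delta k)%:E <= rad (x k))%E) ->
  0 < kappa_H ->
  (forall k, opnorm (x k) (pullback_hess f retr (x k) 0) <= kappa_H) ->
  (forall y, fstar <= f y) ->
  0 < Lhat_H ->
  (forall k, region3 f gamma delta (x k) ->
     tnorm (x k) (pullback_grad f retr (x k) (s k) -
                  pullback_grad f retr (x k) 0 -
                  s k *m pullback_hess f retr (x k) 0)
       <= Lhat_H / 2 * tnorm (x k) (s k) ^+ 2) ->
  1 < kappa_R -> 0 < nu_R ->
  (forall y v, region3 f gamma delta y -> tnorm y v <= nu_R ->
     ((tnorm y v)%:E <= rad y)%E ->
     tnorm (retr y v) (grad f (retr y v))
       <= kappa_R * tnorm y (pullback_grad f retr y v)) ->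
  0 < nu_S -> 0 < kappa_S ->
  (forall y v, region3 f gamma delta y -> tnorm y v <= nu_S ->
     ((tnorm y v)%:E <= rad y)%E ->
     (dist y (retr y v) <= (kappa_S * tnorm y v)%:E)%E) ->
  0 < eps_g -> 0 < eps_H ->
  exists k : nat,
    [/\ tnorm (x k) (grad f (x k)) <= eps_g,
        lambda_min (hess f (x k)) >= - eps_H &
        (successful_before f retr eta1 x s k)%:R <=
          C kappa_H (c_Delta eta1 tau1 L_H kappa_H) Delta0 nu_R kappa_R Lhat_H
            eta1 (c_Q eta1 L_H nu_R kappa_S kappa_R Lhat_H) (f x0 - fstar)
            / saddle_min alpha beta gamma delta
          + 1 + loglog2 (2 * gamma ^+ 2 / (kappa_R * Lhat_H * eps_g))].
Proof.
exists (fun kappa cD D0 nu kR L eta cQ gap =>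
  iteration_constant kappa cD D0 cQ nu kR L eta gap); split=> [*|].
  by rewrite /iteration_constant ltr_pwDl.
move=> n M f retr rad alpha beta gamma delta x0 Delta0 Deltabar eta1 eta2 tau1 tau2.
move=> x Delta s L_H kappa_H fstar Lhat kappa_R nu_R nu_S kappa_S eps_g eps_H.
move=> _ f2 ret ret2 al0 be0 ga0 de0 saddle _ D00 e10 e12 e21 t1 t2 run L0 cubic Drad.
move=> k0 Hk fs Lh0 HLhat kR1 nR0 HkR _ kS0 _ eg0 eH0.
have [k [[gk hk] nk]] := rtr_iteration_bound f2 ret ret2 al0 be0 ga0 de0 saddle D00
  e10 e12 e21 t1 t2 run L0 cubic Drad k0 Hk fs Lh0 HLhat kR1 nR0 HkR kS0 eg0 eH0.
exists k; split=> //; apply: le_trans nk _.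
have [S0 S1 _] := saddle_min_bounds al0 be0 ga0 de0.
set L := loglog2 _; set S := saddle_min _ _ _ _ in S0 S1 *.
rewrite /rtr_unit_decrease /iteration_constant.
set c := decrease_factor _ _ _ _; rewrite -/S.
have -> : eta1 * (2^-1 * (c * S)) = eta1 * (2^-1 * c) * S by rewrite !mulrA.
rewrite invfM mulrA; set W := 2 * _ / _.
have WS : W / S + 1 <= (1 + `|W + 1|) / S.
  rewrite ler_pdivlMr// mulrDl divfK ?gt_eqF// mul1r.
  by have := ler_norm (W + 1); move: S1; move: (`|W + 1|) (W) (S) => u v w; lra.
by move: WS; move: (W / S) (_ / S) (L) => u v w; lra.
Qed.
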